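(* Let $X$ be a rearrangement-invariant Banach function space over a $\sigma$-finite and resonant measure space $(\mathcal{R},\mu)$, and let $X'$ be the corresponding associate space. Assume that $X$ has absolutely continuous norm and that $X'$ has the (ACR) property. Assume that the measurable mapping $\phi\colon\mathcal{R}\to\mathcal{R}$ has the property that there is some $A\in(0,\infty)$ such that for every $n\in\mathbb{N}$, $n\ge 1$, $$\mu(\phi^{-n}(E))\le A\,\mu(E)\quad\text{for every measurable }E\subseteq\mathcal{R}.$$ Then the composition operator $T_\phi f=f\circ\phi$ is mean ergodic on $(X,\lVert\cdot\rVert_X)$, i.e. there is some continuous linear operator $T\colon X\to X$ such that for every $f\in X$ $$\frac1n\sum_{i=0}^{n-1}T_\phi^i f\to Tf\quad\text{in }(X,\lVert\cdot\rVert_X)\text{ as }n\to\infty. \qquad ( * )$$ Furthermore, $T$ is positive, and there exists the associate operator $T'\colon X'\to X'$, which is also continuous. Moreover, $T$ is a projection onto $\operatorname{Ker}(I-T_\phi)$, while $I-T$ is a projection onto $\overline{\operatorname{Im}(I-T_\phi)}^{\lVert\cdot\rVert_X}$, and $$X=\operatorname{Ker}(I-T_\phi)\oplus\overline{\operatorname{Im}(I-T_\phi)}^{\lVert\cdot\rVert_X}. \qquad ( ** )$$ Finally, if (all other assumptions being kept) the space $X$ does not have absolutely continuous norm but it has the (ACR) property, then the limit operator $T$ still exists; however, the convergence in $( * )$ holds only for those functions that themselves have absolutely continuous norm; for other functions the Ces\`aro means converge to the limit operator (i.e. to $Tf$) with respect to a locally convex topology $\xi$ on $X$ that is weaker than the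 norm topology but stronger than the weak topology $\sigma(X,X')$. Also, in this case, $I-T$ is a projection onto the a priori larger set $\overline{\operatorname{Im}(I-T_\phi)}^{\xi}$, and the closure on the right-hand side of $( ** )$ must likewise be taken with respect to the topology $\xi$.
   Context: $\mathbb{N}$ contains $0$. $\mathcal{M}=\mathcal{M}(\mathcal{R},\mu)$ is the set of extended complex-valued $\mu$-measurable functions on $\mathcal{R}$ (identified when equal $\mu$-a.e.), $\mathcal{M}_+$ the non-negative ones; $\lambda$ is Lebesgue measure. For $f\in\mathcal{M}$ put $f_*(s)=\mu(\{|f|>s\})$ and $f^*(t)=\inf\{s\ge0:\ f_*(s)\le t\}$, $s,t\in[0,\infty)$ (non-increasing rearrangement). A $\sigma$-finite $(\mathcal{R},\mu)$ is resonant if $\sup_{\tilde g\in\mathcal{M},\,\tilde g^*=g^*}\int_{\mathcal{R}}|f\tilde g|\,d\mu=\int_0^\infty f^*g^*\,d\lambda$ for all $f,g\in\mathcal{M}$ (equivalently, it is non-atomic, or completely atomic with all atoms of equal measure). A Banach function norm is a map $\lVert\cdot\rVert\colon\mathcal{M}\to[0,\infty]$ with $\lVert\,|f|\,\rVert=\lVert f\rVert$ whose restriction to $\mathcal{M}_+$ satisfies: (P1) it is absolutely homogeneous, vanishes exactly at $f=0$ a.e., and is subadditive; (P2) $f\le g$ a.e. implies $\lVert f\rVert\le\lVert g\rVert$; (P3) $f_n\uparrow f$ a.e. implies $\lVert f_n\rVert\uparrow\lVert f\rVert$; (P4) $\lVert\chi_E\rVert<\infty$ if $\mu(E)<\infty$;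 (P5) if $\mu(E)<\infty$ there is a finite $C_E$ with $\int_E f\,d\mu\le C_E\lVert f\rVert$ for all $f\in\mathcal{M}_+$. It is rearrangement-invariant (r.i.) if $f^*=g^*$ implies $\lVert f\rVert=\lVert g\rVert$. The corresponding (r.i.) Banach function space is $X=\{f\in\mathcal{M}:\lVert f\rVert_X<\infty\}$. The associate space $X'$ is defined by the same recipe from $\lVert f\rVert_{X'}=\sup_{\lVert g\rVert_X\le1}\int_{\mathcal{R}}|fg|\,d\mu$. A function $f\in X$ has absolutely continuous norm if $\lVert f\chi_{E_k}\rVert_X\to0$ for every sequence of measurable sets with $\chi_{E_k}\to0$ $\mu$-a.e.; $X$ has absolutely continuous norm if every $f\in X$ does. An r.i. space $Y$ has the (ACR) property if $\lim_{t\to\infty}f^*(t)=0$ for every $f\in Y$. $\phi^n$ is the $n$-fold composition and $\phi^{-n}(E)$ the preimage of $E$ under $\phi^n$. An operator is positive if it maps non-negative functions to non-negative functions. Operators $T$ on $X$ and $T'$ on $X'$ are mutually associate if $\int_{\mathcal{R}}T(f)\varphi\,d\mu=\int_{\mathcal{R}}f\,T'(\varphi)\,d\mu$ for all $f\in X$, $\varphi\in X'$; $T'$ is then the associate operator of $T$. Continuity without a specified topology refers to the norm topology. The topology $\xi$ on $X$ is the locally convex topology induced by the family $\{|\cdot|_\varphi:\varphi\in X'\}$, where $|f|_\varphi=\int_0^\infty\varphi^*f^*\,d\lambda$. $\sigma(X,X')$ is the weak topology on $X$ induced by $X'$ via $f\mapsto\int_{\mathcal{R}}\varphi f\,d\mu$.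 ''Weaker''/''stronger'' are understood non-strictly. *)

(* Defs.v *)
From mathcomp Require Import all_boot all_order all_algebra.
From mathcomp Require Import complex.
From mathcomp Require Import all_classical all_reals all_analysis.
Import Order.TTheory GRing.Theory Num.Theory ComplexField.Normc.
Import numFieldNormedType.Exports.

Set Implicit Arguments.
Unset Strict Implicit.
Unset Printing Implicit Defensive.

Local Open Scope classical_set_scope.
Local Open Scope ring_scope.
Local Open Scope ereal_scope.

(* The extended complex numbers: C together with a single point at infinity,
   which also plays the role of +oo for functions with values in [0, +oo].
   The arithmetic at infinity is conventional (0 * oo = 0, and oo + z = oo for
   every z); it only matters on null sets for functions of finite norm. *)
Inductive xcomplex (R : realType) : Type := XFin of R[i] | XInf.
Arguments XInf {R}.

Section ExtendedComplex.
Context {R : realType}.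
Implicit Types z w : xcomplex R.

Definition xabs z : \bar R := if z is XFin a then (normc a)%:E else +oo.

(* The modulus again, as an extended complex number. *)
Definition xmod z : xcomplex R := if z is XFin a then XFin `|a|%R else XInf.

Definition xRe z : R := if z is XFin a then complex.Re a else 0%R.
Definition xIm z : R := if z is XFin a then complex.Im a else 0%R.

Definition xzero : xcomplex R := XFin 0%R.

Definition xadd z w : xcomplex R :=
  match z, w with XFin a, XFin b => XFin (a + b)%R | _, _ => XInf end.

Definition xmul z w : xcomplex R :=
  match z, w with
  | XFin a, XFin b => XFin (a * b)%R
  | XFin a, XInf | XInf, XFin a => if a == 0%R then xzero else XInf
  | XInf, XInf => XInf
  end.

Definition xscale (a : R[i]) z : xcomplex R := xmul (XFin a) z.

Definition xsub z w : xcomplex R := xadd z (xscale (-1)%R w).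

Definition xnonneg z : Prop := if z is XFin a then (0 <= a)%R else True.

End ExtendedComplex.

Section MeasurableFunctions.
Context {R : realType} {d : measure_display} {T : measurableType d}.
Variable mu : {measure set T -> \bar R}.
Implicit Types f g : T -> xcomplex R.

(* Borel measurability for the one-point compactification of C. *)
Definition Mfun f : Prop :=
  [/\ measurable [set x | f x = XInf],
      measurable_fun setT (fun x => xRe (f x)) &
      measurable_fun setT (fun x => xIm (f x))].

Definition Mplus f : Prop := Mfun f /\ forall x, xnonneg (f x).

(* The members of the function spaces below are functions; equality in M is
   equality almost everywhere. *)
Definition eq_ae f g : Prop := {ae mu, forall x, f x = g x}.

Definition fzero : T -> xcomplex R := fun=> xzero.
Definition fadd f g : T -> xcomplex R := fun x => xadd (f x) (g x).
Definition fsub f g : T -> xcomplex R := fun x => xsub (f x) (g x).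
Definition fmul f g : T -> xcomplex R := fun x => xmul (f x) (g x).
Definition fscale (a : R[i]) f : T -> xcomplex R := fun x => xscale a (f x).
Definition fmod f : T -> xcomplex R := fun x => xmod (f x).

Definition charfun (E : set T) : T -> xcomplex R :=
  fun x => XFin ((\1_E x : R)%:C)%C.

Definition distrib_fun f (s : R) : \bar R := mu [set x | s%:E < xabs (f x)].

Definition rearr f (t : R) : \bar R :=
  ereal_inf [set s%:E | s in [set s : R | (0 <= s)%R /\ distrib_fun f s <= t%:E]].

Definition equimeasurable f g : Prop :=
  forall t : R, (0 <= t)%R -> rearr f t = rearr g t.

Definition int_abs_mul f g : \bar R := \int[mu]_x xabs (fmul f g x).

Definition int_rearr_mul f g : \bar R :=
  \int[lebesgue_measure]_(t in `[0%R, +oo[) (rearr f t * rearr g t).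

Definition resonant : Prop := forall f g, Mfun f -> Mfun g ->
  ereal_sup [set int_abs_mul f h | h in [set h | Mfun h /\ equimeasurable h g]]
  = int_rearr_mul f g.

(* The integral of a complex-valued function; it is meaningful when |f| is
   integrable, in which case f is infinite only on a null set. *)
Definition cintegral f : R[i] :=
  Complex (\int[mu]_x xRe (f x))%R (\int[mu]_x xIm (f x))%R.

End MeasurableFunctions.

Section BanachFunctionSpaces.
Context {R : realType} {d : measure_display} {T : measurableType d}.
Variable mu : {measure set T -> \bar R}.
Implicit Types f g : T -> xcomplex R.

(* The order of M_+ is that of the moduli. *)
Record banach_function_norm (rho : (T -> xcomplex R) -> \bar R) : Prop := {
  bfn_ge0 : forall f, Mfun f -> 0 <= rho f;
  bfn_mod : forall f, Mfun f -> rho (fmod f) = rho f;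
  bfn_P1_homogeneous : forall (a : R[i]) f, Mplus f ->
    rho (fscale a f) = (normc a)%:E * rho f;
  bfn_P1_definite : forall f, Mplus f -> (rho f = 0 <-> eq_ae mu f fzero);
  bfn_P1_subadditive : forall f g, Mplus f -> Mplus g ->
    rho (fadd f g) <= rho f + rho g;
  bfn_P2 : forall f g, Mplus f -> Mplus g ->
    {ae mu, forall x, xabs (f x) <= xabs (g x)} -> rho f <= rho g;
  bfn_P3 : forall (u : nat -> T -> xcomplex R) f,
    (forall n, Mplus (u n)) -> Mplus f ->
    {ae mu, forall x, (forall n, xabs (u n x) <= xabs (u n.+1 x)) /\
                      xabs (u n x) @[n --> \oo] --> xabs (f x)} ->
    (forall n, rho (u n) <= rho (u n.+1)) /\
    rho (u n) @[n --> \oo] --> rho f;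
  bfn_P4 : forall E, measurable E -> mu E < +oo -> rho (charfun E) < +oo;
  bfn_P5 : forall E, measurable E -> mu E < +oo ->
    exists C : R, forall f, Mplus f ->
      \int[mu]_(x in E) xabs (f x) <= C%:E * rho f
}.

Definition ri_norm (rho : (T -> xcomplex R) -> \bar R) : Prop :=
  banach_function_norm rho /\
  forall f g, Mfun f -> Mfun g -> equimeasurable mu f g -> rho f = rho g.

Definition bfspace (rho : (T -> xcomplex R) -> \bar R) : set (T -> xcomplex R) :=
  [set f | Mfun f /\ rho f < +oo].

Definition assoc_norm (rho : (T -> xcomplex R) -> \bar R) f : \bar R :=
  ereal_sup [set int_abs_mul mu f g | g in [set g | Mfun g /\ rho g <= 1]].

Definition has_acn (rho : (T -> xcomplex R) -> \bar R) f : Prop :=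
  forall E : nat -> set T, (forall k, measurable (E k)) ->
    {ae mu, forall x, (\1_(E k) x : R) @[k --> \oo] --> (0 : R)%R} ->
    rho (fmul f (charfun (E k))) @[k --> \oo] --> 0.

Definition space_has_acn (rho : (T -> xcomplex R) -> \bar R) : Prop :=
  forall f, bfspace rho f -> has_acn rho f.

Definition has_ACR (rho : (T -> xcomplex R) -> \bar R) : Prop :=
  forall f, bfspace rho f -> rearr mu f t @[t --> +oo%R] --> 0.

End BanachFunctionSpaces.

Section InducedTopologies.
Context {R : realType} {d : measure_display} {T : measurableType d}.
Implicit Types (f g : T -> xcomplex R) (X : set (T -> xcomplex R)).
Implicit Types S : set ((T -> xcomplex R) -> \bar R).

Definition seminorm_on X (p : (T -> xcomplex R) -> \bar R) : Prop :=
  [/\ forall f, X f -> 0 <= p f < +oo,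
      forall (a : R[i]) f, X f -> p (fscale a f) = (normc a)%:E * p f &
      forall f g, X f -> X g -> p (fadd f g) <= p f + p g].

(* Neighbourhoods, within X, in the topology induced by the family S of
   seminorms: finite intersections of balls form a base. *)
Definition lc_nbhs X S f : set_system (T -> xcomplex R) := fun U =>
  exists (k : nat) (p : 'I_k -> (T -> xcomplex R) -> \bar R) (e : R),
    [/\ forall j, S (p j), (0 < e)%R &
        forall g, X g -> (forall j, p j (fsub g f) < e%:E) -> U g].

Definition lc_open X S (U : set (T -> xcomplex R)) : Prop :=
  U `<=` X /\ forall f, U f -> lc_nbhs X S f U.

Definition lc_closure X S (A : set (T -> xcomplex R)) : set (T -> xcomplex R) :=
  [set f | X f /\ forall U, lc_nbhs X S f U -> A `&` U !=set0].

Definition lc_cvg X S (u : nat -> T -> xcomplex R) f : Prop :=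
  forall U, lc_nbhs X S f U -> \forall n \near \oo, U (u n).

Definition lc_continuous X S (P : (T -> xcomplex R) -> T -> xcomplex R) : Prop :=
  forall f, X f -> forall U, lc_nbhs X S (P f) U -> lc_nbhs X S f (P @^-1` U).

Definition lc_weaker X S1 S2 : Prop := forall U, lc_open X S1 U -> lc_open X S2 U.

End InducedTopologies.

Section Operators.
Context {R : realType} {d : measure_display} {T : measurableType d}.
Variable mu : {measure set T -> \bar R}.
Implicit Types (f g : T -> xcomplex R) (X K L : set (T -> xcomplex R)).
Implicit Types P Q : (T -> xcomplex R) -> T -> xcomplex R.

(* Operators act on all functions, but only their action on X, modulo equality
   almost everywhere, is meaningful. *)
Definition linear_operator X P : Prop :=
  [/\ forall f, X f -> X (P f),
      forall f g, X f -> X g -> eq_ae mu f g -> eq_ae mu (P f) (P g) &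
      forall (a : R[i]) f g, X f -> X g ->
        eq_ae mu (P (fadd (fscale a f) g)) (fadd (fscale a (P f)) (P g))].

Definition continuous_operator (rho : (T -> xcomplex R) -> \bar R) P : Prop :=
  linear_operator (bfspace rho) P /\ lc_continuous (bfspace rho) [set rho] P.

Definition positive_operator X P : Prop := forall f, X f ->
  {ae mu, forall x, xnonneg (f x)} -> {ae mu, forall x, xnonneg (P f x)}.

Definition mutually_associate (rho : (T -> xcomplex R) -> \bar R) P P' : Prop :=
  forall f g, bfspace rho f -> bfspace (assoc_norm mu rho) g ->
    cintegral mu (fmul (P f) g) = cintegral mu (fmul f (P' g)).

Definition id_sub P : (T -> xcomplex R) -> T -> xcomplex R := fun f => fsub f (P f).

Definition op_ker X P : set (T -> xcomplex R) := [set f | X f /\ eq_ae mu (P f) fzero].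

Definition op_im X P : set (T -> xcomplex R) :=
  [set g | X g /\ exists2 f, X f & eq_ae mu g (P f)].

Definition projection_onto X P K : Prop :=
  [/\ linear_operator X P,
      forall f, X f -> eq_ae mu (P (P f)) (P f),
      forall f, X f -> K (P f) &
      forall g, K g -> exists2 f, X f & eq_ae mu g (P f)].

Definition subspace X K : Prop :=
  [/\ K `<=` X, K fzero &
      forall (a : R[i]) f g, K f -> K g -> K (fadd (fscale a f) g)].

Definition direct_sum X K L : Prop :=
  [/\ subspace X K, subspace X L,
      forall f, X f -> exists g h, [/\ K g, L h & eq_ae mu f (fadd g h)] &
      forall f, K f -> L f -> eq_ae mu f fzero].

Definition composition_operator (phi : T -> T) : (T -> xcomplex R) -> T -> xcomplex R :=
  fun f x => f (phi x).

Definition cesaro_mean P f (n : nat) : T -> xcomplex R :=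
  fun x => xscale (n%:R^-1)%R (\big[xadd/xzero]_(i < n) iter i P f x).

Definition norm_family (rho : (T -> xcomplex R) -> \bar R) :
  set ((T -> xcomplex R) -> \bar R) := [set rho].

Definition xi_family (rho : (T -> xcomplex R) -> \bar R) :
    set ((T -> xcomplex R) -> \bar R) :=
  [set int_rearr_mul mu g | g in bfspace (assoc_norm mu rho)].

Definition weak_family (rho : (T -> xcomplex R) -> \bar R) :
    set ((T -> xcomplex R) -> \bar R) :=
  [set (fun f => (normc (cintegral mu (fmul g f)))%:E)
     | g in bfspace (assoc_norm mu rho)].

End Operators.

(* Main.v *)
From HB Require Import structures.
Require Import Defs.
From mathcomp Require Import all_boot all_order all_algebra.
From mathcomp Require Import complex ring lra.
From mathcomp Require Import all_classical all_reals all_analysis measurable_realfun.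
Import Order.TTheory GRing.Theory Num.Theory ComplexField.Normc.
Import numFieldNormedType.Exports.

Set Implicit Arguments.
Unset Strict Implicit.
Unset Printing Implicit Defensive.

Local Open Scope classical_set_scope.
Local Open Scope ring_scope.
Local Open Scope ereal_scope.

(** Why the averages converge. The norm is a function of the modulus, and the
    averages act separately on real and imaginary parts, so that one works with real
    functions and with seminorms on non-negative ones. Two kinds of seminorms matter: the norm,
    and the pairings [u |-> int u^* v^*] with [v] in the associate space, which define [xi]. The
    hypothesis on [phi] says that the level sets of [f o phi^n] are at most [A] times as large as
    those of [f]. Hence the averages are uniformly bounded for the pairings ([rdot_dilate]), which
    are integrals of minima of distribution functions. They are then bounded for the norm
    ([norm_dilate]), because a Banach function norm is determined by its associate norm
    ([lorentz_luxemburg]); that duality is obtained from closest points in the Hilbert space of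
    square-integrable functions.

    On square-integrable functions the averages are Cauchy in mean square ([hilbert_ergodic]),
    by a convexity argument with the parallelogram identity. A function which is dominated by a
    multiple of an integrable weight has averages that are uniformly bounded and bounded in the
    mean, and for such functions a small mean square makes every pairing small
    ([small_rdot]); here functions of the associate space must vanish at infinity. The same
    holds for the norm as soon as one nonzero function has absolutely continuous norm
    ([small_norm]): resonance moves small sets below a level set of that function. Approximating an
    arbitrary function by dominated ones, with respect to the pairings or to the norm, shows that
    its averages are Cauchy. The limit of an almost everywhere convergent subsequence is the limit
    for all these seminorms at once ([limit_avg_exists]). An absolutely continuous norm forces
    the functions of the space to vanish at infinity ([acn_vanishing]), so that both parts
    of the theorem are instances of one statement.

    The limit operator is linear, positive and bounded, fixes exactly the functions invariant
    under [phi], and kills the coboundaries [h - h o phi]. Being bounded for each pairing, it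
    kills their closure for [xi], hence also for the norm; conversely [f] minus its
    averages is a coboundary that converges to [f - P f] ([closureE]). This gives the two
    projections and the direct sum. For the associate operator, the functional
    [f |-> int (P f) h] is dominated by the pairing with [|h|]; by dominated convergence for
    the pairings ([dominated_rdot]) it defines a signed measure on weighted indicators, whose
    Radon-Nikodym density yields the associate of [h] ([dominated_functional_density]). *)

(** * Non-negative measurable functions *)

Lemma cvge_le {R : realType} (u : nat -> \bar R) (l b : \bar R) :
  u n @[n --> \oo] --> l -> (forall n, u n <= b) -> l <= b.
Proof.
move=> ul ub; have <- : limn u = l by exact/cvg_lim.
by apply: lime_le; [exact: cvgP ul | exact: nearW].
Qed.

Lemma cvge_near_lt {R : realType} (u : nat -> \bar R) (l b : \bar R) :
  u n @[n --> \oo] --> l -> l < b -> \forall n \near \oo, u n < b.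
Proof.
move=> ul lb; suff lbs : nbhs l [set y | y < b] by exact: ul lbs.
apply: open_nbhs_nbhs; split => //; exact: open_ereal_lt_ereal.
Qed.

Section NonnegativeFunctions.
Context {R : realType} {d : measure_display} {T : measurableType d}.
Implicit Types u v w : T -> \bar R.

Definition nnmeas u : Prop := measurable_fun setT u /\ forall x, 0 <= u x.

Lemma nnmeasD u v : nnmeas u -> nnmeas v -> nnmeas (fun x => u x + v x).
Proof.
move=> [mu u0] [mv v0]; split; first exact: emeasurable_funD.
by move=> x; exact: adde_ge0.
Qed.

Lemma nnmeasM u v : nnmeas u -> nnmeas v -> nnmeas (fun x => u x * v x).
Proof.
move=> [mu u0] [mv v0]; split; first exact: emeasurable_funM.
by move=> x; exact: mule_ge0.
Qed.

Lemma nnmeas_cst (c : \bar R) : 0 <= c -> nnmeas (cst c).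
Proof. by move=> c0; split. Qed.

Lemma nnmeasZ (c : \bar R) u : 0 <= c -> nnmeas u -> nnmeas (fun x => c * u x).
Proof. by move=> c0 uP; exact: (nnmeasM (nnmeas_cst c0) uP). Qed.

Lemma nnmeas_indic (E : set T) : measurable E -> nnmeas (fun x => (\1_E x)%:E).
Proof.
move=> mE; split; last by move=> x; rewrite lee_fin.
exact/measurable_EFinP.
Qed.

Lemma nnmeas_abs (g : T -> R) : measurable_fun setT g ->
  nnmeas (fun x => `|g x|%:E).
Proof.
move=> mg; split; last by move=> x; rewrite lee_fin.
exact/measurable_EFinP/measurableT_comp.
Qed.

Lemma nnmeas_EFin (g : T -> R) : measurable_fun setT g -> (forall x, 0 <= g x)%R ->
  nnmeas (fun x => (g x)%:E).
Proof.
by move=> mg g0; split; [exact/measurable_EFinP | move=> x; rewrite lee_fin].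
Qed.

Lemma nnmeas_comp (phi : T -> T) u : measurable_fun setT phi -> nnmeas u ->
  nnmeas (u \o phi).
Proof. by move=> mphi [mu u0]; split; [exact: measurableT_comp | move=> x; exact: u0]. Qed.

Lemma measurable_gt (a : \bar R) u : nnmeas u -> measurable [set x | a < u x].
Proof.
move=> [mu _]; rewrite -[X in measurable X]setTI.
exact: emeasurable_fun_o_infty.
Qed.

Lemma mem_set_itv0 (t : R) : (t \in `[0%R, +oo[%classic) = (0 <= t)%R.
Proof. by rewrite mem_setE in_itv /= andbT. Qed.

End NonnegativeFunctions.

(** * The layer-cake formula *)

Section LayerCake.
Context {R : realType}.

Lemma lebesgue_measure_initial (a : \bar R) : 0 <= a ->
  lebesgue_measure [set t : R | (0 <= t)%R /\ t%:E < a] = a.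
Proof.
case: a => [r| _|//].
- rewrite lee_fin => r0.
  have -> : [set t : R | (0 <= t)%R /\ t%:E < r%:E] = [set` `[0%R, r[].
    by apply/seteqP; split => t /=; rewrite in_itv /= lte_fin => /andP.
  rewrite lebesgue_measure_itv /= lte_fin; case: ltP => [_|r0'].
    by rewrite sube0.
  by have -> : r = 0%R by apply/eqP; rewrite eq_le r0 r0'.
- have -> : [set t : R | (0 <= t)%R /\ t%:E < +oo] = [set` `[0%R, +oo[].
    apply/seteqP; split => t /=; rewrite in_itv /= ?andbT; first by case.
    by move=> t0; split => //; rewrite ltry.
  by rewrite lebesgue_measure_itv /= ltry.
Qed.

Lemma measurable_initial (a : \bar R) :
  measurable [set t : R | (0 <= t)%R /\ t%:E < a].
Proof.
rewrite [X in measurable X](_ : _ = [set` `[0%R, +oo[] `&` [set t | t%:E < a]).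
  apply: emeasurable_fun_infty_o => //; exact/measurable_EFinP.
by apply/seteqP; split => t /=; rewrite in_itv /= andbT.
Qed.

(** Tonelli's theorem for the region under the graph of [u], with density [w];
    the weight makes it possible to apply the formula twice to a product. *)
Lemma layer_cake {d : measure_display} {T : measurableType d}
    (m : {sigma_finite_measure set T -> \bar R}) (u w : T -> \bar R) :
  nnmeas u -> nnmeas w ->
  \int[m]_x (u x * w x) =
  \int[lebesgue_measure]_(s in `[0%R, +oo[) \int[m]_(x in [set x | s%:E < u x]) w x.
Proof.
move=> uP wP; have [[mu u0] [mw w0]] := (uP, wP).
pose G : set (T * R) := [set p | (0 <= p.2)%R /\ p.2%:E < u p.1].
have mG : measurable G.
  rewrite [X in measurable X](_ : _ =
      (snd @^-1` [set` `[0%R, +oo[]) `&` [set p : T * R | p.2%:E < u p.1]).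
    apply: measurableI; first by rewrite -[X in measurable X]setTI; exact: measurable_snd.
    rewrite -[X in measurable X]setTI.
    apply: measurable_lte => //; first exact/measurable_EFinP.
    exact: measurableT_comp.
  by apply/seteqP; split => t /=; rewrite in_itv /= andbT.
pose K : T * R -> \bar R := fun p => w p.1 * (\1_G p)%:E.
have mK : measurable_fun setT K.
  apply: emeasurable_funM; first exact: measurableT_comp.
  exact/measurable_EFinP.
have K0 p : 0 <= K p by rewrite mule_ge0// lee_fin.
transitivity (\int[m]_x \int[lebesgue_measure]_s K (x, s)).
  apply: eq_integral => x _; rewrite /K /=.
  rewrite ge0_integralZl//=; last first.
  - apply/measurable_EFinP.
    exact: (measurableT_comp (measurable_indic mG) (measurable_pair1 x)).
  rewrite muleC; congr (_ * _).
  pose I : set R := [set t | (0 <= t)%R /\ t%:E < u x].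
  transitivity (\int[lebesgue_measure]_s (\1_I s : R)%:E).
    rewrite integral_indic//; last exact: measurable_initial.
    by rewrite setIT; apply/esym/lebesgue_measure_initial.
  by apply: eq_integral => s _; rewrite !indicE.
rewrite (fubini_tonelli (m1 := m) (m2 := lebesgue_measure) K mK K0).
rewrite [RHS]integral_mkcond; apply: eq_integral => s _.
rewrite /patch; case: ifPn => sP; last first.
  rewrite integral0_eq// => x _; rewrite /K /= indicE memNset ?mule0//.
  by move=> -[s0 _]; move/negP: sP; apply; rewrite inE /= in_itv /= s0.
rewrite [RHS]integral_mkcond; apply: eq_integral => x _.
have s0 : (0 <= s)%R by move: sP; rewrite inE /= in_itv /= andbT.
rewrite /K /patch indicE /=; case: ifPn => xs.
  by rewrite mem_set ?mule1//; split => //; move: xs; rewrite inE.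
by rewrite memNset ?mule0// => -[_ h]; move/negP: xs; apply; rewrite inE.
Qed.

End LayerCake.

(** * Distribution functions and rearrangements *)

Section Rearrangement.
Context {R : realType} {d : measure_display} {T : measurableType d}.
Variable mu : {measure set T -> \bar R}.
Implicit Types u v w : T -> \bar R.

Definition dist u (s : R) : \bar R := mu [set x | s%:E < u x].

Definition rea u (t : R) : \bar R :=
  ereal_inf [set s%:E | s in [set s : R | (0 <= s)%R /\ dist u s <= t%:E]].

Definition rdot u v : \bar R :=
  \int[lebesgue_measure]_(t in `[0%R, +oo[) (rea u t * rea v t).

Lemma dist_ge0 u s : 0 <= dist u s.
Proof. exact: measure_ge0. Qed.

Lemma le_dist u s s' : nnmeas u -> (s <= s')%R -> dist u s' <= dist u s.
Proof.
move=> uP ss'; apply: le_measure; rewrite ?inE; try exact: measurable_gt.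
by move=> x /=; apply: le_lt_trans; rewrite lee_fin.
Qed.

Lemma dist_right_cont u (s : R) : nnmeas u ->
  dist u (s + n.+1%:R^-1)%R @[n --> \oo] --> dist u s.
Proof.
move=> uP.
pose F n := [set x | (s + n.+1%:R^-1)%R%:E < u x].
have -> : dist u s = mu (\bigcup_n F n).
  congr (mu _); apply/seteqP; split => x /=.
    move=> sx; have [u'|u'] := eqVneq (u x) +oo.
      by exists 0%N => //; rewrite /F /= u' ltry.
    have [ux u0] : u x \is a fin_num /\ 0 <= u x.
      by split; [rewrite ge0_fin_numE ?uP.2// ltey | exact: uP.2].
    move: sx; rewrite -(fineK ux) lte_fin => sx.
    have d0 : (0 < fine (u x) - s)%R by rewrite subr_gt0.
    near \oo => n; exists n => //; rewrite /F /= -(fineK ux) lte_fin -ltrBrDl.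
    near: n; exact: near_infty_natSinv_lt (PosNum d0).
  move=> [n _]; rewrite /F /=; apply: le_lt_trans.
  by rewrite lee_fin lerDl.
apply: nondecreasing_cvg_mu.
- by move=> n; exact: measurable_gt.
- by apply: bigcup_measurable => n _; exact: measurable_gt.
- move=> m n mn; apply/subsetPset => x; rewrite /F /=; apply: le_lt_trans.
  by rewrite lee_fin lerD2l lef_pV2 ?posrE// ler_nat.
Unshelve. all: end_near. Qed.

(** The rearrangement and the distribution function are generalized inverses of
    each other. *)
Lemma rea_gt u (s t : R) : nnmeas u -> (0 <= s)%R ->
  (s%:E < rea u t) = (t%:E < dist u s).
Proof.
move=> uP s0; apply/idP/idP.
  move=> sr; rewrite ltNge; apply/negP => dt.
  move: sr; rewrite ltNge => /negP; apply.
  by apply: ereal_inf_lbound; exists s.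
move=> td.
(* Right continuity of the distribution function makes the inequality strict. *)
have [n tn] : exists n, t%:E < dist u (s + n.+1%:R^-1)%R.
  apply: contrapT => /forallNP h.
  have : dist u s <= t%:E.
    apply: (cvge_le (dist_right_cont (s := s) uP)) => n.
    by rewrite leNgt; apply/negP.
  by rewrite leNgt td.
apply: (@lt_le_trans _ _ (s + n.+1%:R^-1)%R%:E); first by rewrite lte_fin ltrDl.
apply: le_ereal_inf_tmp => _ [s' [s'0 ds'] <-]; rewrite lee_fin leNgt; apply/negP => s's.
have := le_trans (le_dist uP (ltW s's)) ds'.
by rewrite leNgt tn.
Qed.

Lemma rea_ge0 u t : 0 <= rea u t.
Proof. by apply: le_ereal_inf_tmp => _ [s [s0 _] <-]; rewrite lee_fin. Qed.

Lemma le_rea u t t' : (t <= t')%R -> rea u t' <= rea u t.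
Proof.
move=> tt'; apply: ereal_inf_le_tmp => _ [s [s0 ds] <-]; exists s => //; split => //.
by apply: le_trans ds _; rewrite lee_fin.
Qed.


Lemma nonincreasing_emeasurable (f : R -> \bar R) :
  (forall s s', (0 <= s)%R -> (s <= s')%R -> f s' <= f s) ->
  measurable_fun (`[0%R, +oo[ : set R) f.
Proof.
move=> nf _; apply: (measurability _ (ErealGenOInfty.measurableE R)) => //=.
move=> _ [_ [x ->] <-]; apply: is_interval_measurable => a b [] /=.
rewrite !in_itv /= !andbT => a0 _ [_ xb] c /andP[ac cb].
rewrite !in_itv /= !andbT; split; first exact: le_trans ac.
by apply: lt_le_trans xb _; apply: nf => //; exact: le_trans ac.
Qed.

Lemma nnmeas_rea u : nnmeas u -> nnmeas (rea u \_ `[0%R, +oo[).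
Proof.
move=> uP; split; last first.
  by move=> t; rewrite /patch; case: ifP => // _; exact: rea_ge0.
apply/(measurable_restrictT _ _).1 => //.
by apply: nonincreasing_emeasurable => s s' _; exact: le_rea.
Qed.

Lemma rea_set u (s : R) : nnmeas u -> (0 <= s)%R ->
  [set t : R | s%:E < (rea u \_ `[0%R, +oo[) t] =
  [set t : R | (0 <= t)%R /\ t%:E < dist u s].
Proof.
move=> uP s0; apply/seteqP; split => t /=; rewrite /patch mem_set_itv0.
  case: ifP => t0; first by rewrite (rea_gt _ uP s0).
  by rewrite lte_fin ltNge s0.
by move=> [-> st]; rewrite (rea_gt _ uP s0).
Qed.

(** Applying the layer-cake formula to both rearrangements expresses the pairing by
    distribution functions only; this form makes the effect of dilations visible. *)
Lemma rdot_layer u v : nnmeas u -> nnmeas v ->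
  rdot u v = \int[lebesgue_measure]_(s in `[0%R, +oo[)
    \int[lebesgue_measure]_(r in `[0%R, +oo[) mine (dist u s) (dist v r).
Proof.
move=> uP vP; rewrite /rdot integral_mkcond.
transitivity (\int[lebesgue_measure]_t
    ((rea u \_ `[0%R, +oo[) t * (rea v \_ `[0%R, +oo[) t)).
  by apply: eq_integral => t _; rewrite /patch; case: ifP => //; rewrite mule0.
rewrite layer_cake; [|exact: nnmeas_rea|exact: nnmeas_rea].
apply: eq_integral => s; rewrite mem_set_itv0 => s0.
rewrite rea_set// integral_mkcond.
pose I : set R := [set t : R | (0 <= t)%R /\ t%:E < dist u s].
transitivity (\int[lebesgue_measure]_t ((rea v \_ `[0%R, +oo[) t * (\1_I t)%:E)).
  by apply: eq_integral => t _; rewrite /patch -/I indicE; case: ifP; rewrite ?mule1 ?mule0.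
rewrite (layer_cake lebesgue_measure (nnmeas_rea vP) (nnmeas_indic (measurable_initial _))).
apply: eq_integral => r; rewrite mem_set_itv0 => r0.
rewrite rea_set// integral_indic; [|exact: measurable_initial|exact: measurable_initial].
rewrite -[RHS]lebesgue_measure_initial; last by rewrite le_min !dist_ge0.
by congr (lebesgue_measure _); apply/seteqP; split => t /=; rewrite lt_min;
  [move=> [[-> ->] [_ ->]] | move=> [-> /andP[-> ->]]].
Qed.

Lemma measurable_dist_min (a : \bar R) v : nnmeas v ->
  measurable_fun (`[0%R, +oo[ : set R) (fun r => mine a (dist v r)).
Proof.
move=> vP; apply: nonincreasing_emeasurable => s s' s0 ss'.
by rewrite le_min ge_min lexx /= ge_min (le_dist vP ss') orbT.
Qed.

Lemma rdot_ge0 u v : 0 <= rdot u v.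
Proof. by apply: integral_ge0 => t _; rewrite mule_ge0 ?rea_ge0. Qed.

Lemma rdotC u v : rdot u v = rdot v u.
Proof. by apply: eq_integral => t _; rewrite muleC. Qed.

Lemma eq_dist_rea u v : nnmeas u -> nnmeas v ->
  (forall t, (0 <= t)%R -> rea u t = rea v t) <->
  (forall s, (0 <= s)%R -> dist u s = dist v s).
Proof.
move=> uP vP; split => uv s s0; last first.
  congr ereal_inf; apply/seteqP; split => _ [r [r0 dr] <-]; exists r => //; split => //.
    by rewrite -uv.
  by rewrite uv.
rewrite -(lebesgue_measure_initial (dist_ge0 u s)) -(lebesgue_measure_initial (dist_ge0 v s)).
by congr (lebesgue_measure _); apply/seteqP; split => t /= [t0];
  rewrite -(rea_gt _ uP s0) -(rea_gt _ vP s0) uv.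
Qed.

(** In the layer-cake form, this is the inequality [min (A a) b <= A min a b]. *)
Lemma rdot_dilate (A : R) u u' v : (1 <= A)%R -> nnmeas u -> nnmeas u' -> nnmeas v ->
  (forall s : R, (0 <= s)%R -> dist u s <= A%:E * dist u' s) ->
  rdot u v <= A%:E * rdot u' v.
Proof.
move=> A1 uP u'P vP uu'.
have A0 : (0 <= A)%R by apply: le_trans A1.
rewrite [rdot u v]rdotC [rdot u' v]rdotC !rdot_layer//.
have pos w s : 0 <= \int[lebesgue_measure]_(r in `[0%R, +oo[) mine (dist v s) (dist w r).
  by apply: integral_ge0 => r _; rewrite le_min !dist_ge0.
have mm w : nnmeas w -> measurable_fun (`[0%R, +oo[ : set R)
    (fun s : R => \int[lebesgue_measure]_(r in `[0%R, +oo[) mine (dist v s) (dist w r)).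
  move=> wP; apply: nonincreasing_emeasurable => s s' s0 ss'.
  apply: ge0_le_integral => //; try exact: measurable_dist_min.
    by move=> r _; rewrite le_min !dist_ge0.
  by move=> r _; rewrite le_min !ge_min lexx orbT andbT (le_dist vP ss').
rewrite -ge0_integralZl//; last exact: mm.
apply: ge0_le_integral => //; first exact: mm.
  by apply: emeasurable_funM => //; exact: mm.
move=> s; rewrite /= in_itv /= andbT => s0.
rewrite -ge0_integralZl//; last 2 first.
- exact: measurable_dist_min.
- by move=> r _; rewrite le_min !dist_ge0.
apply: ge0_le_integral => //; first by move=> r _; rewrite le_min !dist_ge0.
- exact: measurable_dist_min.
- by apply: emeasurable_funM => //; exact: measurable_dist_min.
move=> r; rewrite /= in_itv /= andbT => r0.
rewrite mine_pMr ?lee_fin// le_min; apply/andP; split.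
  rewrite ge_min; apply/orP; left.
  by rewrite -[leLHS]mul1e lee_wpmul2r ?dist_ge0// lee_fin.
by rewrite ge_min uu'// orbT.
Qed.

End Rearrangement.

(** * Function norms on non-negative functions *)

Lemma cvg_nneseries {R : realType} (f : nat -> \bar R) : (forall k, 0 <= f k) ->
  (\sum_(k < n) f k) @[n --> \oo] --> \sum_(k <oo) f k.
Proof.
move=> f0; have -> : (fun n => \sum_(k < n) f k) = (fun n => \sum_(0 <= k < n) f k).
  by apply/funext => n; rewrite big_mkord.
exact: (@is_cvg_nneseries R f xpredT 0 (fun k _ _ => f0 k)).
Qed.

Lemma geometric_half {R : realType} n : (\sum_(k < n) (2%:R^-1 : R) ^+ k.+1 <= 1)%R.
Proof.
have -> : (\sum_(k < n) (2%:R^-1 : R) ^+ k.+1 = 1 - 2%:R^-1 ^+ n)%R.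
  elim: n => [|n IH]; first by rewrite big_ord0 expr0 subrr.
  by rewrite big_ord_recr /= IH exprS; field.
by rewrite gerBl exprn_ge0// invr_ge0.
Qed.

Section FunctionNorms.
Context {R : realType} {d : measure_display} {T : measurableType d}.
Variable mu : {measure set T -> \bar R}.
Implicit Types (u v w : T -> \bar R) (N : (T -> \bar R) -> \bar R).

(** The common properties of the norm, of its associate, of the integral against a
    fixed density and of the rearrangement pairings. The last clause is Fatou's
    lemma; it is the form in which order continuity is used throughout. *)
Record fatou_norm N : Prop := {
  fn_ge0 : forall u, nnmeas u -> 0 <= N u;
  fn_Z : forall (a : R) u, (0 <= a)%R -> nnmeas u ->
    N (fun x => a%:E * u x) = a%:E * N u;
  fn_D : forall u v, nnmeas u -> nnmeas v -> N (fun x => u x + v x) <= N u + N v;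
  fn_le : forall u v, nnmeas u -> nnmeas v ->
    {ae mu, forall x, u x <= v x} -> N u <= N v;
  fn_fatou : forall (f : nat -> T -> \bar R) u c, (forall n, nnmeas (f n)) ->
    nnmeas u -> {ae mu, forall x, f n x @[n --> \oo] --> u x} ->
    (forall n, N (f n) <= c) -> N u <= c }.

Lemma aeT (P : T -> Prop) : (forall x, P x) -> {ae mu, forall x, P x}.
Proof. by move=> h; apply: filterE. Qed.

Lemma fn_leT N u v : fatou_norm N -> nnmeas u -> nnmeas v ->
  (forall x, u x <= v x) -> N u <= N v.
Proof. by move=> NP uP vP uv; apply: (fn_le NP) => //; exact: aeT. Qed.

Lemma fn0 N : fatou_norm N -> N (cst 0) = 0.
Proof.
move=> NP; have := fn_Z NP (lexx 0%R) (@nnmeas_cst _ _ T 0 (lexx 0)).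
by rewrite mul0e (_ : (fun x => _) = cst 0)//; apply/funext => x; rewrite mul0e.
Qed.

Lemma fn_sum N (f : nat -> T -> \bar R) n : fatou_norm N ->
  (forall k, nnmeas (f k)) ->
  nnmeas (fun x => \sum_(k < n) f k x) /\
  N (fun x => \sum_(k < n) f k x) <= \sum_(k < n) N (f k).
Proof.
move=> NP fP; elim: n => [|n [mS IH]].
  have -> : (fun x => \sum_(k < 0) f k x) = cst 0.
    by apply/funext => x; rewrite big_ord0.
  by rewrite big_ord0 fn0//; split => //; exact: nnmeas_cst.
have -> : (fun x => \sum_(k < n.+1) f k x) = (fun x => \sum_(k < n) f k x + f n x).
  by apply/funext => x; rewrite big_ord_recr.
split; first exact: nnmeasD.
by rewrite big_ord_recr /=; apply: le_trans (fn_D NP mS (fP n)) _; rewrite leeD2r.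
Qed.

Lemma limn_einf_le (f : nat -> \bar R) c : (forall n, f n <= c) -> limn_einf f <= c.
Proof.
move=> fc; rewrite limn_einf_lim; apply: lime_le; first exact: is_cvg_einfs.
apply: nearW => n; apply: le_trans (fc n); apply: ereal_inf_lbound.
by exists n => //=.
Qed.

Lemma fatou_norm_integral w : nnmeas w -> fatou_norm (fun u => \int[mu]_x (u x * w x)).
Proof.
move=> wP; split.
- by move=> u uP; apply: integral_ge0 => x _; rewrite mule_ge0 ?uP.2 ?wP.2.
- move=> a u a0 uP; under eq_integral do rewrite -muleA.
  rewrite ge0_integralZl//; first exact: (nnmeasM uP wP).1.
  by move=> x _; exact: (nnmeasM uP wP).2.
- move=> u v uP vP; under eq_integral do rewrite ge0_muleDl ?uP.2 ?vP.2//.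
  rewrite ge0_integralD//.
  + by move=> x _; exact: (nnmeasM uP wP).2.
  + exact: (nnmeasM uP wP).1.
  + by move=> x _; exact: (nnmeasM vP wP).2.
  + exact: (nnmeasM vP wP).1.
- move=> u v uP vP uv; apply: ae_ge0_le_integral => //.
  + by move=> x _; exact: (nnmeasM uP wP).2.
  + exact: (nnmeasM uP wP).1.
  + by move=> x _; exact: (nnmeasM vP wP).2.
  + exact: (nnmeasM vP wP).1.
  + by apply: filterS uv => x uvx _; rewrite lee_wpmul2r ?wP.2.
move=> f u c fP uP fu fc.
have gP n : nnmeas (fun x => f n x * w x) by exact: nnmeasM.
have ml : measurable_fun setT (fun x => limn_einf (fun n => f n x * w x)).
  by rewrite /limn_einf; apply: measurableT_comp => //;
    apply: measurable_fun_limn_esup => n; apply: measurableT_comp => //; exact: (gP n).1.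
have l0 x : 0 <= limn_einf (fun n => f n x * w x).
  rewrite limn_einf_lim; apply: lime_ge; first exact: is_cvg_einfs.
  apply: nearW => n; apply: le_ereal_inf_tmp => _ [m _ <-]; exact: (gP m).2.
apply: (@le_trans _ _ (\int[mu]_x limn_einf (fun n => f n x * w x))).
  apply: ae_ge0_le_integral => //.
  - by move=> x _; exact: (nnmeasM uP wP).2.
  - exact: (nnmeasM uP wP).1.
  apply: filterS fu => x fu _.
  have [u0|u0] := eqVneq (u x) 0.
    by rewrite [X in X <= _](_ : _ = 0)// u0 mul0e.
  have [w0|w0] := eqVneq (w x) 0.
    by rewrite [X in X <= _](_ : _ = 0)// w0 mule0.
  (* Only the product of zero and infinity is discontinuous. *)
  have ux : u x *? w x.
    have [ufin|ufin] := boolP (u x \is a fin_num); last exact: mule_def_infty_neq0.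
    have [wfin|wfin] := boolP (w x \is a fin_num); last exact: mule_def_neq0_infty.
    exact: mule_def_fin.
  have : f n x * w x @[n --> \oo] --> u x * w x.
    by apply: (cvgeM ux fu); exact: cvg_cst.
  by move=> /cvg_limn_einf_sup[-> _].
apply: le_trans (fatou _ measurableT (fun n => (gP n).1) (fun n x _ => (gP n).2 x)) _.
exact: limn_einf_le.
Qed.

Lemma fatou_norm_ext N N' : (forall u, nnmeas u -> N u = N' u) ->
  fatou_norm N -> fatou_norm N'.
Proof.
move=> NN' NP; split.
- by move=> u uP; rewrite -NN'//; exact: fn_ge0.
- by move=> a u a0 uP; rewrite -!NN' ?(fn_Z NP)//; apply: nnmeasZ => //; rewrite lee_fin.
- by move=> u v uP vP; rewrite -!NN' ?(fn_D NP)//; exact: nnmeasD.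
- by move=> u v uP vP uv; rewrite -!NN'//; exact: fn_le.
- by move=> f u c fP uP fu fc; rewrite -NN'//; apply: (fn_fatou NP fP) => // n; rewrite NN'.
Qed.

Lemma fatou_norm_int : fatou_norm (fun u => \int[mu]_x u x).
Proof.
apply: (fatou_norm_ext _ (fatou_norm_integral (nnmeas_cst lee01))) => u _.
by apply: eq_integral => x _; rewrite mule1.
Qed.

Lemma fatou_norm_sup (S : set (T -> \bar R)) : S !=set0 -> S `<=` nnmeas ->
  fatou_norm (fun u => ereal_sup [set \int[mu]_x (u x * w x) | w in S]).
Proof.
move=> [w0 Sw0] Snn; split.
- move=> u uP; apply: le_ereal_sup_tmp; exists (\int[mu]_x (u x * w0 x)); first by exists w0.
  exact: (fn_ge0 (fatou_norm_integral (Snn _ Sw0))).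
- move=> a u a0 uP; rewrite -ereal_supZl//; last first.
    by apply/set0P; exists (\int[mu]_x (u x * w0 x)); exists w0.
  congr ereal_sup; apply/seteqP; split => [_ [w Sw <-]|_ [_ [w Sw <-] <-]].
    exists (\int[mu]_x (u x * w x)); first by exists w.
    by rewrite (fn_Z (fatou_norm_integral (Snn _ Sw))).
  by exists w => //; rewrite (fn_Z (fatou_norm_integral (Snn _ Sw))).
- move=> u v uP vP; apply: ge_ereal_sup => _ [w Sw <-].
  apply: le_trans (fn_D (fatou_norm_integral (Snn _ Sw)) uP vP) _.
  by apply: leeD; apply: ereal_sup_ubound; exists w.
- move=> u v uP vP uv; apply: ge_ereal_sup => _ [w Sw <-].
  apply: le_trans (fn_le (fatou_norm_integral (Snn _ Sw)) uP vP uv) _.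
  by apply: ereal_sup_ubound; exists w.
move=> f u c fP uP fu fc; apply: ge_ereal_sup => _ [w Sw <-].
apply: (fn_fatou (fatou_norm_integral (Snn _ Sw)) fP uP fu) => n.
by apply: le_trans (fc n); apply: ereal_sup_ubound; exists w.
Qed.

Record banach_norm N : Prop := {
  bn_fatou : fatou_norm N;
  bn_indic : forall E, measurable E -> mu E < +oo -> N (fun x => (\1_E x)%:E) < +oo;
  bn_int : forall E, measurable E -> mu E < +oo -> exists2 C : R, (0 < C)%R &
    forall u, nnmeas u -> \int[mu]_x (u x * (\1_E x)%:E) <= C%:E * N u }.

Definition assoc N v : \bar R :=
  ereal_sup [set \int[mu]_x (v x * w x) | w in [set w | nnmeas w /\ N w <= 1]].

Lemma fatou_norm_assoc N : fatou_norm N -> fatou_norm (assoc N).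
Proof.
move=> NP; apply: fatou_norm_sup; last by move=> w [].
by exists (cst 0); split; [exact: nnmeas_cst | rewrite fn0].
Qed.

Lemma assoc_ub N v w : nnmeas w -> N w <= 1 -> \int[mu]_x (v x * w x) <= assoc N v.
Proof. by move=> wP Nw; apply: ereal_sup_ubound; exists w. Qed.

(** The bound [k] on the norm of [u] is a positive real, so that the degenerate
    products of zero and infinity do not arise. *)
Lemma hoelder_assoc N u v (k : R) : fatou_norm N -> nnmeas u -> nnmeas v -> (0 < k)%R ->
  N u <= k%:E -> \int[mu]_x (u x * v x) <= k%:E * assoc N v.
Proof.
move=> NP uP vP k0 Nu.
rewrite -lee_pdivrMl//.
have ki0 : (0 <= k^-1)%R by rewrite invr_ge0 ltW.
rewrite -(fn_Z (fatou_norm_integral vP))//.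
under eq_integral do rewrite muleC.
apply: assoc_ub; first by apply: nnmeasZ.
by rewrite fn_Z// lee_pdivrMl// mule1.
Qed.

(** The two finiteness conditions on sets of finite measure are dual to each other. *)
Lemma banach_norm_assoc N : banach_norm N -> banach_norm (assoc N).
Proof.
move=> BN; have NP := bn_fatou BN; split; first exact: fatou_norm_assoc.
- move=> E mE Efin; have [C C0 hC] := bn_int BN mE Efin.
  apply: (@le_lt_trans _ _ C%:E); last exact: ltry.
  apply: ge_ereal_sup => _ [w [wP Nw] <-].
  under eq_integral do rewrite muleC.
  apply: le_trans (hC w wP) _; rewrite -[leRHS]mule1.
  by apply: lee_wpmul2l => //; rewrite lee_fin ltW.
move=> E mE Efin; have NE := bn_indic BN mE Efin.
have N0 := fn_ge0 NP (nnmeas_indic (R:=R) mE).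
exists (fine (N (fun x => (\1_E x)%:E)) + 1)%R.
  by apply: ltr_wpDl => //; exact: fine_ge0.
move=> u uP; under eq_integral do rewrite muleC.
apply: (hoelder_assoc NP (nnmeas_indic mE) uP).
  by apply: ltr_wpDl => //; exact: fine_ge0.
by rewrite EFinD fineK ?leeDl// ge0_fin_numE.
Qed.

(** On a sigma-finite space, summing small multiples of the indicators of sets of
    finite measure gives a strictly positive function of finite norm. Such weights
    stand in for exhausting sequences of sets of finite measure. *)
Lemma weight_exists N : sigma_finite setT mu -> fatou_norm N ->
  (forall E, measurable E -> mu E < +oo -> N (fun x => (\1_E x)%:E) < +oo) ->
  exists w : T -> R, [/\ measurable_fun setT w, (forall x, 0 < w x <= 1)%R &
    N (fun x => (w x)%:E) < +oo].
Proof.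
move=> [F FT Ffin] NP N1.
have mF k : measurable (F k) by case: (Ffin k).
have IP k : @nnmeas R _ T (fun x => (\1_(F k) x)%:E) by exact: nnmeas_indic.
have Nfin k : N (fun x => (\1_(F k) x)%:E) \is a fin_num.
  by rewrite ge0_fin_numE ?(fn_ge0 NP)//; apply: N1 => //; case: (Ffin k).
pose b k := (1 + fine (N (fun x => (\1_(F k) x)%:E)))%R.
have b1 k : (1 <= b k)%R by rewrite lerDl fine_ge0// (fn_ge0 NP).
have b0 k : (0 < b k)%R by apply: lt_le_trans (b1 k).
pose a k : R := ((2%:R^-1) ^+ k.+1 / b k)%R.
have a0 k : (0 < a k)%R by rewrite divr_gt0 ?exprn_gt0// invr_gt0.
have aNl k : (a k <= 2%:R^-1 ^+ k.+1)%R.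
  by rewrite ler_pdivrMr// ler_peMr// exprn_ge0// invr_ge0.
pose f k x : \bar R := (a k)%:E * (\1_(F k) x)%:E.
have fP k : nnmeas (f k) by apply: nnmeasZ => //; rewrite lee_fin ltW.
have S1 n x : \sum_(k < n) f k x <= 1.
  apply: (@le_trans _ _ (\sum_(k < n) (2%:R^-1 ^+ k.+1)%:E)).
    apply: lee_sum => k _; rewrite /f -EFinM lee_fin.
    apply: le_trans (aNl k); rewrite -[leRHS]mulr1; apply: ler_wpM2l; first exact: ltW.
    by rewrite indicE; case: (_ \in _).
  by rewrite sumEFin lee_fin geometric_half.
pose s x := \sum_(k <oo) f k x.
have cs x : (\sum_(k < n) f k x) @[n --> \oo] --> s x.
  by apply: cvg_nneseries => k; exact: (fP k).2.
have s1 x : s x <= 1 by apply: (cvge_le (cs x)) => n; exact: S1.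
have s0 x : 0 <= s x by apply: nneseries_ge0 => k _ _; exact: (fP k).2.
have sfin x : s x \is a fin_num by rewrite ge0_fin_numE// (le_lt_trans (s1 x))// ltry.
have ms : measurable_fun setT s.
  apply: (emeasurable_fun_cvg (fun n x => \sum_(k < n) f k x)) => // n.
  exact: (fn_sum n NP fP).1.1.
exists (fine \o s); split.
- exact: measurableT_comp.
- move=> x; apply/andP; split; last by rewrite -lee_fin fineK.
  rewrite -lte_fin /= fineK//.
  have [k _ Fk] : (\bigcup_i F i) x by rewrite -FT.
  apply: (@lt_le_trans _ _ (f k x)).
    by rewrite /f indicE mem_set// mule1 lte_fin.
  apply: le_trans (@nneseries_lim_ge R (f^~ x) xpredT 0 k.+1 (fun k _ _ => (fP k).2 x)).
  rewrite big_mkord big_ord_recr /= leeDr//.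
  by apply: sume_ge0 => i _; exact: (fP i).2.
rewrite (_ : (fun x => _) = s); last by apply/funext => x /=; rewrite fineK.
apply: (@le_lt_trans _ _ 1); last exact: ltry.
apply: (fn_fatou NP (f := fun n x => \sum_(k < n) f k x)) => //.
- by move=> n; exact: (fn_sum n NP fP).1.
- exact: aeT.
move=> n; apply: le_trans (fn_sum n NP fP).2 _.
apply: (@le_trans _ _ (\sum_(k < n) (2%:R^-1 ^+ k.+1)%:E)).
  apply: lee_sum => k _; rewrite /f fn_Z//; last by rewrite ltW.
  rewrite -(fineK (Nfin k)) -EFinM lee_fin /a -mulrA -[leRHS]mulr1.
  apply: ler_wpM2l; first by rewrite exprn_ge0// invr_ge0.
  by rewrite ler_pdivrMl// mulr1 lerDr.
by rewrite sumEFin lee_fin geometric_half.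
Qed.

Lemma integral_lty_ae u : nnmeas u -> \int[mu]_x u x < +oo ->
  {ae mu, forall x, u x \is a fin_num}.
Proof.
move=> uP ui; have iu : mu.-integrable setT u.
  apply/integrableP; split; first exact: uP.1.
  by under eq_integral do rewrite gee0_abs ?uP.2//.
by have := integrable_ae measurableT iu; apply: filterS => x; exact.
Qed.

Lemma integral_eq0_ae u : nnmeas u -> \int[mu]_x u x <= 0 ->
  {ae mu, forall x, u x = 0}.
Proof.
move=> uP u0; have : \int[mu]_x `|u x| = 0.
  apply/eqP; rewrite eq_le integral_ge0// andbT.
  by under eq_integral do rewrite gee0_abs ?uP.2//.
move=> /(ae_eq_integral_abs _ measurableT uP.1).
by apply: filterS => x; apply.
Qed.

(** Completeness of weighted mean convergence, in the form of an almost everywhere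
    convergent subsequence: rapidly decreasing increments are almost everywhere
    absolutely summable. *)
Lemma cauchy_mean_subseq (w : T -> R) (f : nat -> T -> R) :
  measurable_fun setT w -> (forall x, 0 < w x)%R ->
  (forall n, measurable_fun setT (f n)) ->
  (forall e : R, (0 < e)%R -> exists n0, forall n m, (n0 <= n)%N -> (n0 <= m)%N ->
     \int[mu]_x (`|f n x - f m x|%:E * (w x)%:E) <= e%:E) ->
  exists (k : nat -> nat) (g : T -> R), [/\ measurable_fun setT g,
    forall j, (j <= k j)%N & {ae mu, forall x, f (k j) x @[j --> \oo] --> g x}].
Proof.
move=> mw w0 mf fC.
have e0 j : (0 < (2%:R^-1 : R) ^+ j.+1)%R by rewrite exprn_gt0// invr_gt0.
have [k0 hk0] := choice (fun j => fC _ (e0 j)).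
pose k j := (j + \sum_(i < j.+1) k0 i)%N.
have kge i j : (i <= j)%N -> (k0 i <= k j)%N.
  move=> ij; rewrite /k -[leqLHS]add0n; apply: leq_add => //.
  by rewrite (bigD1 (Ordinal (ij : (i < j.+1)%N))) //= leq_addr.
have wP : @nnmeas R _ T (fun x => (w x)%:E) by apply: nnmeas_EFin => // x; exact: ltW.
pose h j x := `|f (k j.+1) x - f (k j) x|%:E * (w x)%:E.
have hP j : nnmeas (h j).
  by apply: nnmeasM => //; apply: nnmeas_abs; exact: measurable_funB.
have hint j : \int[mu]_x h j x <= (2%:R^-1 ^+ j.+1)%:E.
  by apply: hk0; [exact: kge | exact: kge].
have ih : \int[mu]_x (\sum_(j <oo) h j x) < +oo.
  rewrite integral_nneseries//; last 2 first.
  - by move=> n; exact: (hP n).1.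
  - by move=> n x _; exact: (hP n).2.
  apply: (@le_lt_trans _ _ 1); last exact: ltry.
  have i0 j : 0 <= \int[mu]_x h j x by apply: integral_ge0 => x _; exact: (hP j).2.
  apply: (cvge_le (cvg_nneseries i0)) => n.
  apply: (@le_trans _ _ (\sum_(k < n) (2%:R^-1 ^+ k.+1)%:E)); first exact: lee_sum.
  by rewrite sumEFin lee_fin geometric_half.
have mH : measurable_fun setT (fun x => \sum_(j <oo) h j x).
  apply: (emeasurable_fun_cvg (fun n x => \sum_(k < n) h k x)) => [n|x _].
    exact: (fn_sum n (fatou_norm_integral (nnmeas_cst (lexx 0))) hP).1.1.
  by apply: cvg_nneseries => i; exact: (hP i).2.
have H0 x : 0 <= \sum_(j <oo) h j x by apply: nneseries_ge0 => j _ _; exact: (hP j).2.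
have Hae := integral_lty_ae (conj mH H0) ih.
exists k, (fun x => fine (limn_esup (fun j => (f (k j) x)%:E))); split.
- apply: measurableT_comp => //; apply: measurable_fun_limn_esup => j.
  exact/measurable_EFinP.
- by move=> j; exact: leq_addr.
apply: filterS Hae => x Hx.
suff cf : cvgn (fun j => f (k j) x).
  have /cvg_limn_einf_sup[_ ->] : (f (k j) x)%:E @[j --> \oo] --> (limn (fun j => f (k j) x))%:E.
    by apply: cvg_EFin; [exact: nearW | exact: cf].
  exact: cf.
have cd : cvgn (series (fun j => (f (k j.+1) x - f (k j) x)%R)).
  apply: normed_cvg.
  apply: (@nondecreasing_is_cvgn R) => [|].
    by apply: nondecreasing_series => n _ _; exact: normr_ge0.
  exists (fine (\sum_(j <oo) h j x) / w x)%R => _ [n _ <-] /=.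
  rewrite ler_pdivlMr// -lee_fin fineK//.
  apply: le_trans (@nneseries_lim_ge R (h^~ x) xpredT 0 n (fun k _ _ => (hP k).2 x)).
  rewrite /series /= mulr_suml -sumEFin; apply: lee_sum => i _.
  by rewrite EFinM.
have -> : (fun j => f (k j) x) =
    (fun j => f (k 0%N) x + series (fun j => (f (k j.+1) x - f (k j) x)%R) j)%R.
  apply/funext => j; rewrite /series /= telescope_sumr// addrC subrK//.
apply: is_cvgD => //; exact: is_cvg_cst.
Qed.

End FunctionNorms.

(** * Closest points of convex sets of square-integrable functions *)

Section SquareIntegrable.
Context {R : realType} {d : measure_display} {T : measurableType d}.
Variable mu : {measure set T -> \bar R}.
Implicit Types (f g h : T -> R) (K : set (T -> R)).

Definition sqint f : Prop :=
  measurable_fun setT f /\ \int[mu]_x (f x ^+ 2)%:E < +oo.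

Definition ip f g : R := (\int[mu]_x (f x * g x))%R.

Lemma nnmeas_sqr f : measurable_fun setT f -> nnmeas (fun x => (f x ^+ 2)%:E).
Proof.
by move=> mf; apply: nnmeas_EFin => [|x]; [exact: measurable_funX | exact: sqr_ge0].
Qed.

Lemma sqintD f g : sqint f -> sqint g -> sqint (fun x => f x + g x)%R.
Proof.
move=> [mf fi] [mg gi]; split; first exact: measurable_funD.
apply: (@le_lt_trans _ _ (\int[mu]_x (2%:E * (f x ^+ 2)%:E + 2%:E * (g x ^+ 2)%:E))).
  apply: ge0_le_integral => //.
  - by move=> x _; rewrite lee_fin sqr_ge0.
  - exact: (nnmeas_sqr (measurable_funD mf mg)).1.
  - by apply: (nnmeasD (nnmeasZ _ (nnmeas_sqr mf)) (nnmeasZ _ (nnmeas_sqr mg))).1.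
  move=> x _; rewrite -!EFinM -EFinD lee_fin.
  have := sqr_ge0 (f x - g x)%R; nra.
rewrite ge0_integralD//; last 4 first.
- by move=> x _; exact: (nnmeasZ _ (nnmeas_sqr mf)).2.
- exact: (nnmeasZ _ (nnmeas_sqr mf)).1.
- by move=> x _; exact: (nnmeasZ _ (nnmeas_sqr mg)).2.
- exact: (nnmeasZ _ (nnmeas_sqr mg)).1.
rewrite !ge0_integralZl//; try exact: (nnmeas_sqr _).1; try by move=> x _; rewrite lee_fin sqr_ge0.
by rewrite lte_add_pinfty// lte_mul_pinfty.
Qed.

Lemma sqintZ (a : R) f : sqint f -> sqint (fun x => a * f x)%R.
Proof.
move=> [mf fi]; split; first exact: measurable_funM.
under eq_integral do rewrite exprMn EFinM.
rewrite ge0_integralZl//; last 3 first.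
- exact: (nnmeas_sqr mf).1.
- by move=> x _; exact: (nnmeas_sqr mf).2.
- by rewrite lee_fin sqr_ge0.
by rewrite lte_mul_pinfty// lee_fin sqr_ge0.
Qed.

Lemma sqintB f g : sqint f -> sqint g -> sqint (fun x => f x - g x)%R.
Proof.
move=> fP gP; have := sqintD fP (sqintZ (-1) gP).
by rewrite (_ : (fun x => _) = (fun x => f x - g x)%R)//; apply/funext => x; rewrite mulN1r.
Qed.

Lemma le_sqint f g : measurable_fun setT f -> sqint g ->
  (forall x, `|f x| <= `|g x|)%R -> sqint f.
Proof.
move=> mf [mg gi] fg; split => //; apply: le_lt_trans gi.
apply: ge0_le_integral => //.
- by move=> x _; rewrite lee_fin sqr_ge0.
- exact: (nnmeas_sqr mf).1.
- exact: (nnmeas_sqr mg).1.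
by move=> x _; rewrite lee_fin -real_normK ?num_real// -(real_normK (num_real (g x)))
  lerXn2r ?nnegrE.
Qed.

Lemma sqint_integrable f g : sqint f -> sqint g ->
  mu.-integrable setT (EFin \o (fun x => f x * g x)%R).
Proof.
move=> [mf fi] [mg gi].
have isq h : measurable_fun setT h -> \int[mu]_x (h x ^+ 2)%:E < +oo ->
    mu.-integrable setT (EFin \o (fun x => h x ^+ 2)%R).
  move=> mh hi; apply/integrableP; split; first exact: (nnmeas_sqr mh).1.
  by under eq_integral do rewrite /= ger0_norm ?sqr_ge0//.
apply: (le_integrable measurableT _ _ (integrableD measurableT (isq f mf fi) (isq g mg gi))).
  by apply/measurable_EFinP; exact: measurable_funM.
move=> x _; rewrite /= lee_fin (ger0_norm (addr_ge0 (sqr_ge0 (f x)) (sqr_ge0 (g x)))) normrM.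
rewrite -(real_normK (num_real (f x))) -(real_normK (num_real (g x))).
have := sqr_ge0 (`|f x| - `|g x|)%R; have := normr_ge0 (f x); have := normr_ge0 (g x).
nra.
Qed.

Lemma ipC f g : ip f g = ip g f.
Proof. by apply: eq_Rintegral => x _; rewrite mulrC. Qed.

Lemma ipDr f g h : sqint f -> sqint g -> sqint h ->
  ip f (fun x => g x + h x)%R = (ip f g + ip f h)%R.
Proof.
move=> fP gP hP; rewrite /ip -RintegralD//; try exact: sqint_integrable.
by apply: eq_Rintegral => x _; rewrite mulrDr.
Qed.

Lemma ipZr (a : R) f g : sqint f -> sqint g -> ip f (fun x => a * g x)%R = (a * ip f g)%R.
Proof.
move=> fP gP; rewrite /ip -RintegralZl//; last exact: sqint_integrable.
by apply: eq_Rintegral => x _; rewrite mulrCA.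
Qed.

Lemma ip_ge0 f : (0 <= ip f f)%R.
Proof. by apply: Rintegral_ge0 => x _; rewrite -expr2 sqr_ge0. Qed.

Lemma EFin_ip f g : sqint f -> sqint g -> (ip f g)%:E = \int[mu]_x (f x * g x)%:E.
Proof.
by move=> fP gP; rewrite /ip /Rintegral fineK//; apply: integrable_fin_num => //;
  exact: sqint_integrable.
Qed.

Lemma EFin_ipff f : sqint f -> (ip f f)%:E = \int[mu]_x (f x ^+ 2)%:E.
Proof. by move=> fP; rewrite EFin_ip//; apply: eq_integral => x _; rewrite expr2. Qed.

Lemma ip_lin (a b : R) f g : sqint f -> sqint g ->
  ip (fun x => a * f x + b * g x)%R (fun x => a * f x + b * g x)%R =
  (a ^+ 2 * ip f f + 2 * a * b * ip f g + b ^+ 2 * ip g g)%R.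
Proof.
move=> fP gP; have afP := sqintZ a fP; have bgP := sqintZ b gP.
rewrite ipDr//; last exact: sqintD.
rewrite !ipZr//; try exact: sqintD.
rewrite !(ipC (fun x => _ + _)%R) !ipDr// !ipZr// (ipC g f); ring.
Qed.

Lemma ip_parallelogram f g : sqint f -> sqint g ->
  ip (fun x => f x - g x)%R (fun x => f x - g x)%R =
  (2 * ip f f + 2 * ip g g
    - 4 * ip (fun x => 2^-1 * (f x + g x)) (fun x => 2^-1 * (f x + g x)))%R.
Proof.
move=> fP gP.
have -> : (fun x => f x - g x)%R = (fun x => 1 * f x + (-1) * g x)%R.
  by apply/funext => x; rewrite mul1r mulN1r.
have -> : (fun x => 2^-1 * (f x + g x))%R = (fun x => 2^-1 * f x + 2^-1 * g x)%R.
  by apply/funext => x; rewrite mulrDr.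
by rewrite !ip_lin//; field.
Qed.

(** By the parallelogram identity, minimizing sequences are Cauchy in mean square, hence in the
    mean with respect to the weight [w]; this gives an almost everywhere convergent subsequence,
    whose limit lies in [K] and is closest by Fatou's lemma. *)
Lemma closest_point (w : T -> R) K u :
  sqint w -> (forall x, 0 < w x)%R ->
  (forall f, K f -> sqint f) -> K !=set0 ->
  (forall f g, K f -> K g -> K (fun x => 2^-1 * (f x + g x)))%R ->
  (forall (f : nat -> T -> R) p, (forall n, K (f n)) -> sqint p ->
    {ae mu, forall x, f n x @[n --> \oo] --> p x} -> K p) ->
  sqint u ->
  exists2 p, K p & forall r, K r ->
    (ip (fun x => u x - p x) (fun x => u x - p x) <=
     ip (fun x => u x - r x) (fun x => u x - r x))%R.
Proof.
move=> wP w0 KL [r0 Kr0] Kmid Kcl uP.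
pose D r := ip (fun x => u x - r x)%R (fun x => u x - r x)%R.
pose V := [set D r | r in K].
have V0 : has_inf V.
  split; first by exists (D r0); exists r0.
  by exists 0%R => _ [r _ <-]; exact: ip_ge0.
have dle r : K r -> (inf V <= D r)%R.
  by move=> Kr; apply: ge_inf; [exact: V0.2 | exists r].
have ex j : exists r, K r /\ (D r <= inf V + j.+1%:R^-1)%R.
  have j0 : (0 < j.+1%:R^-1 :> R)%R by rewrite invr_gt0.
  by have [_ [r Kr <-] /ltW rj] := inf_adherent j0 V0; exists r.
have [f fP] := choice ex.
have Kf n : K (f n) := (fP n).1.
have mf n : measurable_fun setT (f n) := (KL _ (Kf n)).1.
have fb n m j : (j <= n)%N -> (j <= m)%N ->
    (ip (fun x => f n x - f m x) (fun x => f n x - f m x) <= 4 * j.+1%:R^-1)%R.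
  move=> jn jm.
  have -> : (fun x => f n x - f m x)%R = (fun x => (u x - f m x) - (u x - f n x))%R.
    by apply/funext => x; ring.
  rewrite ip_parallelogram; try by apply: sqintB => //; exact: KL.
  have -> : (fun x => 2^-1 * (u x - f m x + (u x - f n x)))%R =
            (fun x => u x - 2^-1 * (f m x + f n x))%R.
    by apply/funext => x; field.
  have h1 := dle _ (Kmid _ _ (Kf m) (Kf n)).
  have jle k : (j <= k)%N -> (k.+1%:R^-1 <= j.+1%:R^-1 :> R)%R.
    by move=> jk; rewrite lef_pV2 ?posrE// ler_nat.
  have h2 := le_trans (fP n).2 (lerD (lexx (inf V)) (jle _ jn)).
  have h3 := le_trans (fP m).2 (lerD (lexx (inf V)) (jle _ jm)).
  move: h1 h2 h3; rewrite -!/(D _).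
  by move: (D _) (D _) (D _) (inf V) (j.+1%:R^-1)%R => a b c v t; lra.
have [k [p [mp kP fp]]] : exists (k : nat -> nat) (g : T -> R), [/\ measurable_fun setT g,
    forall j, (j <= k j)%N & {ae mu, forall x, f (k j) x @[j --> \oo] --> g x}].
  apply: (cauchy_mean_subseq wP.1 w0 mf) => e e0.
  have S0 : (0 < ip w w + 1)%R by apply: ltr_wpDl => //; exact: ip_ge0.
  pose c := (e / (ip w w + 1))%R.
  have c0 : (0 < c)%R by rewrite divr_gt0.
  have [n0 hn0] : exists n0 : nat, (4 * n0.+1%:R^-1 / (2 * c) <= e / 2)%R.
    have e1 : (0 < e * c / 4)%R by rewrite divr_gt0// mulr_gt0.
    have [n0 _ h] := near_infty_natSinv_lt (PosNum e1).
    exists n0; have := h n0 (leqnn _) => /=.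
    have key (v e' c' : R) : (v < e' * c' / 4 -> 4 * v <= e' / 2 * (2 * c'))%R by lra.
    move=> hv; rewrite ler_pdivrMr; last by rewrite mulr_gt0.
    exact: key.
  exists n0 => n m n0n n0m.
  have fnm : sqint (fun x => f n x - f m x)%R by apply: sqintB; exact: KL.
  have nn1 : nnmeas (fun x => (2 * c)^-1%:E * ((f n x - f m x) ^+ 2)%:E).
    by apply: nnmeasZ; [rewrite lee_fin invr_ge0 mulr_ge0// ltW | exact: nnmeas_sqr fnm.1].
  have nn2 : nnmeas (fun x => (c / 2)%:E * (w x ^+ 2)%:E).
    by apply: nnmeasZ; [rewrite lee_fin divr_ge0// ltW | exact: nnmeas_sqr wP.1].
  apply: (@le_trans _ _ (\int[mu]_x ((2 * c)^-1%:E * ((f n x - f m x) ^+ 2)%:E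
      + (c / 2)%:E * (w x ^+ 2)%:E))).
    apply: ge0_le_integral => //.
    - by move=> x _; rewrite mule_ge0 ?lee_fin// ltW.
    - apply: (nnmeasM (nnmeas_abs fnm.1) (nnmeas_EFin wP.1 _)).1 => x; exact: ltW.
    - exact: (nnmeasD nn1 nn2).1.
    move=> x _; rewrite -!EFinM -EFinD lee_fin.
    rewrite -(real_normK (num_real (f n x - f m x)%R)).
    set a := `|_|%R; rewrite -subr_ge0.
    have -> : ((2 * c)^-1 * a ^+ 2 + c / 2 * w x ^+ 2 - a * w x =
      (2 * c)^-1 * (a - c * w x) ^+ 2)%R by field; rewrite gt_eqF.
    by rewrite mulr_ge0 ?sqr_ge0// invr_ge0 mulr_ge0// ltW.
  rewrite ge0_integralD//; last 4 first.
  - by move=> x _; exact: nn1.2.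
  - exact: nn1.1.
  - by move=> x _; exact: nn2.2.
  - exact: nn2.1.
  rewrite !ge0_integralZl//; last 6 first.
  - exact: (nnmeas_sqr wP.1).1.
  - by move=> x _; rewrite lee_fin sqr_ge0.
  - by rewrite lee_fin divr_ge0// ltW.
  - exact: (nnmeas_sqr fnm.1).1.
  - by move=> x _; rewrite lee_fin sqr_ge0.
  - by rewrite lee_fin invr_ge0 mulr_ge0// ltW.
  rewrite -!EFin_ipff// -!EFinM -EFinD lee_fin.
  have h2 : (c / 2 * ip w w <= e / 2)%R.
    rewrite mulrAC; apply: ler_wpM2r; first by rewrite invr_ge0.
    rewrite /c mulrAC ler_pdivrMr//; apply: ler_wpM2l; first exact: ltW.
    by rewrite lerDl.
  have h1 : ((2 * c)^-1 * ip (fun x => f n x - f m x) (fun x => f n x - f m x) <= e / 2)%R.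
    apply: le_trans hn0; rewrite [leLHS]mulrC; apply: ler_wpM2r.
      by rewrite invr_ge0 mulr_ge0// ltW.
    exact: fb.
  by apply: le_trans (lerD h1 h2) _; lra.
have Dp J : \int[mu]_x ((u x - p x) ^+ 2)%:E <= (inf V + J.+1%:R^-1)%:E.
  have := fn_fatou (fatou_norm_int mu) (f := fun n x => ((u x - f (k (n + J)%N) x) ^+ 2)%:E)
    (u := fun x => ((u x - p x) ^+ 2)%:E) (c := (inf V + J.+1%:R^-1)%:E).
  apply.
  - by move=> n; apply: nnmeas_sqr; apply: measurable_funB => //; exact: uP.1.
  - by apply: nnmeas_sqr; apply: measurable_funB => //; exact: uP.1.
  - apply: filterS fp => x fpx; apply: cvg_EFin; first exact: nearW.
    have fJ : f (k (n + J)%N) x @[n --> \oo] --> p x.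
      by have := fpx; rewrite -(cvg_shiftn J).
    rewrite [X in X @ _ --> _](_ : _ = (fun n => (u x - f (k (n + J)%N) x) * (u x - f (k (n + J)%N) x))%R)//.
      by rewrite expr2; apply: cvgM; apply: cvgB => //; exact: cvg_cst.
  move=> n.
  rewrite -EFin_ipff; last by apply: sqintB => //; exact: KL.
  rewrite lee_fin; apply: le_trans (fP _).2 _; rewrite lerD2l lef_pV2 ?posrE// ler_nat ltnS.
  by apply: leq_trans (kP _); rewrite leq_addl.
have upP : sqint (fun x => u x - p x)%R.
  split; first by apply: measurable_funB => //; exact: uP.1.
  exact: le_lt_trans (Dp 0%N) (ltry _).
have pP : sqint p.
  have := sqintB uP upP; rewrite (_ : (fun x => _) = p)//.
  by apply/funext => x; ring.
exists p; first exact: (Kcl (fun j => f (k j))).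
move=> r Kr; apply: le_trans (dle r Kr).
rewrite leNgt; apply/negP => lt.
have lt0 : (0 < ip (fun x => u x - p x) (fun x => u x - p x) - inf V)%R by rewrite subr_gt0.
have [J _ h] := near_infty_natSinv_lt (PosNum lt0).
have h2 := Dp J; rewrite -EFin_ipff// lee_fin in h2.
have := h J (leqnn _); rewrite /= ltrBrDl => h1.
by have := le_lt_trans h2 h1; rewrite ltxx.
Qed.

End SquareIntegrable.

(** * The Lorentz-Luxemburg theorem *)

Section LorentzLuxemburg.
Context {R : realType} {d : measure_display} {T : measurableType d}.
Variable mu : {measure set T -> \bar R}.
Implicit Types (u v w : T -> \bar R) (N : (T -> \bar R) -> \bar R).

(** Truncation at the height of a multiple of a weight; if the weight is bounded and of
    finite norm, this truncates both the range and the support. *)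
Definition trunc (w : T -> R) u (k : nat) (x : T) : R :=
  fine (mine (u x) (k%:R * w x)%:E).

Lemma truncE (w : T -> R) u k x : (forall x, 0 < w x)%R -> nnmeas u ->
  (trunc w u k x)%:E = mine (u x) (k%:R * w x)%:E.
Proof.
move=> w0 uP; rewrite /trunc fineK// ge0_fin_numE.
  by rewrite gt_min ltry orbT.
by rewrite le_min uP.2 lee_fin mulr_ge0// ltW.
Qed.

Lemma trunc_ge0 (w : T -> R) u k x : (forall x, 0 < w x)%R -> nnmeas u ->
  (0 <= trunc w u k x)%R.
Proof.
move=> w0 uP; rewrite -lee_fin truncE// le_min uP.2 lee_fin mulr_ge0//.
exact: ltW.
Qed.

Lemma trunc_le (w : T -> R) u k x : (forall x, 0 < w x)%R -> nnmeas u ->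
  (trunc w u k x)%:E <= u x /\ (trunc w u k x <= k%:R * w x)%R.
Proof.
by move=> w0 uP; split; last rewrite -lee_fin; rewrite truncE// ge_min lexx ?orbT.
Qed.

Lemma measurable_trunc (w : T -> R) u k : measurable_fun setT w -> nnmeas u ->
  measurable_fun setT (trunc w u k).
Proof.
move=> mw uP; apply: measurableT_comp => //; apply: measurable_mine; first exact: uP.1.
by apply/measurable_EFinP; exact: measurable_funM.
Qed.

Lemma cvg_trunc (w : T -> R) u x : (forall x, 0 < w x)%R -> nnmeas u ->
  (trunc w u k x)%:E @[k --> \oo] --> u x.
Proof.
move=> w0 uP; under eq_fun do rewrite truncE//.
have kw : (k%:R * w x)%:E @[k --> \oo] --> +oo.
  apply/cvgeryP; apply/cvgryPge => A.
  near=> k; rewrite -ler_pdivrMr//.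
  by near: k; exact: nbhs_infty_ger.
have [ux|ux] := eqVneq (u x) +oo.
  rewrite ux; apply: cvg_trans kw; apply: near_eq_cvg; near=> k.
  by rewrite min_r// leey.
apply: (@cvg_trans _ ((fun=> u x) @ \oo)); last exact: cvg_cst.
apply: near_eq_cvg.
have uf : u x \is a fin_num by rewrite ge0_fin_numE ?uP.2// ltey.
have : \forall k \near \oo, u x <= (k%:R * w x)%:E.
  near=> k; rewrite -(fineK uf) lee_fin -ler_pdivrMr//.
  by near: k; exact: nbhs_infty_ger.
by apply: filterS => k uk; rewrite min_l.
Unshelve. all: end_near. Qed.

Lemma small_le0 (a b : R) : (0 <= b)%R ->
  (forall t, 0 < t <= 1 -> a <= t * b)%R -> (a <= 0)%R.
Proof.
move=> b0 h; rewrite leNgt; apply/negP => a0.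
pose t := (Num.min 1 (a / (2 * (b + 1))))%R.
have b1 : (0 < 2 * (b + 1))%R by rewrite mulr_gt0// ltr_wpDl.
have t0 : (0 < t)%R by rewrite lt_min ltr01 divr_gt0.
have t1 : (t <= 1)%R by rewrite ge_min lexx.
have t2 : (t * (2 * (b + 1)) <= a)%R by rewrite -ler_pdivlMr// ge_min lexx orbT.
have := h t; rewrite t0 t1 => /(_ isT); nra.
Qed.

Variables (N : (T -> \bar R) -> \bar R).
Hypothesis sf : sigma_finite setT mu.
Hypothesis BN : banach_norm mu N.

Let NP := bn_fatou BN.

(** The minimum of three weights, for the norm, for its associate and for the integral. Being at
    most one, it is also square-integrable. *)
Lemma common_weight : exists w : T -> R, [/\ measurable_fun setT w,
  (forall x, 0 < w x <= 1)%R, N (fun x => (w x)%:E) < +oo,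
  assoc mu N (fun x => (w x)%:E) < +oo & \int[mu]_x (w x)%:E < +oo].
Proof.
have BN' := banach_norm_assoc BN.
have [w1 [mw1 w1b w1N]] := weight_exists sf NP (bn_indic BN).
have [w2 [mw2 w2b w2N]] := weight_exists sf (bn_fatou BN') (bn_indic BN').
have [w3 [mw3 w3b w3N]] : exists w : T -> R, [/\ measurable_fun setT w,
    (forall x, 0 < w x <= 1)%R & \int[mu]_x (w x)%:E < +oo].
  apply: (weight_exists sf (fatou_norm_int mu)) => E mE Efin.
  by rewrite integral_indic// setIT.
pose w x := (Num.min (w1 x) (Num.min (w2 x) (w3 x))).
have mw : measurable_fun setT w by do 2! apply: measurable_minr => //.
have w0 x : (0 < w x)%R.
  by have [/andP[? _] /andP[? _] /andP[? _]] := And3 (w1b x) (w2b x) (w3b x); rewrite !lt_min; apply/and3P.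
have nn (g : T -> R) : measurable_fun setT g -> (forall x, 0 < g x <= 1)%R -> nnmeas (fun x => (g x)%:E).
  by move=> mg gb; apply: nnmeas_EFin => // x; have /andP[/ltW] := gb x.
have wb x : (0 < w x <= 1)%R by rewrite w0 !ge_min (andP (w1b x)).2.
exists w; split; [exact: mw | exact: wb | | |].
- by apply: le_lt_trans w1N; apply: (fn_leT NP); [exact: nn|exact: nn|] => x; rewrite lee_fin ge_min lexx.
- by apply: le_lt_trans w2N; apply: (fn_leT (bn_fatou BN')); [exact: nn|exact: nn|] => x; rewrite lee_fin !ge_min lexx orbT.
- by apply: le_lt_trans w3N; apply: (fn_leT (fatou_norm_int mu)); [exact: nn|exact: nn|] => x; rewrite lee_fin !ge_min lexx !orbT.
Qed.

(** The bipolar argument inside the Hilbert space of square-integrable functions: if [f] is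
    not in the unit ball, let [p] be the closest point of the ball. The positive part of
    [f - p] is then, up to scaling, an element of the unit ball of the associate space
    whose pairing with [f] exceeds one. *)
Lemma lorentz_luxemburg_sqint (f : T -> R) : sqint mu f -> (forall x, 0 <= f x)%R ->
  (forall v, nnmeas v -> assoc mu N v <= 1 -> \int[mu]_x ((f x)%:E * v x) <= 1) ->
  N (fun x => (f x)%:E) <= 1.
Proof.
move=> fP f0 hf.
have [th [mth thb thN _ thi]] := common_weight.
have th0 x : (0 < th x)%R by have /andP[] := thb x.
have thP : sqint mu th.
  split => //; apply: le_lt_trans thi; apply: ge0_le_integral => //.
  - by move=> x _; rewrite lee_fin sqr_ge0.
  - exact: (nnmeas_sqr mth).1.
  - exact/measurable_EFinP.
  by move=> x _; rewrite lee_fin; have /andP[h0 h1] := thb x; nra.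
pose Na (g : T -> R) := N (fun x => `|g x|%:E).
pose K : set (T -> R) := [set g | sqint mu g /\ Na g <= 1].
have K0 : K (cst 0%R).
  split; last first.
    rewrite /Na; have -> : (fun x : T => `|cst (0%R : R) x|%:E) = cst 0.
      by apply/funext => x; rewrite normr0.
    by rewrite (fn0 NP).
  by split => //; under eq_integral do rewrite expr0n /=; rewrite integral0.
have Kc (t : R) g h : (0 <= t <= 1)%R -> K g -> K h -> K (fun x => (1 - t) * g x + t * h x)%R.
  move=> /andP[t0 t1] [gP g1] [hP h1]; split; first by apply: sqintD; exact: sqintZ.
  have t1' : (0 <= 1 - t)%R by rewrite subr_ge0.
  have ga := nnmeas_abs gP.1; have ha := nnmeas_abs hP.1.
  have za : nnmeas (fun x => (1 - t)%:E * `|g x|%:E) by apply: nnmeasZ => //; rewrite lee_fin.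
  have zb : nnmeas (fun x => t%:E * `|h x|%:E) by apply: nnmeasZ => //; rewrite lee_fin.
  apply: (@le_trans _ _ (N (fun x => (1 - t)%:E * `|g x|%:E + t%:E * `|h x|%:E))).
    apply: (fn_leT NP); [|exact: nnmeasD|].
      by apply: nnmeas_abs; apply: measurable_funD; apply: measurable_funM => //; [exact: gP.1 | exact: hP.1].
    move=> x; rewrite -!EFinM -EFinD lee_fin; apply: le_trans (ler_normD _ _) _.
    by rewrite !normrM (ger0_norm t0) (ger0_norm t1').
  apply: le_trans (fn_D NP za zb) _; rewrite !(fn_Z NP)//.
  apply: (@le_trans _ _ ((1 - t)%:E * 1 + t%:E * 1)).
    by apply: leeD; apply: lee_wpmul2l => //; rewrite lee_fin.
  by rewrite !mule1 -EFinD subrK.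
have [p Kp pmin] : exists2 p, K p & forall r, K r ->
    (ip mu (fun x => f x - p x) (fun x => f x - p x) <=
     ip mu (fun x => f x - r x) (fun x => f x - r x))%R.
  apply: (closest_point thP th0) => //; first by move=> g [].
  - by exists (cst 0%R).
  - move=> g h Kg Kh; have := Kc 2^-1%R g h _ Kg Kh.
    rewrite (_ : (fun x => _) = (fun x => 2^-1 * (g x + h x))%R); last first.
      by apply/funext => x; field.
    by apply; apply/andP; split; lra.
  move=> g q Kg qP gq; split => //.
  apply: (fn_fatou NP (f := fun n x => `|g n x|%:E)) => //.
  - by move=> n; apply: nnmeas_abs; exact: (Kg n).1.1.
  - exact: nnmeas_abs qP.1.
  - apply: filterS gq => x gx; apply: cvg_EFin; first exact: nearW.
    exact: cvg_norm.
  - by move=> n; exact: (Kg n).2.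
pose w x := (f x - p x)%R.
have pP := Kp.1; have wP : sqint mu w by exact: sqintB.
have var r : K r -> (ip mu w r <= ip mu w p)%R.
  move=> Kr; have rP := Kr.1; rewrite -subr_le0.
  have rpP : sqint mu (fun x => r x - p x)%R by exact: sqintB.
  have -> : (ip mu w r - ip mu w p = ip mu w (fun x => r x - p x))%R.
    have -> : (fun x => r x - p x)%R = (fun x => r x + (-1) * p x)%R.
      by apply/funext => x; rewrite mulN1r.
    by rewrite ipDr ?ipZr//; [ring | exact: sqintZ].
  apply: (@small_le0 _ (2^-1 * ip mu (fun x => r x - p x) (fun x => r x - p x))%R).
    by rewrite mulr_ge0// ip_ge0.
  move=> t /andP[t0 t1].
  have := pmin _ (Kc t p r _ Kp Kr); rewrite (ltW t0) t1 => /(_ isT).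
  have -> : (fun x => f x - ((1 - t) * p x + t * r x))%R = (fun x => 1 * w x + (- t) * (r x - p x))%R.
    by apply/funext => x; rewrite /w; ring.
  rewrite ip_lin// -/w.
  set a := ip _ w w; set b := ip _ w _; set c := ip _ _ _ => h.
  have : (0 <= t * (t * c - 2 * b))%R by move: h; nra.
  by rewrite pmulr_rge0//; lra.
pose wp x := Num.max (w x) 0%R.
have mwp : measurable_fun setT wp by apply: measurable_maxr => //; exact: wP.1.
have wp0 x : (0 <= wp x)%R by rewrite le_max lexx orbT.
have wpP : sqint mu wp.
  apply: (le_sqint mwp wP) => x; rewrite /wp /Num.max; case: ltP => //.
  by rewrite normr0.
have mpos : measurable [set x | (0 <= w x)%R].
  rewrite [X in measurable X](_ : _ = setT `&` w @^-1` `[0%R, +oo[).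
    by apply: wP.1 => //.
  by apply/seteqP; split => x /=; rewrite in_itv /= andbT; [|case].
pose ind x : R := \1_[set x | (0 <= w x)%R] x.
have indE x : (w x * ind x = wp x)%R.
  rewrite /ind indicE /wp /Num.max; case: ltP => [h|h].
    by rewrite memNset ?mulr0//= leNgt h.
  by rewrite mem_set ?mulr1.
have mind : measurable_fun setT ind by exact: measurable_indic.
have ind1 x : (0 <= ind x <= 1)%R by rewrite /ind indicE; case: (_ \in _); rewrite /= ?lexx ?ler01.
pose g := ip mu w p.
have test (r : T -> R) : K r -> (ip mu wp r <= g)%R.
  move=> Kr; have : K (fun x => ind x * r x)%R.
    split.
      apply: (le_sqint _ Kr.1); first by apply: measurable_funM => //; exact: Kr.1.1.
      move=> x; rewrite normrM; have /andP[h0 h1] := ind1 x.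
      by rewrite (ger0_norm h0) ler_piMl.
    apply: le_trans Kr.2; apply: (fn_leT NP).
    - by apply: nnmeas_abs; apply: measurable_funM => //; exact: Kr.1.1.
    - exact: nnmeas_abs Kr.1.1.
    move=> x; rewrite lee_fin normrM; have /andP[h0 h1] := ind1 x.
    by rewrite (ger0_norm h0) ler_piMl.
  move=> /var; apply: le_trans; rewrite le_eqVlt; apply/orP; left; apply/eqP.
  by apply: eq_Rintegral => x _; rewrite mulrA indE.
have g0 : (0 <= g)%R.
  by apply: le_trans (test _ K0); apply: Rintegral_ge0 => x _; rewrite mulr0.
have ag : assoc mu N (fun x => (wp x)%:E) <= g%:E.
  apply: ge_ereal_sup => _ [v [vP Nv] <-].
  under eq_integral do rewrite muleC.
  apply: (fn_fatou (fatou_norm_integral mu (nnmeas_EFin mwp wp0)) (f := fun k x => (trunc th v k x)%:E)) => //.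
  - by move=> k; apply: nnmeas_EFin; [exact: measurable_trunc | move=> x; exact: trunc_ge0].
  - by apply: aeT => x; exact: cvg_trunc.
  move=> k; have tP : sqint mu (trunc th v k).
    apply: (le_sqint (measurable_trunc k mth vP) (sqintZ k%:R thP)) => x.
    rewrite !ger0_norm ?trunc_ge0 ?mulr_ge0//; last exact: ltW.
    exact: (trunc_le _ _ _ vP).2.
  have := test (trunc th v k); rewrite -lee_fin EFin_ip//.
  rewrite (eq_integral (fun x => (trunc th v k x)%:E * (wp x)%:E)); last first.
    by move=> x _; rewrite -EFinM mulrC.
  apply; split => //; apply: le_trans Nv; apply: (fn_leT NP) => //.
    exact: nnmeas_abs tP.1.
  by move=> x; rewrite ger0_norm ?trunc_ge0//; exact: (trunc_le _ _ _ vP).1.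
have fwp (e : R) : (0 < e)%R -> (ip mu f wp <= g + e)%R.
  move=> e0; have ge0 : (0 < g + e)%R by apply: ltr_wpDl.
  have wpn := nnmeas_EFin mwp wp0.
  have gi : (0 <= (g + e)^-1)%R by rewrite invr_ge0 ltW.
  have : \int[mu]_x ((f x)%:E * ((g + e)^-1%:E * (wp x)%:E)) <= 1.
    apply: hf; first by apply: nnmeasZ => //; rewrite lee_fin.
    rewrite (fn_Z (fatou_norm_assoc NP))// lee_pdivrMl// mule1.
    by apply: le_trans ag _; rewrite lee_fin lerDl ltW.
  under eq_integral do rewrite muleCA.
  rewrite ge0_integralZl//; last 2 first.
  - by apply: (nnmeasM _ wpn).1; exact: nnmeas_EFin fP.1 f0.
  - by move=> x _; rewrite mule_ge0// lee_fin.
  by rewrite lee_pdivrMl// mule1 -lee_fin EFin_ip.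
(* Where [w] is negative, [p] exceeds [f] and is positive. *)
have gle : (g <= ip mu p wp)%R.
  apply: le_Rintegral => //; try exact: sqint_integrable.
  move=> x _; rewrite /wp /Num.max; case: ltP => h; last by rewrite mulrC.
  rewrite mulr0; have := f0 x; move: h; rewrite /w => h fx.
  have px : (0 <= p x)%R by lra.
  nra.
have wwp : (ip mu wp wp <= 0)%R.
  apply/ler_addgt0Pr => e e0; rewrite add0r.
  have -> : ip mu wp wp = (ip mu f wp - ip mu p wp)%R.
    rewrite (ipC mu f wp) (ipC mu p wp) -(mulN1r (ip mu wp p)) -(ipZr (-1) wpP pP).
    rewrite -(ipDr wpP fP (sqintZ (-1) pP)).
    apply: eq_Rintegral => x _; rewrite mulN1r -/(w x) /wp /Num.max.
    by case: ltP => // _; rewrite !mul0r.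
  by have := fwp _ e0; lra.
have wp_ae : {ae mu, forall x, wp x = 0%R}.
  have : \int[mu]_x (wp x ^+ 2)%:E <= 0 by rewrite -EFin_ipff// lee_fin.
  move=> /(integral_eq0_ae (nnmeas_sqr mwp)).
  by apply: filterS => x [] /eqP; rewrite sqrf_eq0 => /eqP.
apply: le_trans Kp.2; apply: (fn_le NP); [exact: nnmeas_EFin fP.1 f0 | exact: nnmeas_abs pP.1 |].
apply: filterS wp_ae => x wx; rewrite lee_fin.
apply: le_trans (ler_norm _); rewrite -subr_le0 -/(w x).
by rewrite -wx le_max lexx.
Qed.

(** The norm is recovered from its associate norm: [u] is the increasing limit of its
    truncations, which are square-integrable, and the norm has the Fatou property. *)
Theorem lorentz_luxemburg u (c : R) : nnmeas u -> (0 < c)%R ->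
  (forall v, nnmeas v -> assoc mu N v <= 1 -> \int[mu]_x (u x * v x) <= c%:E) ->
  N u <= c%:E.
Proof.
move=> uP c0 hu.
have [th [mth thb thN _ thi]] := common_weight.
have th0 x : (0 < th x)%R by have /andP[] := thb x.
have thP : sqint mu th.
  split => //; apply: le_lt_trans thi; apply: ge0_le_integral => //.
  - by move=> x _; rewrite lee_fin sqr_ge0.
  - exact: (nnmeas_sqr mth).1.
  - exact/measurable_EFinP.
  by move=> x _; rewrite lee_fin; have /andP[h0 h1] := thb x; nra.
apply: (fn_fatou NP (f := fun k x => (trunc th u k x)%:E)) => //.
- by move=> k; apply: nnmeas_EFin; [exact: measurable_trunc | move=> x; exact: trunc_ge0].
- by apply: aeT => x; exact: cvg_trunc.
move=> k; have ci : (0 <= c^-1)%R by rewrite invr_ge0 ltW.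
have tn : nnmeas (fun x => (trunc th u k x)%:E).
  by apply: nnmeas_EFin; [exact: measurable_trunc | move=> x; exact: trunc_ge0].
have : N (fun x => (c^-1 * trunc th u k x)%R%:E) <= 1.
  apply: lorentz_luxemburg_sqint => [|x|v vP v1].
  - apply: sqintZ; apply: (le_sqint (measurable_trunc k mth uP) (sqintZ k%:R thP)) => x.
    rewrite !ger0_norm ?trunc_ge0 ?mulr_ge0//; last exact: ltW.
    exact: (trunc_le _ _ _ uP).2.
  - by rewrite mulr_ge0// trunc_ge0.
  under eq_integral do rewrite EFinM.
  rewrite (fn_Z (fatou_norm_integral mu vP))// lee_pdivrMl// mule1.
  apply: le_trans (hu v vP v1); apply: (fn_leT (fatou_norm_integral mu vP)) => // x.
  exact: (trunc_le _ _ _ uP).1.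
rewrite (_ : (fun x => _) = (fun x => c^-1%:E * (trunc th u k x)%:E))//.
by rewrite (fn_Z NP)// lee_pdivrMl// mule1.
Qed.

End LorentzLuxemburg.

(** * Rearrangement-invariant norms on resonant spaces *)

Section ResonantSpaces.
Context {R : realType} {d : measure_display} {T : measurableType d}.
Variable mu : {measure set T -> \bar R}.
Implicit Types (u v w : T -> \bar R) (N : (T -> \bar R) -> \bar R).

Lemma sigma_finite_pack : sigma_finite setT mu ->
  exists m : {sigma_finite_measure set T -> \bar R}, mu = m.
Proof.
case: mu => m0 c sf /=.
pose m : {sigma_finite_measure set T -> \bar R} :=
  HB.pack m0 (Measure.Pack c) (Measure_isSigmaFinite.Build _ _ _ (Measure.Pack c) sf).
by exists m; apply: eq_measure.
Qed.

(** Equality of distribution functions is equality of rearrangements, by [eq_dist_rea];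
    resonance and rearrangement invariance are used in this form. *)
Definition equidist u v : Prop := forall s : R, (0 <= s)%R -> dist mu u s = dist mu v s.

Definition resonant_nn : Prop := forall u v, nnmeas u -> nnmeas v ->
  ereal_sup [set \int[mu]_x (u x * w x) | w in [set w | nnmeas w /\ equidist w v]] =
  rdot mu u v.

Definition dist_invariant N : Prop := forall u v, nnmeas u -> nnmeas v ->
  equidist u v -> N u = N v.

(** By [rea_gt], these are the functions whose rearrangement tends to zero at infinity. *)
Definition vanishing u : Prop := forall s : R, (0 < s)%R -> dist mu u s < +oo.

Hypothesis sf : sigma_finite setT mu.

Lemma integral_dist u : nnmeas u ->
  \int[mu]_x u x = \int[lebesgue_measure]_(s in `[0%R, +oo[) dist mu u s.
Proof.
move=> uP; rewrite /dist; have [m ->] := sigma_finite_pack sf.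
rewrite (eq_integral (fun x => u x * cst 1 x)); last by move=> x _; rewrite /= mule1.
rewrite (layer_cake m uP (nnmeas_cst lee01)); apply: eq_integral => s _.
by rewrite integral_cst ?mul1e//; exact: measurable_gt.
Qed.

Lemma measurable_dist u : nnmeas u -> measurable_fun (`[0%R, +oo[ : set R) (dist mu u).
Proof. by move=> uP; apply: nonincreasing_emeasurable => s s' _; exact: le_dist. Qed.

Lemma integral_dilate (A : R) u v : (0 <= A)%R -> nnmeas u -> nnmeas v ->
  (forall s, (0 <= s)%R -> dist mu u s <= A%:E * dist mu v s) ->
  \int[mu]_x u x <= A%:E * \int[mu]_x v x.
Proof.
move=> A0 uP vP uv; rewrite !integral_dist// -ge0_integralZl//; last exact: measurable_dist.
apply: ge0_le_integral => //.
- exact: measurable_dist.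
- by apply: emeasurable_funM => //; exact: measurable_dist.
- by move=> s; rewrite /= in_itv /= andbT; exact: uv.
Qed.

Definition tail (M : R) v (x : T) : \bar R :=
  let E := [set y | M%:E < v y] in v x * (\1_E x)%:E.

Lemma nnmeas_tail M v : nnmeas v -> nnmeas (tail M v).
Proof. by move=> vP; apply: nnmeasM => //; apply/nnmeas_indic/measurable_gt. Qed.

Lemma equidist_tail (M : R) v w : (0 <= M)%R -> nnmeas v -> nnmeas w -> equidist w v ->
  \int[mu]_x tail M w x = \int[mu]_x tail M v x.
Proof.
move=> M0 vP wP wv.
have E u (s : R) : (0 <= s)%R -> dist mu (tail M u) s = dist mu u (Num.max s M).
  move=> s0; congr (mu _); apply/seteqP; split => x /=; rewrite /tail EFin_max gt_max indicE.
    have [xM|xM] := boolP (_ \in _); last first.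
      by rewrite mule0 lte_fin => s1; move: s0; rewrite leNgt s1.
    by rewrite mule1 => ->; rewrite inE in xM.
  by move=> /andP[sx Mx]; rewrite mem_set ?mule1.
rewrite !integral_dist; [|exact: nnmeas_tail|exact: nnmeas_tail].
apply: eq_integral => s; rewrite mem_set_itv0 => s0.
by rewrite !E// wv// le_max s0.
Qed.

Hypothesis res : resonant_nn.

(** Rearrangement is not subadditive, but by resonance the pairing with [v] is a supremum of
    integrals against fixed densities, each of which is additive and satisfies Fatou's lemma. *)
Lemma fatou_norm_rdot v : nnmeas v -> fatou_norm mu (fun u => rdot mu u v).
Proof.
move=> vP.
apply: (fatou_norm_ext (N := fun u => ereal_sup [set \int[mu]_x (u x * w x) |
  w in [set w | nnmeas w /\ equidist w v]])); first by move=> u uP; exact: res.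
by apply: fatou_norm_sup => [|w []//]; exists v; split.
Qed.

Lemma integral_le_rdot u v : nnmeas u -> nnmeas v -> \int[mu]_x (u x * v x) <= rdot mu u v.
Proof. by move=> uP vP; rewrite -res//; apply: ereal_sup_ubound; exists v. Qed.

(** A pointwise splitting, uniform over all functions equidistributed with [v]: small values
    of [v] are controlled by the integral of [u], small values of [u] by the tail of [v],
    and what remains by the mean square of [u] and by the far tail of [v]. *)
Lemma mul_split (c eta e1 M : R) (a b : \bar R) : (0 < c)%R -> (0 < eta)%R -> (0 < e1)%R ->
  (0 < M)%R -> 0 <= a -> a <= c%:E -> 0 <= b ->
  a * b <= eta%:E * a + e1%:E * (b * (if eta%:E < b then 1 else 0))
    + (c * M / e1 ^+ 2)%:E * (a * a) + c%:E * (b * (if M%:E < b then 1 else 0)).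
Proof.
move=> c0 eta0 e10 M0 a0 ac b0.
have af : a \is a fin_num by rewrite ge0_fin_numE// (le_lt_trans ac)// ltry.
have t1 : 0 <= eta%:E * a by rewrite mule_ge0// lee_fin ltW.
have t2 : 0 <= e1%:E * (b * (if eta%:E < b then 1 else 0)).
  by rewrite mule_ge0 ?lee_fin ?(ltW e10)// mule_ge0//; case: ifP.
have t3 : 0 <= (c * M / e1 ^+ 2)%:E * (a * a).
  by rewrite mule_ge0 ?mule_ge0// lee_fin divr_ge0 ?sqr_ge0// mulr_ge0// ltW.
have t4 : 0 <= c%:E * (b * (if M%:E < b then 1 else 0)).
  by rewrite mule_ge0 ?lee_fin ?(ltW c0)// mule_ge0//; case: ifP.
have [bM|bM] := ltP M%:E b.
  apply: (@le_trans _ _ (c%:E * (b * 1))).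
    by rewrite mule1; exact: lee_wpmul2r.
  move: t4; rewrite bM => t4; rewrite -[leLHS]add0e; apply: leeD => //.
  by rewrite !adde_ge0.
have bf : b \is a fin_num by rewrite ge0_fin_numE// (le_lt_trans bM)// ltry.
suff h : a * b <= eta%:E * a + e1%:E * (b * (if eta%:E < b then 1 else 0))
    + (c * M / e1 ^+ 2)%:E * (a * a).
  by apply: le_trans h _; rewrite !mule0 adde0.
clear t1 t2 t3 t4; move: a0 ac b0 bM; rewrite -(fineK af) -(fineK bf) !lee_fin lte_fin.
move: (fine a) (fine b) => {af bf a}a {}b a0 ac b0 bM.
have p1 : (0 <= eta * a)%R by rewrite mulr_ge0// ltW.
have p2 : (0 <= e1 * b)%R by rewrite mulr_ge0// ltW.
have p3 : (0 <= c * M / e1 ^+ 2 * (a * a))%R.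
  by rewrite mulr_ge0 ?mulr_ge0// ?invr_ge0 ?sqr_ge0// ltW.
case: ifP => [hb|/negbT]; last rewrite -leNgt => hb.
  rewrite mule1 -!EFinM -!EFinD lee_fin.
  have [ae|ae] := leP a e1.
    have : (a * b <= e1 * b)%R by exact: ler_wpM2r.
    lra.
  have : (a * b <= c * M / e1 ^+ 2 * (a * a))%R.
    apply: (@le_trans _ _ (c * M)%R); first by apply: ler_pM.
    rewrite -mulrA ler_peMr// ?mulr_ge0 ?ltW//.
    rewrite mulrC ltr_pdivlMr ?exprn_gt0// mul1r expr2.
    by apply: ltr_pM => //; exact: ltW.
  lra.
rewrite !mule0 -!EFinM -!EFinD lee_fin addr0.
have : (a * b <= eta * a)%R by rewrite mulrC ler_wpM2r.
lra.
Qed.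

Lemma tailE M v x : tail M v x = v x * (if M%:E < v x then 1 else 0).
Proof.
rewrite /tail indicE; congr (_ * _); case: ifPn => h; first by rewrite mem_set.
by rewrite memNset//; exact/negP.
Qed.

Lemma integral_split (c eta e1 M : R) u v : (0 < c)%R -> (0 < eta)%R -> (0 < e1)%R ->
  (0 < M)%R -> nnmeas u -> nnmeas v -> (forall x, u x <= c%:E) ->
  \int[mu]_x (u x * v x) <= eta%:E * \int[mu]_x u x + e1%:E * \int[mu]_x tail eta v x
    + (c * M / e1 ^+ 2)%:E * \int[mu]_x (u x * u x) + c%:E * \int[mu]_x tail M v x.
Proof.
move=> c0 eta0 e10 M0 uP vP uc.
have I := fatou_norm_int mu.
have k0 : (0 <= c * M / e1 ^+ 2)%R by rewrite divr_ge0 ?sqr_ge0// mulr_ge0// ltW.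
have uuP : nnmeas (fun x => u x * u x) by exact: nnmeasM.
have p1 : nnmeas (fun x => eta%:E * u x) by apply: nnmeasZ => //; rewrite lee_fin ltW.
have p2 : nnmeas (fun x => e1%:E * tail eta v x).
  by apply: nnmeasZ; [rewrite lee_fin ltW | exact: nnmeas_tail].
have p3 : nnmeas (fun x => (c * M / e1 ^+ 2)%:E * (u x * u x)).
  by apply: nnmeasZ => //; rewrite lee_fin.
have p4 : nnmeas (fun x => c%:E * tail M v x).
  by apply: nnmeasZ; [rewrite lee_fin ltW | exact: nnmeas_tail].
apply: le_trans (fn_leT I (nnmeasM uP vP) (nnmeasD (nnmeasD (nnmeasD p1 p2) p3) p4) _) _.
  by move=> x; rewrite !tailE; apply: mul_split => //; [exact: uP.2 | exact: vP.2].
apply: le_trans (fn_D I (nnmeasD (nnmeasD p1 p2) p3) p4) _.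
rewrite (fn_Z I (ltW c0) (nnmeas_tail M vP)); apply: leeD2r.
apply: le_trans (fn_D I (nnmeasD p1 p2) p3) _.
rewrite (fn_Z I k0 uuP); apply: leeD2r.
apply: le_trans (fn_D I p1 p2) _.
by rewrite (fn_Z I (ltW eta0) uP) (fn_Z I (ltW e10) (nnmeas_tail eta vP)).
Qed.

Variable N : (T -> \bar R) -> \bar R.
Hypothesis BN : banach_norm mu N.
Hypothesis inv : dist_invariant N.

Let NP := bn_fatou BN.
Let N' := assoc mu N.
Let BN' : banach_norm mu N' := banach_norm_assoc BN.

(** Hoelder's inequality for the pairing: resonance makes the pairing a supremum of integrals
    against densities equidistributed with [u], all of which have the norm of [u]. *)
Lemma rdot_le (k : R) u v : nnmeas u -> nnmeas v -> (0 < k)%R -> N u <= k%:E ->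
  rdot mu u v <= k%:E * N' v.
Proof.
move=> uP vP k0 Nu; rewrite rdotC -res//; apply: ge_ereal_sup => _ [w [wP wu] <-].
under eq_integral do rewrite muleC.
by apply: (hoelder_assoc NP wP vP k0); rewrite (inv wP uP wu).
Qed.

Lemma le_of_bound (A : R) (x y : \bar R) : (0 < A)%R -> 0 <= y ->
  (forall k : R, (0 < k)%R -> y <= k%:E -> x <= (A * k)%:E) -> x <= A%:E * y.
Proof.
move=> A0; case: y => [y| |//]; last by move=> _ _; rewrite gt0_muley ?lte_fin// leey.
rewrite lee_fin => y0 h; rewrite -EFinM; apply/lee_addgt0Pr => e e0.
have eA : (0 < e / A)%R by rewrite divr_gt0.
have := h (y + e / A)%R (ltr_wpDl y0 eA); rewrite lee_fin lerDl (ltW eA) => /(_ isT).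
by rewrite mulrDr mulrCA divff ?gt_eqF// mulr1 EFinD.
Qed.

(** Boundedness of dilations, by duality. *)
Lemma norm_dilate (A : R) u v : (1 <= A)%R -> nnmeas u -> nnmeas v ->
  (forall s, (0 <= s)%R -> dist mu u s <= A%:E * dist mu v s) ->
  N u <= A%:E * N v.
Proof.
move=> A1 uP vP uv; have A0 : (0 < A)%R by apply: lt_le_trans A1.
apply: (le_of_bound A0); first exact: (fn_ge0 NP).
move=> k k0 Nv; apply: (lorentz_luxemburg sf BN uP); first exact: mulr_gt0.
move=> w wP w1; apply: le_trans (integral_le_rdot uP wP) _.
apply: le_trans (rdot_dilate A1 uP vP wP uv) _.
rewrite EFinM; apply: lee_wpmul2l; first by rewrite lee_fin ltW.
apply: le_trans (rdot_le vP wP k0 Nv) _.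
by rewrite -[leRHS]mule1; apply: lee_wpmul2l => //; rewrite lee_fin ltW.
Qed.

Lemma assoc_mono u v : nnmeas u -> nnmeas v ->
  (forall s, (0 <= s)%R -> dist mu u s <= dist mu v s) -> N' u <= N' v.
Proof.
move=> uP vP uv; apply: ge_ereal_sup => _ [w [wP w1] <-].
apply: le_trans (integral_le_rdot uP wP) _.
apply: (@le_trans _ _ (rdot mu v w)).
  rewrite -[leRHS]mul1e; apply: rdot_dilate => // s s0; rewrite mul1e; exact: uv.
rewrite rdotC; have := rdot_le wP vP ltr01 w1.
by rewrite mul1e.
Qed.

Lemma rdot_lty u v : nnmeas u -> nnmeas v -> N u < +oo -> N' v < +oo -> rdot mu u v < +oo.
Proof.
move=> uP vP Nu Nv.
have Nu0 := fn_ge0 NP uP; have Nv0 := fn_ge0 (bn_fatou BN') vP.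
have k0 : (0 < fine (N u) + 1)%R by rewrite ltr_wpDl// fine_ge0.
have Nuk : N u <= (fine (N u) + 1)%:E by rewrite EFinD fineK ?leeDl// ge0_fin_numE.
apply: le_lt_trans (rdot_le uP vP k0 Nuk) _.
by rewrite lte_mul_pinfty// lee_fin ltW.
Qed.

(** A strictly positive weight of finite associate norm has a finite integral against [u]. *)
Lemma norm_lty_ae u : nnmeas u -> N u < +oo -> {ae mu, forall x, u x \is a fin_num}.
Proof.
move=> uP Nu; have [w [mw wb _ w' _]] := common_weight sf BN.
have wP : nnmeas (fun x => (w x)%:E).
  by apply: nnmeas_EFin => // x; have /andP[/ltW] := wb x.
have uwP := nnmeasM uP wP.
have : \int[mu]_x (u x * (w x)%:E) < +oo.
  exact: le_lt_trans (integral_le_rdot uP wP) (rdot_lty uP wP Nu w').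
move=> /(integral_lty_ae uwP); apply: filterS => x /=.
have /andP[wx _] := wb x; rewrite !ge0_fin_numE ?uP.2 ?uwP.2// => h.
by rewrite ltey; apply: contraTneq h => ->; rewrite gt0_mulye ?lte_fin.
Qed.

Lemma assoc_lty_ae v : nnmeas v -> N' v < +oo -> {ae mu, forall x, v x \is a fin_num}.
Proof.
move=> vP Nv; have [w [mw wb w' _ _]] := common_weight sf BN.
have wP : nnmeas (fun x => (w x)%:E).
  by apply: nnmeas_EFin => // x; have /andP[/ltW] := wb x.
have uwP := nnmeasM wP vP.
have : \int[mu]_x ((w x)%:E * v x) < +oo.
  exact: le_lt_trans (integral_le_rdot wP vP) (rdot_lty wP vP w' Nv).
move=> /(integral_lty_ae uwP); apply: filterS => x /=.
have /andP[wx _] := wb x; rewrite !ge0_fin_numE ?vP.2 ?uwP.2// => h.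
by rewrite ltey; apply: contraTneq h => ->; rewrite gt0_muley ?lte_fin.
Qed.

(** The tail is supported by a set of finite measure, whose indicator belongs to the space. *)
Lemma tail_lty (M : R) v : (0 < M)%R -> nnmeas v -> N' v < +oo -> vanishing v ->
  \int[mu]_x tail M v x < +oo.
Proof.
move=> M0 vP Nv vv; have mE : measurable [set x | M%:E < v x] by exact: measurable_gt.
have [C C0 hC] := bn_int BN' mE (vv M M0).
apply: le_lt_trans (hC v vP) _.
by rewrite lte_mul_pinfty// ?lee_fin ?(ltW C0).
Qed.

Lemma cvg_tail v : nnmeas v -> N' v < +oo -> vanishing v ->
  \int[mu]_x tail n.+1%:R v x @[n --> \oo] --> 0.
Proof.
move=> vP Nv vv.
have t1 : mu.-integrable setT (tail 1 v).
  apply/integrableP; split; first exact: (nnmeas_tail 1 vP).1.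
  under eq_integral do rewrite gee0_abs ?(nnmeas_tail 1 vP).2//.
  exact: tail_lty.
have := dominated_convergence (mu := mu) measurableT
  (f_ := fun n => tail n.+1%:R v) (f := cst 0) (g := tail 1 v) _ _ _ t1.
move=> /(_ _ _ _ _)[]; last by move=> _ _; rewrite integral0; exact.
- by move=> n; exact: (nnmeas_tail _ vP).1.
- by [].
- apply: filterS (assoc_lty_ae vP Nv) => x vx _.
  apply: (@cvg_trans _ ((fun=> 0) @ \oo)); last exact: cvg_cst.
  apply: near_eq_cvg; near=> n; rewrite tailE ifF ?mule0//.
  apply/negbTE; rewrite -leNgt -(fineK vx) lee_fin.
  near: n; have := nbhs_infty_ger (fine (v x)); apply: filterS => n /= h.
  by apply: le_trans h _; rewrite ler_nat.
- apply: aeT => x n _; rewrite gee0_abs ?(nnmeas_tail _ vP).2// !tailE.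
  apply: lee_wpmul2l; first exact: vP.2.
  case: ifP => [h|_]; last by case: ifP.
  by rewrite ifT// (le_lt_trans _ h)// lee_fin ler1n.
Unshelve. all: end_near. Qed.

(** The estimate behind the convergence of averages for the pairings. All terms of
    [integral_split] depend on [v] only through its distribution function, so the bound holds for
    all functions equidistributed with [v], and passes to their supremum by resonance. *)
Lemma small_rdot v (c c' e : R) : nnmeas v -> N' v < +oo -> vanishing v ->
  (0 < c)%R -> (0 < c')%R -> (0 < e)%R -> exists2 del : R, (0 < del)%R &
  forall u, nnmeas u -> (forall x, u x <= c%:E) -> \int[mu]_x u x <= c'%:E ->
    \int[mu]_x (u x * u x) <= del%:E -> rdot mu u v <= e%:E.
Proof.
move=> vP Nv vv c0 c'0 e0.
(* Each of the four terms of the splitting is made at most [e / 4]. *)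
pose eta := (e / (4 * c'))%R.
have eta0 : (0 < eta)%R by rewrite divr_gt0// mulr_gt0.
have [M M0 hM] : exists2 M : R, (0 < M)%R & \int[mu]_x tail M v x <= (e / (4 * c))%:E.
  have e4 : (0 < e / (4 * c))%R by rewrite divr_gt0// mulr_gt0.
  have /fine_cvgP[_ /cvgrPdist_le/(_ _ e4)] := cvg_tail vP Nv vv.
  move=> [n _ /(_ n (leqnn _))] /=; rewrite sub0r normrN => hn.
  exists n.+1%:R => //.
  have fn : \int[mu]_x tail n.+1%:R v x \is a fin_num.
    rewrite ge0_fin_numE ?(fn_ge0 (fatou_norm_int mu))//; [exact: tail_lty | exact: nnmeas_tail].
  by rewrite -(fineK fn) lee_fin; apply: le_trans hn; exact: ler_norm.
have I0 : 0 <= \int[mu]_x tail eta v x by apply: (fn_ge0 (fatou_norm_int mu)); exact: nnmeas_tail.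
have If : \int[mu]_x tail eta v x \is a fin_num by rewrite ge0_fin_numE//; exact: tail_lty.
pose I := fine (\int[mu]_x tail eta v x).
have I0' : (0 <= I)%R by exact: fine_ge0.
have I1 : (0 < 4 * (I + 1))%R by rewrite mulr_gt0// ltr_wpDl.
pose e1 := (e / (4 * (I + 1)))%R.
have e10 : (0 < e1)%R by rewrite divr_gt0.
pose k := (c * M / e1 ^+ 2)%R.
have k0 : (0 < k)%R by rewrite divr_gt0 ?exprn_gt0// mulr_gt0.
exists (e / (4 * k))%R; first by rewrite divr_gt0// mulr_gt0.
move=> u uP uc ui uu; rewrite -res//; apply: ge_ereal_sup => _ [w [wP wv] <-].
apply: le_trans (integral_split c0 eta0 e10 M0 uP wP uc) _.
rewrite (equidist_tail (ltW eta0) vP wP wv) (equidist_tail (ltW M0) vP wP wv).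
have -> : e%:E = (e / 4)%:E + (e / 4)%:E + (e / 4)%:E + (e / 4)%:E.
  by rewrite -!EFinD; congr (_%:E); field.
apply: leeD; first apply: leeD; first apply: leeD.
- apply: (@le_trans _ _ (eta%:E * c'%:E)); first by apply: lee_wpmul2l => //; rewrite lee_fin ltW.
  rewrite -EFinM lee_fin /eta le_eqVlt; apply/orP; left; apply/eqP; field.
  by rewrite gt_eqF.
- rewrite -(fineK If) -EFinM lee_fin -/I /e1 mulrAC ler_pdivrMr//.
  by nra.
- apply: (@le_trans _ _ (k%:E * (e / (4 * k))%:E)).
    by apply: lee_wpmul2l => //; rewrite lee_fin ltW.
  rewrite -EFinM lee_fin le_eqVlt; apply/orP; left; apply/eqP; field.
  by rewrite gt_eqF.
- apply: (@le_trans _ _ (c%:E * (e / (4 * c))%:E)).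
    by apply: lee_wpmul2l => //; rewrite lee_fin ltW.
  rewrite -EFinM lee_fin le_eqVlt; apply/orP; left; apply/eqP; field.
  by rewrite gt_eqF.
Qed.

(** The level sets of [u] have finite measure, so the distribution functions of the [f n] tend
    to zero by dominated convergence on the space; hence the rearrangements tend to zero, and
    dominated convergence applies once more, on the half-line. Functions that escape to infinity
    without becoming small show why [u] has to vanish at infinity: rearrangement does not see where
    a function lives. *)
Lemma dominated_rdot (f : nat -> T -> \bar R) u v : (forall n, nnmeas (f n)) ->
  nnmeas u -> nnmeas v -> (forall n x, f n x <= u x) ->
  {ae mu, forall x, f n x @[n --> \oo] --> 0} -> vanishing u -> rdot mu u v < +oo ->
  rdot mu (f n) v @[n --> \oo] --> 0.
Proof.
move=> fP uP vP fu f0 uu ruv.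
have d0 (s : R) : (0 < s)%R -> dist mu (f n) s @[n --> \oo] --> 0.
  move=> s0; pose E n := [set x | s%:E < f n x].
  have mE n : measurable (E n) by exact: measurable_gt.
  pose F := [set x | s%:E < u x]; have mF : measurable F by exact: measurable_gt.
  have iF : mu.-integrable setT (fun x => (\1_F x)%:E).
    apply/integrableP; split; first exact: (nnmeas_indic mF).1.
    under eq_integral do rewrite gee0_abs ?(nnmeas_indic mF).2//.
    by rewrite integral_indic// setIT; exact: uu.
  have := dominated_convergence (mu := mu) measurableT
    (f_ := fun n x => (\1_(E n) x)%:E) (f := cst 0) (g := fun x => (\1_F x)%:E) _ _ _ iF.
  move=> /(_ _ _ _ _)[].
  - by move=> n; exact: (nnmeas_indic (mE n)).1.
  - by [].
  - apply: filterS f0 => x fx _.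
    apply: (@cvg_trans _ ((fun=> 0) @ \oo)); last exact: cvg_cst.
    apply: near_eq_cvg.
    have : \forall n \near \oo, f n x < s%:E by apply: (cvge_near_lt fx); rewrite lte_fin.
    apply: filterS => n fs; rewrite indicE memNset// /E /=.
    by apply/negP; rewrite -leNgt ltW.
  - apply: aeT => x n _; rewrite gee0_abs ?(nnmeas_indic (mE n)).2// lee_fin !indicE.
    case: (boolP (x \in E n)) => // /set_mem h; rewrite mem_set//.
    by rewrite /F /=; apply: lt_le_trans (fu n x).
  move=> _ _; rewrite integral0 => h; apply: cvg_trans h; apply: near_eq_cvg.
  by apply: nearW => n /=; rewrite integral_indic// setIT.
have mr g : nnmeas g -> measurable_fun (`[0%R, +oo[ : set R) (rea mu g).
  by move=> gP; apply: nonincreasing_emeasurable => s s' _; exact: le_rea.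
have mm g : nnmeas g -> measurable_fun (`[0%R, +oo[ : set R) (fun t => rea mu g t * rea mu v t).
  by move=> gP; apply: emeasurable_funM; exact: mr.
have ile n t : rea mu (f n) t <= rea mu u t.
  apply: ereal_inf_le_tmp => _ [s [s0 ds] <-]; exists s => //; split => //.
  apply: le_trans ds; apply: le_measure; rewrite ?inE; try exact: measurable_gt.
  by move=> x /= sx; apply: lt_le_trans (fu n x).
have int : lebesgue_measure.-integrable (`[0%R, +oo[ : set R) (fun t => rea mu u t * rea mu v t).
  apply/integrableP; split; first exact: mm.
  by under eq_integral do rewrite gee0_abs ?mule_ge0 ?rea_ge0//.
have := dominated_convergence (mu := lebesgue_measure) (measurable_itv `[0%R, +oo[)
  (f_ := fun n t => rea mu (f n) t * rea mu v t) (f := cst 0) _ _ _ int.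
move=> /(_ _ _ _ _)[]; last by move=> _ _; rewrite integral0; exact.
- by move=> n; exact: mm.
- by [].
- have h1 := (fun mI => integrable_ae mI int).
  have {}h1 := h1 (measurable_itv _).
  have [Z [mZ Z0 sZ]] := h1.
  exists (Z `|` [set 0%R]); split; first by apply: measurableU.
    apply/eqP; rewrite eq_le measure_ge0 andbT.
    apply: le_trans (measureU2 _ mZ (measurable_set1 _)) _.
    by rewrite [X in X + _]Z0 add0e [leLHS]lebesgue_measure_set1.
  move=> t nt; apply: contrapT => ntZ; apply: nt => tD.
  have tge : (0 <= t)%R by move: tD; rewrite /= in_itv /= andbT.
  have t0 : t != 0%R by apply: contra_notN ntZ => /eqP ->; right.
  have fin : rea mu u t * rea mu v t \is a fin_num.
    by apply: contrapT => h; apply: ntZ; left; apply: sZ => /(_ tD).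
  have tpos : (0 < t)%R by rewrite lt_neqAle eq_sym t0.
  have r0 : rea mu (f n) t @[n --> \oo] --> 0.
    apply/fine_cvgP; split.
      have : \forall n \near \oo, dist mu (f n) 1 < t%:E.
        by apply: (cvge_near_lt (d0 1%R ltr01)); rewrite lte_fin.
      apply: filterS => n h; rewrite ge0_fin_numE ?rea_ge0//.
      apply: (@le_lt_trans _ _ 1%:E); last exact: ltry.
      by apply: ereal_inf_lbound; exists 1%R => //; split => //; exact: ltW.
    apply/cvgrPdist_le => e e0.
    have : \forall n \near \oo, dist mu (f n) e < t%:E.
      by apply: (cvge_near_lt (d0 e e0)); rewrite lte_fin.
    apply: filterS => n h; rewrite /= sub0r normrN ger0_norm ?fine_ge0 ?rea_ge0//.
    have le : rea mu (f n) t <= e%:E.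
      by apply: ereal_inf_lbound; exists e => //; split; exact: ltW.
    rewrite -lee_fin fineK// ge0_fin_numE ?rea_ge0//.
    exact: le_lt_trans le (ltry _).
  have [vf|vf] := boolP (rea mu v t \is a fin_num).
    by have := cvgeZr vf r0; rewrite mul0e.
  have uz : rea mu u t = 0.
    apply/eqP; apply: contraTT fin => u0.
    move: vf; rewrite ge0_fin_numE ?rea_ge0// -leNgt leye_eq => /eqP ->.
    by rewrite gt0_muley// lt_neqAle eq_sym u0 rea_ge0.
  apply: (@cvg_trans _ ((fun=> 0) @ \oo)); last exact: cvg_cst.
  apply: near_eq_cvg; apply: nearW => n /=.
  have -> : rea mu (f n) t = 0 by apply/eqP; rewrite eq_le rea_ge0 andbT -uz ile.
  by rewrite mul0e.
apply: aeT => t n _; rewrite gee0_abs ?mule_ge0 ?rea_ge0//.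
by apply: lee_wpmul2r; rewrite ?rea_ge0.
Qed.

End ResonantSpaces.

(** * Absolutely continuous norms *)

Section AbsolutelyContinuousNorm.
Context {R : realType} {d : measure_display} {T : measurableType d}.
Variable mu : {measure set T -> \bar R}.
Implicit Types (u v w : T -> \bar R) (E F : set T).

Definition indic_fun E : T -> \bar R := fun x => (\1_E x)%:E.

Lemma indic_funE E x : indic_fun E x = if x \in E then 1 else 0.
Proof. by rewrite /indic_fun indicE; case: ifP. Qed.

Lemma integral_indic_fun E : measurable E -> \int[mu]_x indic_fun E x = mu E.
Proof. by move=> mE; rewrite integral_indic// setIT. Qed.

Lemma dist_indic E (s : R) : (0 <= s)%R ->
  dist mu (indic_fun E) s = if (s < 1)%R then mu E else 0.
Proof.
move=> s0; rewrite /dist; case: ifPn => s1.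
  congr (mu _); apply/seteqP; split => x /=; rewrite indic_funE.
    by case: ifPn => [/set_mem//|_]; rewrite lte_fin ltNge s0.
  by move=> Ex; rewrite mem_set// lte_fin.
rewrite [X in mu X](_ : _ = set0) ?measure0//; apply/seteqP; split => x //=.
rewrite indic_funE; case: ifP => _; rewrite lte_fin; first by rewrite (negbTE s1).
by rewrite ltNge s0.
Qed.

Variable N : (T -> \bar R) -> \bar R.

Definition acn_nn u : Prop := forall E : nat -> set T, (forall k, measurable (E k)) ->
  {ae mu, forall x, (\1_(E k) x : R) @[k --> \oo] --> (0 : R)%R} ->
  N (fun x => u x * indic_fun (E k) x) @[k --> \oo] --> 0.

Hypothesis sf : sigma_finite setT mu.
Hypothesis res : resonant_nn mu.
Hypothesis BN : banach_norm mu N.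
Hypothesis inv : dist_invariant mu N.

Let NP := bn_fatou BN.
Let N' := assoc mu N.
Let BN' : banach_norm mu N' := banach_norm_assoc BN.

Lemma null_indic_norm E : measurable E -> mu E = 0 -> N (indic_fun E) = 0.
Proof.
move=> mE E0; apply/eqP; rewrite eq_le (fn_ge0 NP (nnmeas_indic mE)) andbT.
rewrite -(fn0 NP); apply: (fn_le NP); [exact: nnmeas_indic|exact: nnmeas_cst|].
exists E; split => // x /= nx; apply: contrapT => Ex; apply: nx.
by rewrite indic_funE memNset.
Qed.

Lemma cvg_squeeze0 (a b : nat -> \bar R) : (forall n, 0 <= a n) ->
  (forall n, a n <= b n) -> b n @[n --> \oo] --> 0 -> a n @[n --> \oo] --> 0.
Proof.
move=> a0 ab b0; apply: (squeeze_cvge _ (cvg_cst 0) b0).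
by apply: nearW => n; rewrite a0 ab.
Qed.

(** A superlevel set of infinite measure stays equidistributed with itself after removing
    any set of finite measure, so its norm could not tend to zero. *)
Lemma acn_vanishing u : nnmeas u -> acn_nn u -> vanishing mu u.
Proof.
move=> uP ua s s0; rewrite ltey; apply/negP => /eqP muG.
have /sigma_finiteP [F [FT Fnd Ffin]] := sf.
have mF k : measurable (F k) by case: (Ffin k).
pose G := [set x | s%:E < u x]; have mG : measurable G by exact: measurable_gt.
have muGk k : mu (G `&` ~` F k) = +oo.
  apply/eqP; rewrite -leye_eq -[leLHS]muG.
  have : mu G <= mu (G `&` ~` F k) + mu (F k).
    apply: (@le_trans _ _ (mu ((G `&` ~` F k) `|` F k))).
      apply: le_measure; rewrite ?inE//.
        by apply: measurableU => //; apply: measurableI => //; exact: measurableC.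
      by move=> x Gx; have [Fx|nFx] := pselect (F k x); [right|left].
    by apply: measureU2 => //; apply: measurableI => //; exact: measurableC.
  rewrite [X in X <= _]muG => le; rewrite leNgt; apply/negP => a.
  have {}a : mu (G `&` ~` F k) < +oo by apply: lt_le_trans a _; rewrite leey.
  by have := lte_add_pinfty a (Ffin k).2; rewrite ltNge le.
have mGk k : measurable (G `&` ~` F k) by apply: measurableI => //; exact: measurableC.
have NG k : N (indic_fun (G `&` ~` F k)) = N (indic_fun G).
  apply: inv; [exact: nnmeas_indic|exact: nnmeas_indic|] => t t0.
  by rewrite !dist_indic// muGk; case: ifP => // _; exact/esym.
have lim0 : N (fun x => u x * indic_fun (~` F k) x) @[k --> \oo] --> 0.
  apply: ua => [k|]; first exact: measurableC.
  apply: aeT => x; have [k0 _ Fx] : (\bigcup_i F i) x by rewrite -FT.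
  apply: (@cvg_trans _ ((fun=> 0%R : R) @ \oo)); last exact: cvg_cst.
  apply: near_eq_cvg; exists k0 => // k /= k0k; rewrite indicE memNset//= => nF.
  by apply: nF; have /subsetPset := Fnd _ _ k0k; apply.
have sN k : s%:E * N (indic_fun G) <= N (fun x => u x * indic_fun (~` F k) x).
  rewrite -(NG k) -(fn_Z NP (ltW s0)); last exact: nnmeas_indic.
  apply: (fn_leT NP).
  - by apply: nnmeasZ; [rewrite lee_fin ltW | exact: nnmeas_indic].
  - by apply: nnmeasM => //; apply: nnmeas_indic; exact: measurableC.
  move=> x; rewrite !indic_funE; case: ifPn => [/set_mem[Gx nF]|_].
    by rewrite mem_set// !mule1 ltW.
  rewrite mule0; case: ifP; rewrite ?mule0 ?mule1//.
  by rewrite uP.2.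
have NG0 : N (indic_fun G) = 0.
  apply/eqP; rewrite eq_le (fn_ge0 NP (nnmeas_indic mG)) andbT.
  have : s%:E * N (indic_fun G) <= 0.
    have <- := cvg_lim (@ereal_hausdorff R) lim0.
    by apply: lime_ge; [exact: cvgP lim0 | exact: nearW].
  by rewrite pmule_rle0// lte_fin.
have GF0 k : mu (G `&` F k) = 0.
  have [C C0 hC] := bn_int BN (mF k) (Ffin k).2.
  have := hC _ (nnmeas_indic mG); rewrite NG0 mule0 => h.
  apply/eqP; rewrite eq_le measure_ge0 andbT; apply: le_trans h.
  rewrite -integral_indic_fun; last exact: measurableI.
  apply: ge0_le_integral => //.
  - by move=> x _; exact: (nnmeas_indic (measurableI _ _ mG (mF k))).2.
  - exact: (nnmeas_indic (measurableI _ _ mG (mF k))).1.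
  - exact: (nnmeasM (nnmeas_indic mG) (nnmeas_indic (mF k))).1.
  by move=> x _; rewrite -EFinM lee_fin indicI.
have : mu G = 0.
  have -> : G = \bigcup_k (G `&` F k) by rewrite -setI_bigcupr -FT setIT.
  apply/eqP; rewrite eq_le measure_ge0 andbT.
  apply: le_trans (measure_sigma_subadditive _ _ _ (@subset_refl _ _)) _.
  - by move=> k; exact: measurableI.
  - by apply: bigcup_measurable => k _; exact: measurableI.
  by rewrite (eq_eseriesr (g := fun=> 0)) ?eseries0.
by rewrite [LHS]muG.
Qed.

(** The pairing of the two indicators is the smaller measure. By resonance it is almost attained
    by a function equidistributed with the indicator of [E], that is, by the indicator of a set,
    at least half of which must then lie in [F]. *)
Lemma resonant_subset E F : measurable E -> measurable F -> mu F < +oo -> mu E <= mu F ->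
  0 < mu E -> exists G, [/\ measurable G, G `<=` F, mu E <= 2%:E * mu G & mu G <= mu E].
Proof.
move=> mE mF Ffin EF E0.
have EP : nnmeas (indic_fun E) by exact: nnmeas_indic.
have FP : nnmeas (indic_fun F) by exact: nnmeas_indic.
have Efin : mu E \is a fin_num by rewrite ge0_fin_numE// (le_lt_trans EF).
have : mu E <= rdot mu (indic_fun F) (indic_fun E).
  apply: (@le_trans _ _ (rdot mu (indic_fun E) (indic_fun E))).
    apply: le_trans (integral_le_rdot res EP EP).
    rewrite -(integral_indic_fun mE); apply: ge0_le_integral => //.
    - by move=> x _; exact: EP.2.
    - exact: EP.1.
    - exact: (nnmeasM EP EP).1.
    by move=> x _; rewrite !indic_funE; case: ifP => _; rewrite ?mule1 ?mule0.
  rewrite -[leRHS]mul1e; apply: rdot_dilate => // s s0; rewrite mul1e !dist_indic//.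
  by case: ifP.
rewrite -res// => hsup.
have half : 2^-1%:E * mu E < mu E.
  rewrite -(fineK Efin) -EFinM lte_fin.
  by have : (0 < fine (mu E))%R by [rewrite fine_gt0// E0 ltey_eq Efin]; lra.
have [_ [w [wP wE] <-] hw] := ereal_sup_gt (lt_le_trans half hsup).
have mw0 : measurable [set x | 0 < w x] by exact: measurable_gt.
pose G := F `&` [set x | 0 < w x].
have mG : measurable G by exact: measurableI.
have w0E : mu [set x | 0 < w x] = mu E.
  by have := wE 0%R (lexx _); rewrite dist_indic// ltr01.
have w1 : {ae mu, forall x, w x <= 1}.
  exists [set x | 1 < w x]; split; first exact: measurable_gt.
    by have := wE 1%R ler01; rewrite dist_indic// ltxx.
  by move=> x /= /negP; rewrite -ltNge.
exists G; split => //; first by move=> x [].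
  have : \int[mu]_x (indic_fun F x * w x) <= mu G.
    rewrite -(integral_indic_fun mG); apply: ae_ge0_le_integral => //.
    - by move=> x _; exact: (nnmeasM FP wP).2.
    - exact: (nnmeasM FP wP).1.
    - by move=> x _; exact: (nnmeas_indic mG).2.
    - exact: (nnmeas_indic mG).1.
    apply: filterS w1 => x wx _; rewrite !indic_funE.
    case: ifPn => [/set_mem Fx|_]; last by rewrite mul0e; case: ifP.
    rewrite mul1e; have [w0|w0] := ltP 0 (w x); first by rewrite mem_set.
    by apply: le_trans w0 _; case: ifP.
  move=> /(lt_le_trans hw) /ltW.
  have -> : mu E = 2%:E * (2^-1%:E * mu E) by rewrite muleA -EFinM divff// mul1e.
  by rewrite muleA -EFinM mulVf// mul1e => h; apply: lee_wpmul2l.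
by rewrite -[leRHS]w0E; apply: le_measure; rewrite ?inE// => x [].
Qed.

Lemma not_null_level u : nnmeas u -> ~ {ae mu, forall x, u x = 0} ->
  exists2 s : R, (0 < s)%R & 0 < dist mu u s.
Proof.
move=> uP u0; apply: contrapT => h; apply: u0.
have : dist mu u 0 <= 0.
  apply: (cvge_le (dist_right_cont (s := 0%R) uP)) => n.
  rewrite leNgt; apply/negP => n0; apply: h; exists n.+1%:R^-1%R.
    by rewrite invr_gt0.
  by rewrite add0r in n0.
move=> h0; exists [set x | 0 < u x]; split; first exact: measurable_gt.
  by apply/eqP; rewrite eq_le measure_ge0 andbT.
by move=> x /= /eqP ux; rewrite lt_neqAle eq_sym ux uP.2.
Qed.

(** Otherwise there are sets of summable measures whose indicators have norms bounded below.
    Resonance places sets of comparable measure below a level set of [u], without changing the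
    norms by more than a constant factor. By absolute continuity, [u] restricted to these sets
    tends to zero in norm, a contradiction. *)
Lemma acn_indic_small u (e : R) : nnmeas u -> acn_nn u ->
  ~ {ae mu, forall x, u x = 0} -> (0 < e)%R ->
  exists2 del : R, (0 < del)%R & forall E, measurable E -> mu E <= del%:E ->
    N (indic_fun E) <= e%:E.
Proof.
move=> uP ua u0 e0.
have [s s0 Fs] := not_null_level uP u0.
pose F := [set x | s%:E < u x]; have mF : measurable F by exact: measurable_gt.
have Ffin : mu F < +oo by exact: acn_vanishing.
have Ff : mu F \is a fin_num by rewrite ge0_fin_numE.
apply: contrapT => h.
have ex j : exists E, [/\ measurable E, mu E <= mu F, mu E <= (2^-1 ^+ j.+1)%:E &
    e%:E < N (indic_fun E)].
  apply: contrapT => hj; apply: h.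
  exists (Num.min (fine (mu F)) (2^-1 ^+ j.+1))%R.
    by rewrite lt_min exprn_gt0 ?invr_gt0// andbT fine_gt0// Ffin andbT.
  move=> E mE; rewrite EFin_min le_min fineK// => /andP[EF Ej].
  by rewrite leNgt; apply/negP => eE; apply: hj; exists E.
have [E EP] := choice ex.
have E0 j : 0 < mu (E j).
  rewrite lt_neqAle measure_ge0 andbT eq_sym; apply/eqP => E0.
  by case: (EP j) => mE _ _; rewrite null_indic_norm// lte_fin ltNge (ltW e0).
have exG j : exists G, [/\ measurable G, G `<=` F, mu (E j) <= 2%:E * mu G & mu G <= mu (E j)].
  by case: (EP j) => mE EF _ _; exact: resonant_subset.
have [G GP] := choice exG.
have mG j : measurable (G j) by case: (GP j).
have sG : \sum_(j <oo) mu (G j) < +oo.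
  apply: (@le_lt_trans _ _ 1); last exact: ltry.
  apply: (cvge_le (cvg_nneseries (fun j => measure_ge0 mu (G j)))) => n.
  apply: (@le_trans _ _ (\sum_(k < n) (2^-1 ^+ k.+1)%:E)).
    apply: lee_sum => k _; case: (GP k) => _ _ _ h1; case: (EP k) => _ _ h2 _.
    exact: le_trans h1 h2.
  by rewrite sumEFin lee_fin geometric_half.
have lim0 : N (fun x => u x * indic_fun (G j) x) @[j --> \oo] --> 0.
  apply: ua => //; exists (lim_sup_set G); split.
  - by apply: bigcap_measurable => // k _; exact: bigcup_measurable.
  - exact: lim_sup_set_cvg0.
  move=> x /= nx n _; apply: contrapT => nG; apply: nx.
  apply: (@cvg_trans _ ((fun=> 0%R : R) @ \oo)); last exact: cvg_cst.
  apply: near_eq_cvg; exists n => // k /= nk; rewrite indicE memNset// => Gx.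
  by apply: nG; exists k.
have le j : (s * (e / 2))%:E <= N (fun x => u x * indic_fun (G j) x).
  case: (EP j) => mE _ _ eE; case: (GP j) => _ GF EG _.
  have : N (indic_fun (E j)) <= 2%:E * N (indic_fun (G j)).
    apply: (norm_dilate sf res BN inv) => //; [by rewrite ler1n|exact: nnmeas_indic|exact: nnmeas_indic|].
    by move=> t t0; rewrite !dist_indic//; case: ifP => //; rewrite mule0.
  move=> /(lt_le_trans eE)/ltW h1.
  apply: (@le_trans _ _ (s%:E * N (indic_fun (G j)))).
    rewrite EFinM; apply: lee_wpmul2l; first by rewrite lee_fin ltW.
    by rewrite mulrC EFinM lee_pdivrMl.
  rewrite -(fn_Z NP (ltW s0)); last exact: nnmeas_indic.
  apply: (fn_leT NP).
  - by apply: nnmeasZ; [rewrite lee_fin ltW | exact: nnmeas_indic].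
  - by apply: nnmeasM => //; exact: nnmeas_indic.
  move=> x; rewrite !indic_funE; case: ifPn => [/set_mem Gx|_]; last by rewrite !mule0.
  by rewrite !mule1 ltW//; exact: GF.
have : (s * (e / 2))%:E <= 0.
  have <- := cvg_lim (@ereal_hausdorff R) lim0.
  by apply: lime_ge; [exact: cvgP lim0 | exact: nearW].
by rewrite lee_fin leNgt mulr_gt0// divr_gt0.
Qed.

Hypothesis ACR' : forall v, nnmeas v -> N' v < +oo -> vanishing mu v.

(** If sets of arbitrarily large measure had indicators of bounded associate norm, then so would
    all sets of finite measure, and constants would have finite associate norm. As the associate
    space consists of vanishing functions, the whole space would have finite measure. *)
Lemma assoc_indic_bound (k : R) : exists M : R, forall E, measurable E ->
  N' (indic_fun E) <= k%:E -> mu E <= M%:E.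
Proof.
apply: contrapT => /forallNP h.
have ex n : exists E, [/\ measurable E, N' (indic_fun E) <= k%:E & n%:R%:E < mu E].
  have /existsNP[E /not_implyP[mE /not_implyP[Ek En]]] := h n%:R.
  by exists E; split => //; rewrite ltNge; exact/negP.
have [E EP] := choice ex.
have /sigma_finiteP [F [FT Fnd Ffin]] := sf.
have mF j : measurable (F j) by case: (Ffin j).
have NF j : N' (indic_fun (F j)) <= k%:E.
  have Fj : mu (F j) \is a fin_num by rewrite ge0_fin_numE// (Ffin j).2.
  pose n := Num.bound (fine (mu (F j))).
  have [mE En nE] := EP n.
  apply: le_trans En; apply: (assoc_mono res BN inv); [exact: nnmeas_indic|exact: nnmeas_indic|].
  move=> s s0; rewrite !dist_indic//; case: ifP => // _.
  apply: le_trans (ltW nE); rewrite -(fineK Fj) lee_fin.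
  by apply/ltW/archi_boundP; exact: fine_ge0.
have N1 : N' (cst 1) <= k%:E.
  apply: (fn_fatou (bn_fatou BN') (f := fun j => indic_fun (F j))) => //.
    by move=> j; exact: nnmeas_indic.
  apply: aeT => x; have [j0 _ Fx] : (\bigcup_i F i) x by rewrite -FT.
  apply: (@cvg_trans _ ((fun=> 1) @ \oo)); last exact: cvg_cst.
  apply: near_eq_cvg; exists j0 => // j /= j0j; rewrite indic_funE mem_set//.
  by have /subsetPset := Fnd _ _ j0j; apply.
have muT : mu setT < +oo.
  have := ACR' (nnmeas_cst lee01) (le_lt_trans N1 (ltry k)) (s := 2^-1%R).
  rewrite /dist [X in mu X](_ : _ = setT); first by apply; rewrite invr_gt0.
  by apply/seteqP; split => x //= _; rewrite lte_fin invf_lt1// ltr1n.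
have muTf : mu setT \is a fin_num by rewrite ge0_fin_numE.
apply: (h (fine (mu setT))) => E' mE' _.
by rewrite fineK//; apply: le_measure; rewrite ?inE.
Qed.

(** By invariance it is enough to dominate all sets of measure at most [M] by one set of finite
    measure: a term of the exhausting sequence, or the whole space. *)
Lemma indic_bound (M : R) : exists2 C : R, (0 < C)%R &
  forall E, measurable E -> mu E <= M%:E -> N (indic_fun E) <= C%:E.
Proof.
have /sigma_finiteP [F [FT Fnd Ffin]] := sf.
have mF j : measurable (F j) by case: (Ffin j).
have [[F0 [mF0 F0fin F0M]]|h] := pselect (exists F0, [/\ measurable F0, mu F0 < +oo &
    forall E, measurable E -> mu E <= M%:E -> mu E <= mu F0]).
  have NF0 := fn_ge0 NP (nnmeas_indic (R:=R) mF0).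
  exists (fine (N (indic_fun F0)) + 1)%R; first by rewrite ltr_wpDl// fine_ge0.
  move=> E mE EM; apply: (@le_trans _ _ (1%:E * N (indic_fun F0))).
    apply: (norm_dilate sf res BN inv) => //; [exact: nnmeas_indic|exact: nnmeas_indic|].
    by move=> s s0; rewrite !dist_indic// mul1e; case: ifP => // _; exact: F0M.
  rewrite mul1e EFinD fineK ?leeDl//.
  by rewrite ge0_fin_numE//; exact: (bn_indic BN).
exfalso; apply: h.
have [[j Mj]|h] := pselect (exists j, M%:E <= mu (F j)).
  by exists (F j); split => //; [exact: (Ffin j).2 | move=> E _ EM; exact: le_trans Mj].
exists setT; split => //; last by move=> E mE _; apply: le_measure; rewrite ?inE.
apply: (@le_lt_trans _ _ M%:E); last exact: ltry.
have mFU : measurable (\bigcup_i F i) by exact: bigcup_measurable.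
rewrite FT; apply: (cvge_le (nondecreasing_cvg_mu mF mFU Fnd)) => j /=; rewrite leNgt; apply/negP => jM; apply: h.
by exists j; exact: ltW.
Qed.

(** On the unit ball of the associate space, [eta] times the indicator of the superlevel set
    at height [eta] has norm at most one. Hence these sets have uniformly bounded measure, and
    Hoelder's inequality bounds the integrals of the tails. *)
Lemma tail_bound (eta : R) : (0 < eta)%R -> exists2 C : R, (0 < C)%R &
  forall v, nnmeas v -> N' v <= 1 -> \int[mu]_x tail eta v x <= C%:E.
Proof.
move=> eta0; have [M hM] := assoc_indic_bound eta^-1.
have [C C0 hC] := indic_bound M; exists C => // v vP v1.
pose E := [set x | eta%:E < v x]; have mE : measurable E by exact: measurable_gt.
have EP : nnmeas (indic_fun E) by exact: nnmeas_indic.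
have NE : N (indic_fun E) <= C%:E.
  apply: hC => //; apply: hM => //.
  rewrite -[leRHS]mule1 -lee_pdivrMl ?invr_gt0// invrK.
  rewrite -(fn_Z (bn_fatou BN') (ltW eta0) EP); apply: le_trans v1.
  apply: (fn_leT (bn_fatou BN')) => //; first by apply: nnmeasZ => //; rewrite lee_fin ltW.
  move=> x; rewrite indic_funE; case: ifPn => [/set_mem|_]; first by rewrite mule1 => /ltW.
  by rewrite mule0 vP.2.
under eq_integral do rewrite /tail muleC.
apply: le_trans (hoelder_assoc NP EP vP C0 NE) _.
by rewrite -[leRHS]mule1; apply: lee_wpmul2l => //; rewrite lee_fin ltW.
Qed.

(** The counterpart of [small_rdot] for the norm itself. The set where [u] is not small has
    small measure by Chebyshev's inequality, and its indicator has small norm. The rest is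
    estimated by duality, with the uniform bound on tails in the unit ball of the associate
    space. *)
Lemma small_norm g (c c' e : R) : nnmeas g -> acn_nn g -> ~ {ae mu, forall x, g x = 0} ->
  (0 < c)%R -> (0 < c')%R -> (0 < e)%R -> exists2 del : R, (0 < del)%R &
  forall u, nnmeas u -> (forall x, u x <= c%:E) -> \int[mu]_x u x <= c'%:E ->
    \int[mu]_x (u x * u x) <= del%:E -> N u <= e%:E.
Proof.
move=> gP ga g0 c0 c'0 e0.
pose eta := (e / (4 * c'))%R.
have eta0 : (0 < eta)%R by rewrite divr_gt0// mulr_gt0.
have [C C0 hC] := tail_bound eta0.
pose e1 := (e / (4 * C))%R.
have e10 : (0 < e1)%R by rewrite divr_gt0// mulr_gt0.
have e2 : (0 < e / (2 * c))%R by rewrite divr_gt0// mulr_gt0.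
have [del0 del00 hdel] := acn_indic_small gP ga g0 e2.
exists (e1 ^+ 2 * del0)%R; first by rewrite mulr_gt0// exprn_gt0.
move=> u uP uc ui uu.
pose E := [set x | e1%:E < u x]; have mE : measurable E by exact: measurable_gt.
have EP : nnmeas (indic_fun E) by exact: nnmeas_indic.
have cEP : nnmeas (fun x => c%:E * indic_fun E x).
  by apply: nnmeasZ => //; rewrite lee_fin ltW.
have uEP : nnmeas (fun x => u x * indic_fun (~` E) x).
  by apply: nnmeasM => //; apply: nnmeas_indic; exact: measurableC.
have muE : mu E <= del0%:E.
  rewrite -(@lee_pmul2l _ (e1 ^+ 2)%:E) ?lte_fin ?exprn_gt0//.
  apply: le_trans uu; rewrite -(integral_indic_fun mE).
  rewrite -ge0_integralZl//; [|exact: EP.1|by move=> x _; exact: EP.2|by rewrite lee_fin sqr_ge0].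
  apply: ge0_le_integral => //.
  - by move=> x _; apply: mule_ge0; rewrite ?lee_fin ?sqr_ge0.
  - by apply: emeasurable_funM => //; exact: EP.1.
  - exact: (nnmeasM uP uP).1.
  move=> x _; rewrite -/(indic_fun E x) indic_funE; case: ifPn => [/set_mem Ex|_].
    rewrite mule1 expr2 EFinM; apply: lee_pmul; rewrite ?lee_fin ?ltW//.
  by rewrite mule0 mule_ge0 ?uP.2.
have sp : N u <= N (fun x => c%:E * indic_fun E x) + N (fun x => u x * indic_fun (~` E) x).
  apply: le_trans (fn_D NP cEP uEP); apply: (fn_leT NP) => //; first exact: nnmeasD.
  move=> x; rewrite !indic_funE in_setC; case: (x \in E) => /=.
    by rewrite mule1 mule0 adde0.
  by rewrite mule0 mule1 add0e.
apply: le_trans sp _; have -> : e%:E = (e / 2)%:E + (e / 2)%:E.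
  by rewrite -EFinD -splitr.
apply: leeD.
  rewrite (fn_Z NP (ltW c0) EP).
  apply: (@le_trans _ _ (c%:E * (e / (2 * c))%:E)).
    by apply: lee_wpmul2l; [rewrite lee_fin ltW | exact: hdel].
  rewrite -EFinM lee_fin le_eqVlt; apply/orP; left; apply/eqP; field.
  by rewrite gt_eqF.
apply: (lorentz_luxemburg sf BN) => //; first by rewrite divr_gt0.
move=> v vP v1.
have p1 : nnmeas (fun x => eta%:E * u x) by apply: nnmeasZ => //; rewrite lee_fin ltW.
have p2 : nnmeas (fun x => e1%:E * tail eta v x).
  by apply: nnmeasZ; [rewrite lee_fin ltW | exact: nnmeas_tail].
have I := fatou_norm_int mu.
apply: (@le_trans _ _ (\int[mu]_x (eta%:E * u x + e1%:E * tail eta v x))).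
  apply: (fn_leT I); [exact: nnmeasM|exact: nnmeasD|].
  move=> x; have u0 := uP.2 x; have v0 := vP.2 x.
  have q1 := p1.2 x; have q2 := p2.2 x; rewrite indic_funE in_setC.
  have [xE|xE] := boolP (x \in E); first by rewrite /= mule0 mul0e adde_ge0.
  rewrite /= mule1; have ue1 : u x <= e1%:E by rewrite leNgt; apply: contraNN xE => /mem_set.
  have [vx|vx] := leP (v x) eta%:E.
    by rewrite muleC; apply: le_trans (lee_wpmul2r u0 vx) _; rewrite leeDl.
  apply: le_trans (lee_wpmul2r v0 ue1) _.
  by rewrite tailE vx mule1 leeDr.
apply: le_trans (fn_D I p1 p2) _; rewrite (fn_Z I (ltW eta0) uP).
rewrite (fn_Z I (ltW e10) (nnmeas_tail eta vP)).
apply: (@le_trans _ _ (eta%:E * c'%:E + e1%:E * C%:E)).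
  apply: leeD; apply: lee_wpmul2l => //; [by rewrite lee_fin ltW| |by apply: hC].
  by rewrite lee_fin ltW.
rewrite -!EFinM -EFinD lee_fin le_eqVlt; apply/orP; left; apply/eqP.
by rewrite /eta /e1; field; rewrite !gt_eqF.
Qed.

End AbsolutelyContinuousNorm.

(** * A mean ergodic theorem in Hilbert seminorms *)

Section CesaroMeans.
Context {R : realType} {V : lmodType R}.
Variable S : V -> V.
Hypothesis SD : forall x y, (S (x + y) = S x + S y)%R.
Hypothesis SZ : forall (a : R) x, (S (a *: x) = a *: S x)%R.

Definition avg (n : nat) (x : V) : V := (n%:R^-1 *: \sum_(i < n) iter i S x)%R.

Lemma iterSD i x y : (iter i S (x + y) = iter i S x + iter i S y)%R.
Proof. by elim: i => //= i ->. Qed.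

Lemma iterSZ i (a : R) x : (iter i S (a *: x) = a *: iter i S x)%R.
Proof. by elim: i => //= i ->. Qed.

Lemma iterSB i x y : (iter i S (x - y) = iter i S x - iter i S y)%R.
Proof. by rewrite -scaleN1r iterSD iterSZ scaleN1r. Qed.

Lemma avgD n x y : (avg n (x + y) = avg n x + avg n y)%R.
Proof.
by rewrite /avg -scalerDr -big_split /=; congr (_ *: _)%R; apply: eq_bigr => i _; rewrite iterSD.
Qed.

Lemma avgZ n (a : R) x : (avg n (a *: x) = a *: avg n x)%R.
Proof.
rewrite /avg scalerA mulrC -scalerA; congr (_ *: _)%R.
by rewrite scaler_sumr; apply: eq_bigr => i _; rewrite iterSZ.
Qed.

Lemma avgB n x y : (avg n (x - y) = avg n x - avg n y)%R.
Proof. by rewrite -scaleN1r avgD avgZ scaleN1r. Qed.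

Lemma avg_comm n x : (avg n (S x) = S (avg n x))%R.
Proof.
rewrite /avg SZ; congr (_ *: _)%R; elim: n => [|n IH].
  by rewrite !big_ord0 -[X in S X](scale0r 0%R) SZ scale0r.
by rewrite !big_ord_recr /= SD IH -iterSr.
Qed.

Lemma avg_telescope n x : (avg n x - avg n (S x) = n%:R^-1 *: (x - iter n S x))%R.
Proof.
rewrite /avg -scalerBr -sumrB; congr (_ *: _)%R; elim: n => [|n IH].
  by rewrite big_ord0 /= subrr.
by rewrite big_ord_recr /= IH -iterSr /= addrA subrK.
Qed.

(** The difference between an element and its Cesaro mean lies in the range of
    [id - S]; the witness is explicit. *)
Definition avg_primitive n (x : V) : V :=
  (n%:R^-1 *: \sum_(i < n) \sum_(j < i) iter j S x)%R.

Lemma avg_coboundary n x : (0 < n)%N ->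
  (x - avg n x = avg_primitive n x - S (avg_primitive n x))%R.
Proof.
move=> n0; have nn : (n%:R != 0 :> R)%R by rewrite pnatr_eq0 -lt0n.
have Ssum m : (S (\sum_(j < m) iter j S x) = \sum_(j < m) iter j.+1 S x)%R.
  elim: m => [|m IH]; first by rewrite !big_ord0 -[X in S X](scale0r 0%R) SZ scale0r.
  by rewrite !big_ord_recr /= SD IH.
have tel i : (\sum_(j < i) iter j S x - S (\sum_(j < i) iter j S x) = x - iter i S x)%R.
  rewrite Ssum -sumrB; elim: i => [|i IH]; first by rewrite big_ord0 /= subrr.
  by rewrite big_ord_recr /= IH /= addrA subrK.
have SS m : (S (\sum_(i < m) \sum_(j < i) iter j S x) =
    \sum_(i < m) S (\sum_(j < i) iter j S x))%R.
  elim: m => [|m IH]; first by rewrite !big_ord0 -[X in S X](scale0r 0%R) SZ scale0r.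
  by rewrite !big_ord_recr /= SD IH.
rewrite /avg_primitive SZ -scalerBr SS -sumrB.
under [in RHS]eq_bigr do rewrite tel.
by rewrite sumrB sumr_const card_ord scalerBr -(scaler_nat n x) scalerA mulVf// scale1r.
Qed.

Lemma avg_primitiveB n x :
  (avg_primitive n x - S (avg_primitive n x) = avg_primitive n (x - S x))%R.
Proof.
have S0 : (S 0 = 0)%R by rewrite -[X in S X](scale0r 0%R) SZ scale0r.
have Ssum m (f : nat -> V) : (S (\sum_(j < m) f j) = \sum_(j < m) S (f j))%R.
  elim: m => [|m IH]; first by rewrite !big_ord0.
  by rewrite !big_ord_recr /= SD IH.
rewrite /avg_primitive SZ -scalerBr; congr (_ *: _)%R.
rewrite (Ssum n (fun i => \sum_(j < i) iter j S x)%R) -sumrB; apply: eq_bigr => i _.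
rewrite (Ssum i (fun j => iter j S x)) -sumrB; apply: eq_bigr => j _.
by rewrite iterSB -iterSr.
Qed.

End CesaroMeans.

Section HilbertErgodic.
Context {R : realType} {V : lmodType R}.
Variables (S : V -> V) (L : V -> Prop) (q : V -> R) (A : R).
Hypothesis SD : forall x y, (S (x + y) = S x + S y)%R.
Hypothesis SZ : forall (a : R) x, (S (a *: x) = a *: S x)%R.
Hypothesis LS : forall x, L x -> L (S x).
Hypothesis LD : forall x y, L x -> L y -> L (x + y)%R.
Hypothesis LZ : forall (a : R) x, L x -> L (a *: x)%R.
Hypothesis q0 : forall x, L x -> (0 <= q x)%R.
Hypothesis qZ : forall (a : R) x, L x -> (q (a *: x) = a ^+ 2 * q x)%R.
Hypothesis qpar : forall x y, L x -> L y -> (q (x + y) + q (x - y) = 2 * q x + 2 * q y)%R.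
Hypothesis qS : forall i x, L x -> (q (iter i S x) <= A * q x)%R.
Hypothesis qsum : forall n (f : nat -> V), (forall i, L (f i)) ->
  (q (\sum_(i < n) f i) <= n%:R * \sum_(i < n) q (f i))%R.

Let LB x y : L x -> L y -> L (x - y)%R.
Proof. by move=> Lx Ly; rewrite -scaleN1r; apply: LD => //; exact: LZ. Qed.

Let L0 x : L x -> L 0%R.
Proof. by move=> Lx; rewrite -(scale0r x); exact: LZ. Qed.

Let Liter i x : L x -> L (iter i S x).
Proof. by move=> Lx; elim: i => //= i; exact: LS. Qed.

Let Lsum n (f : nat -> V) x : L x -> (forall i, L (f i)) -> L (\sum_(i < n) f i)%R.
Proof.
move=> Lx Lf; elim: n => [|n IH]; first by rewrite big_ord0; exact: L0 Lx.
by rewrite big_ord_recr /=; exact: LD.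
Qed.

Let Lavg n x : L x -> L (avg S n x).
Proof. by move=> Lx; apply: LZ; apply: (Lsum n Lx) => i; exact: Liter. Qed.

Let qN x : L x -> q (- x)%R = q x.
Proof. by move=> Lx; rewrite -scaleN1r qZ// sqrrN expr1n mul1r. Qed.

Let qD2 x y : L x -> L y -> (q (x + y) <= 2 * q x + 2 * q y)%R.
Proof. by move=> Lx Ly; rewrite -qpar// lerDl; apply: q0; exact: LB. Qed.

Let qB2 x y : L x -> L y -> (q (x - y) <= 2 * q x + 2 * q y)%R.
Proof. by move=> Lx Ly; rewrite -qpar// lerDr; apply: q0; exact: LD. Qed.

Hypothesis A0 : (0 <= A)%R.

Let q_avg n x : L x -> (q (avg S n x) <= A * q x)%R.
Proof.
move=> Lx; case: n => [|n].
  by rewrite /avg big_ord0 scaler0 -(scale0r x) qZ// expr0n mul0r mulr_ge0// q0.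
have nn : (0 < n.+1%:R :> R)%R by rewrite ltr0n.
rewrite /avg qZ; last by apply: (Lsum _ Lx) => i; exact: Liter.
apply: (@le_trans _ _ (n.+1%:R^-1 ^+ 2 * (n.+1%:R * \sum_(i < n.+1) (A * q x)))%R).
  apply: ler_wpM2l; first exact: sqr_ge0.
  apply: le_trans (qsum n.+1 (fun i => Liter i Lx)) _; apply: ler_wpM2l => //.
  by apply: ler_sum => i _; exact: qS.
rewrite sumr_const card_ord -(mulr_natl (A * q x)%R) le_eqVlt; apply/orP; left; apply/eqP.
by field; rewrite gt_eqF.
Qed.

Let q_coboundary n x : L x -> (0 < n)%N ->
  (q (avg S n (x - S x)) <= n%:R^-1 ^+ 2 * (2 * (1 + A) * q x))%R.
Proof.
move=> Lx n0; rewrite avgB// avg_telescope// qZ; last by apply: LB => //; exact: Liter.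
apply: ler_wpM2l; first exact: sqr_ge0.
apply: le_trans (qB2 Lx (Liter n Lx)) _.
by have := qS n Lx; lra.
Qed.

Let q_prim n x : L x -> (q (avg_primitive S n x) <= n%:R ^+ 2 * A * q x)%R.
Proof.
move=> Lx; case: n => [|n].
  by rewrite /avg_primitive big_ord0 scaler0 -(scale0r x) qZ// !expr0n /= !mul0r.
have nn : (0 < n.+1%:R :> R)%R by rewrite ltr0n.
have Ls i : L (\sum_(j < i) iter j S x)%R by apply: (Lsum _ Lx) => j; exact: Liter.
rewrite /avg_primitive qZ; last by apply: (@Lsum _ (fun i => \sum_(j < i) iter j S x)%R _ Lx).
have qi (i : nat) : (i <= n.+1)%N ->
    (q (\sum_(j < i) iter j S x)%R <= n.+1%:R * (n.+1%:R * (A * q x)))%R.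
  move=> il; apply: le_trans (qsum i (fun j => Liter j Lx)) _.
  have Aq : (0 <= A * q x)%R by rewrite mulr_ge0// q0.
  have ile : (i%:R <= n.+1%:R :> R)%R by rewrite ler_nat.
  apply: ler_pM => //; first by apply: sumr_ge0 => j _; apply: q0; exact: Liter.
  apply: (@le_trans _ _ (\sum_(j < i) (A * q x))%R); first by apply: ler_sum => j _; exact: qS.
  by rewrite sumr_const card_ord -(mulr_natl (A * q x)%R) ler_wpM2r.
apply: (@le_trans _ _ (n.+1%:R^-1 ^+ 2 * (n.+1%:R * \sum_(i < n.+1) (n.+1%:R * (n.+1%:R * (A * q x)))))%R).
  apply: ler_wpM2l; first exact: sqr_ge0.
  apply: le_trans (qsum n.+1 Ls) _; apply: ler_wpM2l => //.
  by apply: ler_sum => i _; apply: qi; rewrite ltnW.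
rewrite sumr_const card_ord -(mulr_natl (n.+1%:R * (n.+1%:R * (A * q x)))%R) le_eqVlt; apply/orP; left; apply/eqP.
by field; rewrite gt_eqF.
Qed.

Variable v : V.
Hypothesis Lv : L v.

(** Almost fixed elements, at precision [e], that differ from [v] by an element
    whose averages tend to zero. These convex sets replace the closed convex hulls of the
    tails of the sequence of averages. *)
Let C (e : R) : set V := [set y | [/\ L y, (q (y - S y) <= e)%R &
  forall t : R, (0 < t)%R -> exists n0, forall n, (n0 <= n)%N -> (q (avg S n (v - y)) <= t)%R]].

(** The averages of [v] are almost fixed, and they differ from [v] by an explicit coboundary. *)
Let C_avg (e : R) : (0 < e)%R -> exists2 y, C e y & (q y <= A * q v)%R.
Proof.
move=> e0; have B0 : (0 <= 2 * (1 + A) * q v)%R by rewrite !mulr_ge0// ?q0// addr_ge0.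
have inv_small (B : R) : (0 <= B)%R -> forall t : R, (0 < t)%R ->
    exists n0, forall n, (n0 <= n)%N -> (0 < n)%N /\ (n%:R^-1 ^+ 2 * B <= t)%R.
  move=> B1 t t0; exists (Num.bound (B / t)).+1 => n hn.
  have n0 : (0 < n)%N by apply: leq_trans hn.
  have nn : (0 < n%:R :> R)%R by rewrite ltr0n.
  split => //; have : (B / t < n%:R)%R.
    apply: lt_le_trans (archi_boundP _) _; first by rewrite divr_ge0// ltW.
    by rewrite ler_nat ltnW.
  rewrite ltr_pdivrMr// => Bn.
  rewrite exprVn mulrC ler_pdivrMr ?exprn_gt0//.
  have n1 : (1 <= n%:R :> R)%R by rewrite ler1n.
  by nra.
have [n1 hn1] := inv_small _ B0 e e0.
have [n10 hle] := hn1 n1 (leqnn _).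
exists (avg S n1 v); last exact: q_avg.
split; first exact: Lavg.
  rewrite -avg_comm// -avgB//; apply: le_trans hle.
  exact: q_coboundary.
move=> t t0; rewrite (avg_coboundary SD SZ _ n10).
have Lp : L (avg_primitive S n1 v).
  by apply: LZ; apply: (@Lsum _ (fun i => \sum_(j < i) iter j S v)%R _ Lv) => i;
      apply: (@Lsum _ (fun j => iter j S v) _ Lv) => j; exact: Liter.
have B1 : (0 <= 2 * (1 + A) * q (avg_primitive S n1 v))%R by rewrite !mulr_ge0// ?q0// addr_ge0.
have [n0 hn0] := inv_small _ B1 t t0.
exists n0 => n nn; have [n_gt0 h] := hn0 n nn.
by apply: le_trans h; exact: q_coboundary.
Qed.

Let C_mid (e : R) y z : C e y -> C e z -> C e (2^-1 *: (y + z))%R.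
Proof.
move=> [Ly y1 y2] [Lz z1 z2].
have half u w : L u -> L w -> (q (2^-1 *: (u + w)) <= 2^-1 * (q u + q w))%R.
  move=> Lu Lw; rewrite qZ; last exact: LD.
  have := qD2 Lu Lw; nra.
split; first by apply: LZ; exact: LD.
  have -> : (2^-1 *: (y + z) - S (2^-1 *: (y + z)) = 2^-1 *: ((y - S y) + (z - S z)))%R.
    by rewrite SZ SD -scalerBr opprD addrACA.
  apply: le_trans (half _ _ (LB Ly (LS Ly)) (LB Lz (LS Lz))) _; lra.
move=> t t0; have [n1 h1] := y2 t t0; have [n2 h2] := z2 t t0.
exists (n1 + n2)%N => n nn.
have -> : (v - 2^-1 *: (y + z) = 2^-1 *: ((v - y) + (v - z)))%R.
  rewrite addrACA -opprD scalerBr; congr (_ - _)%R.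
  by rewrite -mulr2n -(scaler_nat 2 v) scalerA mulVf ?scale1r// pnatr_eq0.
rewrite avgZ// avgD//; apply: le_trans (half _ _ _ _) _; try by apply: Lavg; exact: LB.
have := h1 n (leq_trans (leq_addr _ _) nn); have := h2 n (leq_trans (leq_addl _ _) nn).
lra.
Qed.

Let D e := inf [set q y | y in C e].

Let D_inf (e : R) : (0 < e)%R -> has_inf [set q y | y in C e].
Proof.
move=> e0; have [y Cy _] := C_avg e0.
by split; [exists (q y); exists y | exists 0%R => _ [z [Lz _ _] <-]; exact: q0].
Qed.

Let C_sub (e e' : R) : (e <= e')%R -> C e `<=` C e'.
Proof. by move=> ee' y [Ly y1 y2]; split => //; exact: le_trans ee'. Qed.

(** The infimum of [q] over the set [C e] increases as [e] decreases to zero, and stays bounded,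
    so that near-minimal elements of [C e] and of a smaller set [C e'] are close. An element of
    [C e'] with [e'] tiny compared to [n] is almost equal to its [n]-th average; hence all the
    averages of one near-minimal element [y] of [C e] are close to [y], and those of [v] are close
    to those of [y] eventually. *)
Theorem hilbert_ergodic (t : R) : (0 < t)%R -> exists n0, forall n m,
  (n0 <= n)%N -> (n0 <= m)%N -> (q (avg S n v - avg S m v) <= t)%R.
Proof.
move=> t0.
pose W := [set D e | e in [set e : R | (0 < e)%R]].
have W_sup : has_sup W.
  split; first by exists (D 1%R); exists 1%R => //=.
  exists (A * q v)%R => _ [e /= e0 <-]; have [y Cy qy] := C_avg e0.
  by apply: le_trans qy; apply: ge_inf; [exact: (D_inf e0).2 | exists y].
(* A generous constant for the repeated use of [q (x + y) <= 2 q x + 2 q y] below. *)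
pose K : R := (400 * (A + 1))%R.
have K0 : (0 < K)%R by apply: mulr_gt0; [rewrite ltr0n | apply: ltr_wpDl].
pose r : R := (t / K)%R.
have r0 : (0 < r)%R by rewrite divr_gt0.
have [_ [e e0 <-] hD] := sup_adherent r0 W_sup.
have near_min (e' : R) : (0 < e')%R -> exists2 y, C e' y & (q y <= D e' + r)%R.
  by move=> e'0; have [_ [y Cy <-] /ltW h] := inf_adherent r0 (D_inf e'0); exists y.
have [y Cy qy] := near_min e e0.
have [Ly _ y2] := Cy.
(* By the parallelogram identity, near-minimal elements of all smaller sets are close. *)
have close (e' : R) : (0 < e')%R -> (e' <= e)%R -> exists2 z, C e' z & (q (y - z) <= 6 * r)%R.
  move=> e'0 e'e; have [z Cz qz] := near_min e' e'0; exists z => //.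
  have Lz : L z by case: Cz.
  have m1 : (D e <= q (2^-1 *: (y + z)))%R.
    apply: ge_inf; first exact: (D_inf e0).2.
    by exists (2^-1 *: (y + z))%R => //; apply: C_mid => //; exact: C_sub e'e _ Cz.
  have m2 : (D e' <= sup W)%R by apply: sup_upper_bound => //; exists e'.
  move: m1; rewrite qZ; last exact: LD.
  have := qpar Ly Lz; move: hD qy qz m2; move: (sup W) => s; nra.
have fixed n : (0 < n)%N -> (q (avg S n y - y) <= (12 * A + 28) * r)%R.
  move=> n0; pose e' : R := (Num.min e (r / (n%:R ^+ 2 * A + 1)))%R.
  have d0 : (0 < n%:R ^+ 2 * A + 1)%R by rewrite ltr_wpDl// mulr_ge0// sqr_ge0.
  have e'0 : (0 < e')%R by rewrite lt_min e0 divr_gt0.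
  have e'e : (e' <= e)%R by rewrite ge_min lexx.
  have e'r : (n%:R ^+ 2 * A * e' <= r)%R.
    apply: (@le_trans _ _ ((n%:R ^+ 2 * A + 1) * e')%R).
      by apply: ler_wpM2r; [exact: ltW | rewrite lerDl].
    by rewrite mulrC -ler_pdivlMr// ge_min lexx orbT.
  have [z [Lz z1 _] yz] := close e' e'0 e'e.
  have -> : (avg S n y - y = avg S n (y - z) + ((avg S n z - z) + (z - y)))%R.
    by rewrite avgB// !subrKA.
  have Lyz : L (y - z)%R by exact: LB.
  have Lzy : L (z - y)%R by exact: LB.
  have Lzz : L (avg S n z - z)%R by apply: LB => //; exact: Lavg.
  have h1 := qD2 (Lavg n Lyz) (LD Lzz Lzy).
  have h2 := qD2 Lzz Lzy.
  have h3 := q_avg n Lyz.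
  have h4 : (q (z - y) = q (y - z))%R by rewrite -opprB qN.
  have h5 : (q (avg S n z - z) <= r)%R.
    rewrite -opprB qN; last by apply: LB => //; exact: Lavg.
    rewrite (avg_coboundary SD SZ _ n0) avg_primitiveB//.
    apply: le_trans (q_prim n (LB Lz (LS Lz))) _; apply: le_trans e'r.
    by apply: ler_wpM2l => //; rewrite mulr_ge0// sqr_ge0.
  have h6 : (A * q (y - z) <= A * (6 * r))%R by exact: ler_wpM2l.
  lra.
have [n0 hn0] := y2 r r0.
have Lvy : L (v - y)%R by exact: LB.
exists n0.+1 => n m nn mm.
have n_gt0 : (0 < n)%N by apply: leq_trans nn.
have m_gt0 : (0 < m)%N by apply: leq_trans mm.
have -> : (avg S n v - avg S m v = avg S n (v - y) + ((avg S n y - y) -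
    (avg S m (v - y) + (avg S m y - y))))%R.
  by rewrite !avgB// subrKA opprB !subrKA.
have Ln := Lavg n Lvy; have Lm := Lavg m Lvy.
have Lny : L (avg S n y - y)%R by apply: LB => //; exact: Lavg.
have Lmy : L (avg S m y - y)%R by apply: LB => //; exact: Lavg.
have h1 := qD2 Ln (LB Lny (LD Lm Lmy)).
have h2 := qB2 Lny (LD Lm Lmy).
have h3 := qD2 Lm Lmy.
have h4 := fixed n n_gt0; have h5 := fixed m m_gt0.
have h6 := hn0 n (ltnW nn); have h7 := hn0 m (ltnW mm).
have -> : t = (K * r)%R by rewrite /r mulrCA divff ?gt_eqF// mulr1.
have Ar : (0 <= A * r)%R by rewrite mulr_ge0// ltW.
rewrite /K; lra.
Qed.

End HilbertErgodic.

(** * Averages of real functions along the iterates of a map *)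

Section RealAverages.
Context {R : realType} {d : measure_display} {T : measurableType d}.
Variable mu : {measure set T -> \bar R}.
Variables (phi : T -> T) (A : R).
Hypothesis mphi : measurable_fun setT phi.
Hypothesis A1 : (1 <= A)%R.
Hypothesis phiA : forall n (E : set T), measurable E ->
  mu (iter n phi @^-1` E) <= A%:E * mu E.
Implicit Types (f g h : T -> R) (p : (T -> \bar R) -> \bar R).

Let A0 : (0 <= A)%R. Proof. exact: le_trans A1. Qed.

Definition avgR (n : nat) f : T -> R :=
  fun x => (n%:R^-1 * \sum_(i < n) f (iter i phi x))%R.

Definition absnorm p f : \bar R := p (fun x => `|f x|%:E).

Definition phi_bounded p : Prop := forall n u, nnmeas u ->
  p (u \o iter n phi) <= A%:E * p u.

Lemma measurable_iter n : measurable_fun setT (iter n phi).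
Proof.
elim: n => [|n IH]; first exact: measurable_id.
exact: (measurableT_comp mphi IH).
Qed.

Lemma measurable_avgR n f : measurable_fun setT f -> measurable_fun setT (avgR n f).
Proof.
move=> mf; apply: measurable_funM => //; apply: measurable_sum => i.
exact: measurableT_comp (measurable_iter i).
Qed.

Lemma dist_iter n u (s : R) : nnmeas u -> dist mu (u \o iter n phi) s <= A%:E * dist mu u s.
Proof. by move=> uP; apply: phiA; exact: measurable_gt. Qed.

Let S (f : T -> R^o) : T -> R^o := f \o phi.

Let iterSE n f : iter n S f = f \o iter n phi.
Proof. by elim: n => //= n ->; apply/funext => x; rewrite /S /= -iterSr. Qed.

Lemma avgRE n f : avg S n f = avgR n f.
Proof.
apply/funext => x; rewrite /avg /avgR.
transitivity (n%:R^-1 * (\sum_(i < n) iter i S f) x)%R; first by [].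
rewrite fct_sumE; congr (_ * _)%R; apply: eq_bigr => i _.
by rewrite iterSE.
Qed.

Section AbsoluteNorm.
Variable p : (T -> \bar R) -> \bar R.
Hypothesis pP : fatou_norm mu p.

Lemma absnorm_ge0 f : measurable_fun setT f -> 0 <= absnorm p f.
Proof. by move=> mf; apply: (fn_ge0 pP); exact: nnmeas_abs. Qed.

Lemma absnorm_le f g : measurable_fun setT f -> measurable_fun setT g ->
  (forall x, `|f x| <= `|g x|)%R -> absnorm p f <= absnorm p g.
Proof.
by move=> mf mg fg; apply: (fn_leT pP) => [||x]; rewrite ?lee_fin//; exact: nnmeas_abs.
Qed.

Lemma absnormD f g : measurable_fun setT f -> measurable_fun setT g ->
  absnorm p (fun x => f x + g x)%R <= absnorm p f + absnorm p g.
Proof.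
move=> mf mg; apply: le_trans (fn_D pP (nnmeas_abs mf) (nnmeas_abs mg)).
apply: (fn_leT pP); first by apply: nnmeas_abs; exact: measurable_funD.
  by apply: nnmeasD; exact: nnmeas_abs.
by move=> x; rewrite -EFinD lee_fin ler_normD.
Qed.

Lemma absnormZ (a : R) f : measurable_fun setT f ->
  absnorm p (fun x => a * f x)%R = `|a|%:E * absnorm p f.
Proof.
move=> mf; rewrite /absnorm -(fn_Z pP (normr_ge0 a) (nnmeas_abs mf)).
by congr p; apply/funext => x; rewrite normrM EFinM.
Qed.

Lemma absnormB f g : measurable_fun setT f -> measurable_fun setT g ->
  absnorm p (fun x => f x - g x)%R <= absnorm p f + absnorm p g.
Proof.
move=> mf mg; have mg' : measurable_fun setT (fun x => - 1 * g x)%R by exact: measurable_funM.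
have := absnormD mf mg'; rewrite absnormZ// normrN1 mul1e.
by rewrite (_ : (fun x => _) = (fun x => f x - g x)%R)//; apply/funext => x; rewrite mulN1r.
Qed.

Lemma absnormC f g : absnorm p (fun x => f x - g x)%R = absnorm p (fun x => g x - f x)%R.
Proof. by congr p; apply/funext => x; rewrite distrC. Qed.

Lemma absnorm_tri f g h : measurable_fun setT f -> measurable_fun setT g ->
  measurable_fun setT h -> absnorm p (fun x => f x - h x)%R <=
  absnorm p (fun x => f x - g x)%R + absnorm p (fun x => g x - h x)%R.
Proof.
move=> mf mg mh; have := absnormD (measurable_funB mf mg) (measurable_funB mg mh).
by rewrite (_ : (fun x => _) = (fun x => f x - h x)%R)//; apply/funext => x /=; rewrite addrA subrK.
Qed.

Lemma absnorm_ae0 f : measurable_fun setT f -> {ae mu, forall x, f x = 0%R} ->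
  absnorm p f = 0.
Proof.
move=> mf f0; apply/eqP; rewrite eq_le absnorm_ge0// andbT.
rewrite -(fn0 pP); apply: (fn_le pP); [exact: nnmeas_abs|exact: nnmeas_cst|].
by apply: filterS f0 => x ->; rewrite normr0.
Qed.

Lemma absnorm_sum n (f : nat -> T -> R) : (forall i, measurable_fun setT (f i)) ->
  absnorm p (fun x => \sum_(i < n) f i x)%R <= \sum_(i < n) absnorm p (f i).
Proof.
move=> mf; have [nn le] := fn_sum n pP (fun i => nnmeas_abs (mf i)).
apply: le_trans le; apply: (fn_leT pP) => //; first by apply: nnmeas_abs; exact: measurable_sum.
by move=> x; rewrite sumEFin lee_fin ler_norm_sum.
Qed.

Lemma absnorm_fatou (f : nat -> T -> R) g c : (forall n, measurable_fun setT (f n)) ->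
  measurable_fun setT g -> {ae mu, forall x, f n x @[n --> \oo] --> g x} ->
  (forall n, absnorm p (f n) <= c) -> absnorm p g <= c.
Proof.
move=> mf mg fg fc; apply: (fn_fatou pP (f := fun n x => `|f n x|%:E)) => //.
- by move=> n; exact: nnmeas_abs.
- exact: nnmeas_abs.
apply: filterS fg => x fx; apply: cvg_EFin; first exact: nearW.
exact: cvg_norm.
Qed.

Hypothesis pA : phi_bounded p.

Lemma absnorm_iter n f : measurable_fun setT f ->
  absnorm p (f \o iter n phi) <= A%:E * absnorm p f.
Proof. by move=> mf; exact: (pA n (nnmeas_abs mf)). Qed.

Lemma absnorm_mean n (f : nat -> T -> R) c : (forall i, measurable_fun setT (f i)) ->
  0 <= c -> (forall i, absnorm p (f i) <= c) ->
  absnorm p (fun x => n%:R^-1 * \sum_(i < n) f i x)%R <= c.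
Proof.
move=> mf c0 fc; rewrite absnormZ; last exact: measurable_sum.
case: n => [|n].
  by rewrite invr0 normr0 mul0e.
have nn : (0 < n.+1%:R :> R)%R by rewrite ltr0n.
rewrite ger0_norm ?invr_ge0// lee_pdivrMl//.
apply: le_trans (absnorm_sum n.+1 mf) _.
apply: (@le_trans _ _ (\sum_(i < n.+1) c)); first by apply: lee_sum => i _.
by rewrite sumr_const card_ord mule_natl.
Qed.

Lemma absnorm_avg n f : measurable_fun setT f -> absnorm p (avgR n f) <= A%:E * absnorm p f.
Proof.
move=> mf; apply: (@absnorm_mean n (fun i => f \o iter i phi)).
- by move=> i; exact: measurableT_comp (measurable_iter i).
- by rewrite mule_ge0// ?absnorm_ge0// lee_fin.
- by move=> i; exact: absnorm_iter.
Qed.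

Lemma avgRB n f g : avgR n (fun x => f x - g x)%R = (fun x => avgR n f x - avgR n g x)%R.
Proof. by apply/funext => x; rewrite /avgR sumrB mulrBr. Qed.

Lemma avgR_lin n (a : R) f g :
  avgR n (fun x => a * f x + g x)%R = (fun x => a * avgR n f x + avgR n g x)%R.
Proof.
by apply/funext => x; rewrite /avgR big_split /= mulrDr -mulr_sumr mulrCA.
Qed.

Lemma avgR_phi n f x : (avgR n f (phi x) - avgR n f x = n%:R^-1 * (f (iter n phi x) - f x))%R.
Proof.
rewrite /avgR -mulrBr -sumrB; congr (_ * _)%R; elim: n => [|n IH]; first by rewrite big_ord0 /= subrr.
by rewrite big_ord_recr /= IH -iterSr /= addrC subrKA.
Qed.

Definition cauchy_avg f : Prop := forall e : R, (0 < e)%R -> exists n0, forall n m,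
  (n0 <= n)%N -> (n0 <= m)%N -> absnorm p (fun x => avgR n f x - avgR m f x)%R <= e%:E.

(** The averaging operators are uniformly bounded for [p]. *)
Lemma cauchy_approx f (g : nat -> T -> R) : measurable_fun setT f ->
  (forall k, measurable_fun setT (g k)) -> (forall k, cauchy_avg (g k)) ->
  absnorm p (fun x => f x - g k x)%R @[k --> \oo] --> 0 -> cauchy_avg f.
Proof.
move=> mf mg gC fg e e0.
have e4 : (0 < e / (4 * A))%R by rewrite divr_gt0// mulr_gt0// (lt_le_trans ltr01).
have [k _ hk] := cvge_near_lt fg (e4 : 0 < (e / (4 * A))%:E).
have {}hk := ltW (hk k (leqnn k)).
have e2 : (0 < e / 2)%R by rewrite divr_gt0.
have [n0 hn0] := gC k _ e2; exists n0 => n m nn mm.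
have mfg : measurable_fun setT (fun x => f x - g k x)%R by exact: measurable_funB.
have q n' : absnorm p (fun x => avgR n' f x - avgR n' (g k) x)%R <= (e / 4)%:E.
  rewrite -avgRB; apply: le_trans (absnorm_avg n' mfg) _.
  apply: (@le_trans _ _ (A%:E * (e / (4 * A))%:E)); first by apply: lee_wpmul2l => //; rewrite lee_fin.
  rewrite -EFinM lee_fin le_eqVlt; apply/orP; left; apply/eqP; field.
  by rewrite gt_eqF// (lt_le_trans ltr01).
have m1 := measurable_avgR n mf; have m2 := measurable_avgR m mf.
have m3 := measurable_avgR n (mg k); have m4 := measurable_avgR m (mg k).
apply: le_trans (absnorm_tri m1 m3 m2) _.
have -> : e%:E = (e / 4)%:E + ((e / 2)%:E + (e / 4)%:E) by rewrite -!EFinD; congr (_%:E); field.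
apply: leeD; first exact: q.
apply: le_trans (absnorm_tri m3 m4 m2) _; apply: leeD; first exact: hn0.
by rewrite absnormC.
Qed.

Definition cvg_avg f g : Prop := forall e : R, (0 < e)%R -> exists n0, forall n,
  (n0 <= n)%N -> absnorm p (fun x => avgR n f x - g x)%R <= e%:E.

(** Fatou's lemma along the subsequence turns the Cauchy property into convergence. *)
Lemma cauchy_avg_cvg f g (k : nat -> nat) : measurable_fun setT f -> measurable_fun setT g ->
  (forall j, (j <= k j)%N) -> {ae mu, forall x, avgR (k j) f x @[j --> \oo] --> g x} ->
  cauchy_avg f -> cvg_avg f g.
Proof.
move=> mf mg kj fg fC e e0; have [n0 hn0] := fC e e0; exists n0 => n nn.
apply: (@absnorm_fatou (fun j x => avgR n f x - avgR (k (j + n0)%N) f x)%R).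
- by move=> j; apply: measurable_funB; exact: measurable_avgR.
- by apply: measurable_funB => //; exact: measurable_avgR.
- apply: filterS fg => x fx; apply: cvgB; first exact: cvg_cst.
  by have := fx; rewrite -(cvg_shiftn n0).
- by move=> j; apply: hn0 => //; apply: leq_trans (kj _); exact: leq_addl.
Qed.

(** Seminorms that are controlled by the mean square on functions which are bounded and have
    bounded integral. This is what transfers mean-square convergence of averages to [p]. *)
Definition small_fun : Prop := forall c c' e : R, (0 < c)%R -> (0 < c')%R -> (0 < e)%R ->
  exists2 del : R, (0 < del)%R &
  forall u, nnmeas u -> (forall x, u x <= c%:E) -> \int[mu]_x u x <= c'%:E ->
    \int[mu]_x (u x * u x) <= del%:E -> p u <= e%:E.

End AbsoluteNorm.

Hypothesis sf : sigma_finite setT mu.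

Lemma phi_bounded_int : phi_bounded (fun u => \int[mu]_x u x).
Proof.
move=> n u uP; apply: (integral_dilate sf) => //; last by move=> s s0; exact: dist_iter.
exact: (nnmeas_comp (measurable_iter n) uP).
Qed.

Let sqint_iter n f : sqint mu f -> sqint mu (f \o iter n phi) /\
  (ip mu (f \o iter n phi) (f \o iter n phi) <= A * ip mu f f)%R.
Proof.
move=> fP; have mfn : measurable_fun setT (f \o iter n phi).
  exact: measurableT_comp fP.1 (measurable_iter n).
have le := phi_bounded_int n (nnmeas_sqr fP.1).
have fn : sqint mu (f \o iter n phi).
  split => //; apply: le_lt_trans le _.
  by rewrite lte_mul_pinfty ?lee_fin//; exact: fP.2.
by split => //; rewrite -lee_fin EFinM !EFin_ipff.
Qed.

Let sqint_avg n f : sqint mu f -> sqint mu (avgR n f).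
Proof.
move=> fP; apply: sqintZ; elim: n => [|n IH].
  rewrite (_ : (fun x => _) = cst 0%R); last by apply/funext => x; rewrite big_ord0.
  by split => //; under eq_integral do rewrite expr0n /=; rewrite integral0.
rewrite (_ : (fun x => _) = (fun x => \sum_(i < n) f (iter i phi x) + f (iter n phi x))%R).
  by apply: sqintD => //; exact: (sqint_iter n fP).1.
by apply/funext => x; rewrite big_ord_recr.
Qed.

Lemma sqr_sum_le n (a : nat -> R) :
  ((\sum_(i < n) a i) ^+ 2 <= n%:R * \sum_(i < n) a i ^+ 2)%R.
Proof.
elim: n => [|n IH]; first by rewrite !big_ord0 expr0n mulr0.
rewrite !big_ord_recr /=.
have q0 : (0 <= \sum_(i < n) a i ^+ 2)%R by apply: sumr_ge0 => i _; exact: sqr_ge0.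
move: (\sum_(i < n) a i)%R (\sum_(i < n) a i ^+ 2)%R q0 IH => s q q0 IH.
have main : (2 * s * a n <= q + n%:R * a n ^+ 2)%R.
  case: n IH => [|n] IH.
    have -> : s = 0%R by apply/eqP; rewrite -sqrf_eq0 eq_le sqr_ge0 andbT; move: IH; rewrite mul0r.
    by rewrite mulr0 !mul0r addr0.
  have nn : (0 < n.+1%:R :> R)%R by rewrite ltr0n.
  rewrite -(ler_pM2l nn).
  have := sqr_ge0 (s - n.+1%:R * a n.+1)%R; move: (n.+1%:R : R) (a n.+1) IH => c b IH; nra.
rewrite -natr1; move: (n%:R : R) (a n) main IH => c b main IH; nra.
Qed.

(** Composition with the iterates of [phi] is bounded in mean square, since the level sets of
    [(f o phi^n)^2] are at most [A] times as large as those of [f^2]; thus [hilbert_ergodic]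
    applies. *)
Lemma cauchy_avg_sqint f (t : R) : sqint mu f -> (0 < t)%R -> exists n0, forall n m,
  (n0 <= n)%N -> (n0 <= m)%N ->
  (ip mu (fun x => avgR n f x - avgR m f x) (fun x => avgR n f x - avgR m f x) <= t)%R.
Proof.
move=> fP t0.
have [n0 hn0] : exists n0 : nat, forall n m : nat, (n0 <= n)%N -> (n0 <= m)%N ->
    (ip mu (avg S n f - avg S m f)%R (avg S n f - avg S m f)%R <= t)%R.
  apply: (@hilbert_ergodic R (T -> R^o) S (fun f => sqint mu f) (fun f => ip mu f f) A) => //.
  - by move=> g gP; exact: (sqint_iter 1 gP).1.
  - by move=> g g' gP gP'; exact: sqintD.
  - by move=> a g gP; exact: sqintZ.
  - by move=> g gP; exact: ip_ge0.
  - move=> a g gP; change (ip mu (fun x => a * g x)%R (fun x => a * g x)%R = a ^+ 2 * ip mu g g)%R.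
    rewrite (ipZr a (sqintZ a gP) gP) (ipC mu (fun x => a * g x)%R g) (ipZr a gP gP).
    by rewrite mulrA -expr2.
  - move=> g h gP hP.
    have -> : (g + h = (fun x => 1 * g x + 1 * h x))%R by apply/funext => x; rewrite !mul1r.
    have -> : (g - h = (fun x => 1 * g x + (-1) * h x))%R.
      by apply/funext => x; rewrite mul1r mulN1r.
    by rewrite !ip_lin//; ring.
  - by move=> i g gP; rewrite iterSE; exact: (sqint_iter i gP).2.
  move=> n F FP.
  have sE : (\sum_(i < n) F i)%R = (fun x => \sum_(i < n) F i x)%R.
    by apply/funext => x; rewrite fct_sumE.
  have sP : sqint mu (fun x => \sum_(i < n) F i x)%R.
    elim: n {sE} => [|n IH].
      rewrite (_ : (fun x => _) = cst 0%R); last by apply/funext => x; rewrite big_ord0.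
      by split => //; under eq_integral do rewrite expr0n /=; rewrite integral0.
    rewrite (_ : (fun x => _) = (fun x => \sum_(i < n) F i x + F n x)%R).
      exact: sqintD.
    by apply/funext => x; rewrite big_ord_recr.
  rewrite sE -lee_fin EFin_ipff// EFinM -sumEFin.
  have I := fatou_norm_int mu.
  have [nn le] := fn_sum n I (fun i => nnmeas_sqr (FP i).1).
  apply: (@le_trans _ _ (n%:R%:E * \int[mu]_x (\sum_(k < n) (F k x ^+ 2)%:E))).
    rewrite -(fn_Z I (ler0n R n) nn); apply: (fn_leT I); first exact: nnmeas_sqr sP.1.
      by apply: nnmeasZ => //; rewrite lee_fin.
    by move=> x; rewrite sumEFin -EFinM lee_fin; exact: (sqr_sum_le n (fun i => F i x)).
  apply: lee_wpmul2l; first by rewrite lee_fin.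
  by apply: le_trans le _; apply: lee_sum => i _; rewrite EFin_ipff.
by exists n0 => n m nn mm; have := hn0 n m nn mm; rewrite !avgRE.
Qed.

(** Averages of functions dominated by an integrable weight are uniformly bounded, bounded in
    the mean, and Cauchy in the mean square. *)
Lemma cauchy_avg_dominated p (w : T -> R) (k : R) f : fatou_norm mu p -> small_fun p ->
  measurable_fun setT w -> (forall x, 0 < w x <= 1)%R -> \int[mu]_x (w x)%:E < +oo ->
  measurable_fun setT f -> (0 < k)%R -> (forall x, `|f x| <= k * w x)%R -> cauchy_avg p f.
Proof.
move=> pP ps mw wb wi mf k0 fk e e0.
have w0 x : (0 < w x)%R by have /andP[] := wb x.
have wP : nnmeas (fun x => (w x)%:E) by apply: nnmeas_EFin => // x; exact: ltW.
have I := fatou_norm_int mu.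
have fk1 x : (`|f x| <= k)%R.
  by apply: le_trans (fk x) _; rewrite ler_piMr ?(ltW k0)//; have /andP[] := wb x.
have wi0 := fn_ge0 I wP.
have wif : \int[mu]_x (w x)%:E \is a fin_num by rewrite ge0_fin_numE.
pose c' : R := (2 * A * (k * fine (\int[mu]_x (w x)%:E)) + 1)%R.
have c'0 : (0 < c')%R.
  by rewrite ltr_wpDl// !mulr_ge0// ?fine_ge0// ltW.
have k20 : (0 < 2 * k)%R by rewrite mulr_gt0.
have [del del0 hdel] := ps _ _ _ k20 c'0 e0.
have fP : sqint mu f.
  have wsq : sqint mu w.
    split => //; apply: le_lt_trans wi; apply: (fn_leT I) => //; first exact: nnmeas_sqr.
    by move=> x; rewrite lee_fin; have /andP[h0 h1] := wb x; nra.
  apply: (le_sqint mf (sqintZ k wsq)) => x.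
  by rewrite [X in (_ <= X)%R]ger0_norm// mulr_ge0// ltW.
have [n0 hn0] := cauchy_avg_sqint fP del0; exists n0 => n m nn mm.
have mn := measurable_avgR n mf; have mm' := measurable_avgR m mf.
have mB : measurable_fun setT (fun x => avgR n f x - avgR m f x)%R by exact: measurable_funB.
have bn n' x : (`|avgR n' f x| <= k)%R.
  case: n' => [|n']; first by rewrite /avgR invr0 mul0r normr0 ltW.
  have nz : (0 < n'.+1%:R :> R)%R by rewrite ltr0n.
  rewrite /avgR normrM ger0_norm ?invr_ge0// ler_pdivrMl//.
  apply: le_trans (ler_norm_sum _ _ _) _.
  apply: (@le_trans _ _ (\sum_(i < n'.+1) k)%R); first by apply: ler_sum => i _.
  by rewrite sumr_const card_ord mulr_natl.
have If : absnorm (fun u => \int[mu]_x u x) f <= (k * fine (\int[mu]_x (w x)%:E))%:E.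
  rewrite EFinM fineK// -(fn_Z I (ltW k0) wP); apply: (fn_leT I) => [||x].
  - exact: nnmeas_abs.
  - by apply: nnmeasZ => //; rewrite lee_fin ltW.
  - by rewrite -EFinM lee_fin.
apply: hdel.
- exact: nnmeas_abs.
- move=> x; rewrite lee_fin; apply: le_trans (ler_normB _ _) _.
  by have := bn n x; have := bn m x; lra.
- apply: le_trans (absnormB I mn mm') _.
  have avI n' : absnorm (fun u => \int[mu]_x u x) (avgR n' f) <= (A * (k * fine (\int[mu]_x (w x)%:E)))%:E.
    apply: le_trans (absnorm_avg I phi_bounded_int n' mf) _.
    by rewrite EFinM; apply: lee_wpmul2l.
  apply: le_trans (leeD (avI n) (avI m)) _; rewrite -EFinD lee_fin /c'; lra.
have -> : \int[mu]_x (`|avgR n f x - avgR m f x|%:E * `|avgR n f x - avgR m f x|%:E) =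
    (ip mu (fun x => avgR n f x - avgR m f x) (fun x => avgR n f x - avgR m f x))%:E.
  rewrite EFin_ipff; last by apply: sqintB; exact: sqint_avg.
  by apply: eq_integral => x _; rewrite -EFinM -expr2 real_normK// num_real.
by rewrite lee_fin; exact: hn0.
Qed.

End RealAverages.

(** * The limit operator on real functions *)

Section LimitOperator.
Context {R : realType} {d : measure_display} {T : measurableType d}.
Variable mu : {measure set T -> \bar R}.
Variables (phi : T -> T) (A : R) (N : (T -> \bar R) -> \bar R).
Hypothesis mphi : measurable_fun setT phi.
Hypothesis A1 : (1 <= A)%R.
Hypothesis phiA : forall n (E : set T), measurable E ->
  mu (iter n phi @^-1` E) <= A%:E * mu E.
Hypothesis sf : sigma_finite setT mu.
Hypothesis res : resonant_nn mu.
Hypothesis BN : banach_norm mu N.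
Hypothesis inv : dist_invariant mu N.
Hypothesis ACR : forall u, nnmeas u -> N u < +oo -> vanishing mu u.
Hypothesis ACR' : forall v, nnmeas v -> assoc mu N v < +oo -> vanishing mu v.
Implicit Types (f g h : T -> R) (u v : T -> \bar R).

Let NP := bn_fatou BN.
Let N' := assoc mu N.
Let BN' : banach_norm mu N' := banach_norm_assoc BN.
Let A0 : (0 <= A)%R. Proof. exact: le_trans A1. Qed.

Definition rspace f : Prop := measurable_fun setT f /\ absnorm N f < +oo.

Let rp v := fun u => rdot mu u v.

Let rpP v : nnmeas v -> fatou_norm mu (rp v).
Proof. exact: fatou_norm_rdot. Qed.

Let iterP n u : nnmeas u -> nnmeas (u \o iter n phi).
Proof. by move=> uP; exact: (nnmeas_comp (measurable_iter mphi n) uP). Qed.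

Let rpA v : nnmeas v -> phi_bounded phi A (rp v).
Proof.
move=> vP n u uP; apply: rdot_dilate => //; first exact: iterP.
by move=> s _; exact: (dist_iter phiA).
Qed.

Let NA : phi_bounded phi A N.
Proof.
move=> n u uP; apply: (norm_dilate sf res BN inv) => //; first exact: iterP.
by move=> s _; exact: (dist_iter phiA).
Qed.

Let rp_small v : nnmeas v -> N' v < +oo -> small_fun mu (rp v).
Proof. by move=> vP Nv c c' e; apply: (small_rdot sf res BN inv vP Nv); exact: ACR'. Qed.

Let rp_lty f v : rspace f -> nnmeas v -> N' v < +oo -> absnorm (rp v) f < +oo.
Proof.
by move=> [mf Nf] vP Nv; apply: (rdot_lty res BN inv) => //; exact: nnmeas_abs.
Qed.

(** Unlike a truncation of the range alone, this cuts [f] down to a multiple of an integrable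
    weight, whose averages are under control. *)
Definition clip (w : T -> R) (k : nat) f : T -> R :=
  fun x => (f x * \1_[set y | (`|f y| <= k%:R * w y)%R] x)%R.

Lemma measurable_clip_set (w : T -> R) k f : measurable_fun setT w -> measurable_fun setT f ->
  measurable [set y | (`|f y| <= k%:R * w y)%R].
Proof.
move=> mw mf; rewrite -[X in measurable X]setTI.
apply: (measurable_lee measurableT (f := fun y => `|f y|%:E) (g := fun y => (k%:R * w y)%:E)).
  by apply/measurable_EFinP; exact: measurableT_comp.
by apply/measurable_EFinP; exact: measurable_funM.
Qed.

Lemma measurable_clip (w : T -> R) k f : measurable_fun setT w -> measurable_fun setT f ->
  measurable_fun setT (clip w k f).
Proof.
by move=> mw mf; apply: measurable_funM => //; exact/measurable_indic/measurable_clip_set.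
Qed.

Lemma clip_le (w : T -> R) k f x : (forall x, 0 < w x)%R -> (`|clip w k f x| <= k%:R * w x)%R.
Proof.
move=> w0; rewrite /clip indicE; case: (boolP (x \in _)) => [/set_mem /=|_].
  by rewrite mulr1.
by rewrite mulr0 normr0 mulr_ge0// ltW.
Qed.

Lemma sub_clip (w : T -> R) k f x :
  (f x - clip w k f x = f x * \1_(~` [set y | (`|f y| <= k%:R * w y)%R]) x)%R.
Proof.
rewrite /clip !indicE in_setC; case: (x \in _) => /=; first by rewrite mulr1 mulr0 subrr.
by rewrite mulr0 mulr1 subr0.
Qed.

Lemma cvg_clip_set (w : T -> R) f x : (forall x, 0 < w x)%R ->
  (\1_(~` [set y | (`|f y| <= k%:R * w y)%R]) x : R) @[k --> \oo] --> (0 : R)%R.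
Proof.
move=> w0; apply: (@cvg_trans _ ((fun=> 0%R : R) @ \oo)); last exact: cvg_cst.
apply: near_eq_cvg; have := nbhs_infty_ger (`|f x| / w x)%R.
apply: filterS => k /= h; rewrite indicE memNset//= => nf; apply: nf.
by rewrite -ler_pdivrMr.
Qed.

Let rp_clip (w : T -> R) f v : measurable_fun setT w -> (forall x, 0 < w x)%R ->
  rspace f -> nnmeas v -> N' v < +oo ->
  absnorm (rp v) (fun x => f x - clip w k f x)%R @[k --> \oo] --> 0.
Proof.
move=> mw w0 fX vP Nv; have [mf Nf] := fX.
have mB k : measurable_fun setT (fun x => f x - clip w k f x)%R.
  by apply: measurable_funB => //; exact: measurable_clip.
apply: (dominated_rdot (u := fun x => `|f x|%:E)) => //.
- by move=> k; exact: nnmeas_abs.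
- exact: nnmeas_abs.
- move=> k x; rewrite lee_fin sub_clip normrM ler_piMr//.
  by rewrite indicE; case: (_ \in _); rewrite ?normr1 ?normr0.
- apply: aeT => x; apply: cvg_EFin; first exact: nearW.
  have h : (f x * \1_(~` [set y | (`|f y| <= k%:R * w y)%R]) x : R)%R @[k --> \oo] --> (0 : R)%R.
    rewrite -(mulr0 (f x)); apply: cvgM; first exact: cvg_cst.
    exact: cvg_clip_set.
  rewrite -(@normr0 _ R); apply: cvg_trans (cvg_norm h); apply: near_eq_cvg; apply: nearW => k /=.
  by rewrite sub_clip.
- by apply: ACR => //; exact: nnmeas_abs.
- exact: rp_lty.
Qed.

Let good p (w : T -> R) k f : fatou_norm mu p -> small_fun mu p -> measurable_fun setT f ->
  measurable_fun setT w -> (forall x, 0 < w x <= 1)%R -> \int[mu]_x (w x)%:E < +oo ->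
  cauchy_avg phi p (clip w k f).
Proof.
move=> pP ps mf mw wb wi.
have w0 x : (0 < w x)%R by have /andP[] := wb x.
apply: (cauchy_avg_dominated mphi A1 phiA sf pP ps mw wb wi (measurable_clip k mw mf) (k := k.+1%:R)).
  by rewrite ltr0n.
by move=> x; apply: le_trans (clip_le _ _ _ w0) _; rewrite ler_wpM2r ?ler_nat// ltW.
Qed.

Let cauchy_rdot f v : rspace f -> nnmeas v -> N' v < +oo -> cauchy_avg phi (rp v) f.
Proof.
move=> fX vP Nv; have [w [mw wb _ _ wi]] := common_weight sf BN.
have w0 x : (0 < w x)%R by have /andP[] := wb x.
apply: (cauchy_approx mphi A1 (rpP vP) (rpA vP) fX.1 (fun k => measurable_clip k mw fX.1)).
  by move=> k; apply: (good k (rpP vP) _ fX.1 mw wb wi); exact: rp_small.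
exact: rp_clip.
Qed.

Let cauchy_norm f : rspace f -> acn_nn mu N (fun x => `|f x|%:E) -> cauchy_avg phi N f.
Proof.
move=> fX fa; have [mf Nf] := fX.
have [w [mw wb _ _ wi]] := common_weight sf BN.
have w0 x : (0 < w x)%R by have /andP[] := wb x.
have faP : nnmeas (fun x => `|f x|%:E) by exact: nnmeas_abs.
have [f0|f0] := pselect {ae mu, forall x, `|f x|%:E = 0}.
  have Nf0 : absnorm N f = 0.
    by apply: (absnorm_ae0 NP mf); apply: filterS f0 => x [] /eqP; rewrite normr_eq0 => /eqP.
  move=> e e0; exists 0%N => n m _ _.
  apply: le_trans (absnormB NP (measurable_avgR mphi n mf) (measurable_avgR mphi m mf)) _.
  apply: le_trans (leeD (absnorm_avg mphi A1 NP NA n mf) (absnorm_avg mphi A1 NP NA m mf)) _.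
  by rewrite Nf0 mule0 adde0 lee_fin ltW.
have sm : small_fun mu N.
  by move=> c c' e; apply: (small_norm sf res BN inv ACR' faP fa f0).
apply: (cauchy_approx mphi A1 NP NA mf (fun k => measurable_clip k mw mf)).
  by move=> k; exact: (good k NP sm mf mw wb wi).
have := fa (fun k => ~` [set y | (`|f y| <= k%:R * w y)%R]).
move=> /(_ _ _); have h : forall k, measurable (~` [set y | (`|f y| <= k%:R * w y)%R]).
  by move=> k; apply: measurableC; exact: measurable_clip_set.
move=> /(_ h (aeT _ (fun x => cvg_clip_set f x w0))).
apply: cvg_trans; apply: near_eq_cvg; apply: nearW => k /=.
congr N; apply/funext => x; rewrite sub_clip normrM EFinM /indic_fun.
by congr (_ * _%:E); rewrite indicE; case: (_ \in _); rewrite ?normr1 ?normr0.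
Qed.

Let weak_weight : exists w : T -> R, [/\ measurable_fun setT w, (forall x, 0 < w x)%R,
  nnmeas (fun x => (w x)%:E) & N' (fun x => (w x)%:E) < +oo].
Proof.
have [w [mw wb _ Nw _]] := common_weight sf BN.
have w0 x : (0 < w x)%R by have /andP[] := wb x.
by exists w; split => //; apply: nnmeas_EFin => // x; exact: ltW.
Qed.

(** Convergence of the averages of [f] to [g] for all the pairings, that is, for the real
    counterpart of the topology [xi]. *)
Definition limit_avg f g : Prop := rspace g /\
  forall v, nnmeas v -> N' v < +oo -> cvg_avg phi (fun u => rdot mu u v) f g.

(** Averages of clipped functions are Cauchy for every seminorm that satisfies [small_fun], and
    [f] is approximated by its clippings: by dominated convergence for the pairings, and by
    absolute continuity for the norm. The almost everywhere limit of a subsequence is a common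
    limit for all these seminorms, and has finite norm by Fatou's lemma. *)
Lemma limit_avg_exists f : rspace f -> exists g, [/\ limit_avg f g,
  absnorm N g <= A%:E * absnorm N f &
  acn_nn mu N (fun x => `|f x|%:E) -> cvg_avg phi N f g].
Proof.
move=> fX; have [mf Nf] := fX.
have [w [mw w0 wP Nw]] := weak_weight.
have mav n : measurable_fun setT (avgR phi n f) by exact: measurable_avgR.
have [k [g [mg kj kg]]] : exists (k : nat -> nat) (g : T -> R), [/\ measurable_fun setT g,
    forall j, (j <= k j)%N & {ae mu, forall x, avgR phi (k j) f x @[j --> \oo] --> g x}].
  apply: (cauchy_mean_subseq mw w0 mav) => e e0.
  have [n0 hn0] := cauchy_rdot fX wP Nw e0; exists n0 => n m nn mm.
  apply: le_trans (hn0 n m nn mm); apply: (integral_le_rdot res) => //.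
  by apply: nnmeas_abs; exact: measurable_funB.
have Ng : absnorm N g <= A%:E * absnorm N f.
  apply: (absnorm_fatou NP (f := fun j => avgR phi (k j) f)) => // j.
  exact: (absnorm_avg mphi A1 NP NA).
exists g; split => //.
  split; first by split => //; apply: le_lt_trans Ng _; rewrite lte_mul_pinfty ?lee_fin.
  move=> v vP Nv; apply: (cauchy_avg_cvg mphi (rpP vP) mf mg kj kg).
  exact: cauchy_rdot.
by move=> fa; apply: (cauchy_avg_cvg mphi NP mf mg kj kg); exact: cauchy_norm.
Qed.

Lemma le_eps (x : \bar R) (C : R) : (0 <= C)%R ->
  (forall e : R, (0 < e)%R -> x <= (C * e)%:E) -> x <= 0.
Proof.
move=> C0 h; apply/lee_addgt0Pr => e e0; rewrite add0e.
have C1 : (0 < C + 1)%R by rewrite ltr_wpDl.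
apply: le_trans (h (e / (C + 1))%R _) _; first by rewrite divr_gt0.
rewrite lee_fin mulrA ler_pdivrMr// mulrC ler_wpM2l ?lerDl// ltW//.
Qed.

(** A strictly positive weight of finite associate norm already separates. *)
Lemma rdot_separates f : measurable_fun setT f ->
  (forall v, nnmeas v -> N' v < +oo -> absnorm (fun u => rdot mu u v) f <= 0) ->
  {ae mu, forall x, f x = 0%R}.
Proof.
move=> mf f0; have [w [mw w0 wP Nw]] := weak_weight.
have faP := nnmeas_abs mf.
have : \int[mu]_x (`|f x|%:E * (w x)%:E) <= 0.
  by apply: le_trans (f0 _ wP Nw); exact: integral_le_rdot.
move=> /(integral_eq0_ae (nnmeasM faP wP)); apply: filterS => x.
rewrite -EFinM => -[] /eqP; rewrite mulf_eq0 normr_eq0 => /orP[/eqP//|/eqP wx].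
by have := w0 x; rewrite wx ltxx.
Qed.

Lemma limit_avg_unique f f' g g' : measurable_fun setT f -> measurable_fun setT f' ->
  {ae mu, forall x, f x = f' x} -> limit_avg f g -> limit_avg f' g' ->
  {ae mu, forall x, g x = g' x}.
Proof.
move=> mf mf' ff' [[mg _] lg] [[mg' _] lg'].
suff : {ae mu, forall x, (g x - g' x)%R = 0%R}.
  by apply: filterS => x /eqP; rewrite subr_eq0 => /eqP.
apply: rdot_separates; first exact: measurable_funB.
move=> v vP Nv; have pP := rpP vP; have pA := rpA vP.
apply: (@le_eps _ 2%R) => // e e0.
have [n h] := lg v vP Nv e e0; have [n' h'] := lg' v vP Nv e e0.
pose m := (n + n')%N; have ma := measurable_avgR mphi m mf; have ma' := measurable_avgR mphi m mf'.
have z : absnorm (rp v) (fun x => avgR phi m f x - avgR phi m f' x)%R = 0.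
  apply/eqP; rewrite eq_le (absnorm_ge0 pP) ?andbT; last exact: measurable_funB.
  rewrite -avgRB; apply: le_trans (absnorm_avg mphi A1 pP pA m (measurable_funB mf mf')) _.
  rewrite (absnorm_ae0 pP) ?mule0//; first exact: measurable_funB.
  by apply: filterS ff' => x /= ->; rewrite subrr.
apply: le_trans (absnorm_tri pP mg ma mg') _.
rewrite absnormC mulr_natl mulr2n EFinD; apply: leeD; first exact: (h m (leq_addr _ _)).
apply: le_trans (absnorm_tri pP ma ma' mg') _; rewrite z add0e.
exact: (h' m (leq_addl _ _)).
Qed.

Lemma rspace_lin (a : R) f g : rspace f -> rspace g -> rspace (fun x => a * f x + g x)%R.
Proof.
move=> [mf Nf] [mg Ng]; have maf : measurable_fun setT (fun x => a * f x)%R by exact: measurable_funM.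
split; first exact: measurable_funD.
apply: le_lt_trans (absnormD NP maf mg) _; rewrite (absnormZ NP)//.
by rewrite lte_add_pinfty// lte_mul_pinfty ?lee_fin.
Qed.

Lemma limit_avg_lin (a : R) f g lf lg : rspace f -> rspace g -> limit_avg f lf ->
  limit_avg g lg -> limit_avg (fun x => a * f x + g x)%R (fun x => a * lf x + lg x)%R.
Proof.
move=> [mf _] [mg _] [lfX cf] [lgX cg]; split; first exact: rspace_lin.
move=> v vP Nv e e0; have pP := rpP vP.
have a1 : (0 < `|a| + 1)%R by rewrite ltr_wpDl.
pose t : R := (e / (`|a| + 1))%R; have t0 : (0 < t)%R by rewrite divr_gt0.
have [n h] := cf v vP Nv t t0; have [n' h'] := cg v vP Nv t t0.
exists (n + n')%N => m nm; rewrite avgR_lin.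
have mF : measurable_fun setT (fun x => avgR phi m f x - lf x)%R.
  by apply: measurable_funB; [exact: measurable_avgR | exact: lfX.1].
have mG : measurable_fun setT (fun x => avgR phi m g x - lg x)%R.
  by apply: measurable_funB; [exact: measurable_avgR | exact: lgX.1].
have -> : (fun x => a * avgR phi m f x + avgR phi m g x - (a * lf x + lg x))%R =
    (fun x => a * (avgR phi m f x - lf x) + (avgR phi m g x - lg x))%R.
  by apply/funext => x; ring.
apply: le_trans (absnormD pP (measurable_funM _ mF) mG) _; first exact: measurable_cst.
rewrite (absnormZ pP)//.
apply: (@le_trans _ _ (`|a|%:E * t%:E + t%:E)).
  apply: leeD; last exact: (h' m (leq_trans (leq_addl _ _) nm)).
  by apply: lee_wpmul2l; [rewrite lee_fin | exact: (h m (leq_trans (leq_addr _ _) nm))].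
by rewrite -EFinM -EFinD lee_fin -[X in (_ + X)%R]mul1r -mulrDl /t mulrCA divff ?gt_eqF// mulr1.
Qed.

(** Averages are bounded by [A] times the function for each pairing, and the bound passes
    to the limit. *)
Lemma limit_avg_bound f g v : rspace f -> limit_avg f g -> nnmeas v -> N' v < +oo ->
  absnorm (fun u => rdot mu u v) g <= A%:E * absnorm (fun u => rdot mu u v) f.
Proof.
move=> [mf _] [[mg _] lg] vP Nv; have pP := rpP vP; have pA := rpA vP.
apply/lee_addgt0Pr => e e0; have [n h] := lg v vP Nv e e0.
have ma := measurable_avgR mphi n mf.
have -> : g = (fun x => avgR phi n f x - (avgR phi n f x - g x))%R.
  by apply/funext => x; ring.
apply: le_trans (absnormB pP ma (measurable_funB ma mg)) _.
by apply: leeD; [exact: (absnorm_avg mphi A1 pP pA) | exact: (h n)].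
Qed.

Lemma limit_avg_ge0 f g : rspace f -> limit_avg f g -> {ae mu, forall x, (0 <= f x)%R} ->
  {ae mu, forall x, (0 <= g x)%R}.
Proof.
move=> [mf Nf] lfg f0.
(* The averages of [f] agree almost everywhere with those of its positive part. *)
pose f' x := Num.max (f x) 0%R.
have mf' : measurable_fun setT f' by exact: measurable_maxr.
have ff' : {ae mu, forall x, f x = f' x}.
  by apply: filterS f0 => x fx; rewrite /f' max_l.
have f'X : rspace f'.
  split => //; apply: le_lt_trans Nf; apply: (absnorm_le NP) => // x.
  by rewrite /f' /Num.max; case: ltP => //; rewrite normr0.
have [g' [lg' _ _]] := limit_avg_exists f'X.
have gg' := limit_avg_unique mf mf' ff' lfg lg'.
have [[mg' _] cg'] := lg'.
have mn : measurable_fun setT (fun x => Num.min (g' x) 0%R) by exact: measurable_minr.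
have : {ae mu, forall x, Num.min (g' x) 0%R = 0%R}.
  apply: rdot_separates => // v vP Nv; have pP := rpP vP.
  apply: (@le_eps _ 1%R) => // e e0; have [n h] := cg' v vP Nv e e0.
  rewrite mul1r; apply: le_trans (h n (leqnn _)); apply: (absnorm_le pP) => //.
    by apply: measurable_funB => //; exact: measurable_avgR.
  move=> x; have a0 : (0 <= avgR phi n f' x)%R.
    by rewrite mulr_ge0 ?invr_ge0// sumr_ge0// => i _; rewrite le_max lexx orbT.
  rewrite /Num.min; case: ltP => gx; last by rewrite normr0.
  by rewrite ltr0_norm// ger0_norm ?subr_ge0 ?(le_trans (ltW gx))//; lra.
move: gg'; apply: filterS2 => x -> h.
by rewrite leNgt; apply/negP => gx; move: h; rewrite min_l ?ltW// => gx0; rewrite gx0 ltxx in gx.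
Qed.

Lemma rspace_phi f : rspace f -> rspace (f \o phi).
Proof.
move=> [mf Nf]; split; first exact: measurableT_comp.
by apply: le_lt_trans (absnorm_iter NA 1 mf) _; rewrite lte_mul_pinfty ?lee_fin.
Qed.

Let coboundary_small f v (e : R) : rspace f -> nnmeas v -> N' v < +oo -> (0 < e)%R ->
  exists n0, forall n, (n0 <= n)%N ->
    absnorm (rp v) (fun x => avgR phi n f (phi x) - avgR phi n f x)%R <= e%:E.
Proof.
move=> fX vP Nv e0; have [mf _] := fX; have pP := rpP vP; have pA := rpA vP.
have B0 := absnorm_ge0 pP mf.
have Bf : absnorm (rp v) f \is a fin_num by rewrite ge0_fin_numE//; exact: rp_lty.
pose B := ((A + 1) * fine (absnorm (rp v) f))%R.
have BB : (0 <= B)%R by rewrite mulr_ge0 ?fine_ge0// addr_ge0.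
exists (Num.bound (B / e)).+1 => n nn.
have n0 : (0 < n%:R :> R)%R by rewrite ltr0n (leq_trans _ nn).
have -> : (fun x => avgR phi n f (phi x) - avgR phi n f x)%R =
   (fun x => n%:R^-1 * (f (iter n phi x) - f x))%R.
  by apply/funext => x; rewrite avgR_phi.
have mi : measurable_fun setT (f \o iter n phi).
  exact: measurableT_comp mf (measurable_iter mphi n).
rewrite (absnormZ pP) ?ger0_norm ?invr_ge0//; last exact: (measurable_funB mi mf).
rewrite lee_pdivrMl//; apply: le_trans (absnormB pP mi mf) _.
apply: le_trans (leeD (absnorm_iter pA n mf) (lexx _)) _.
rewrite -(fineK Bf) -EFinM -EFinD -EFinM lee_fin -[X in (_ + X <= _)%R]mul1r -mulrDl -/B.
rewrite -ler_pdivrMr//; apply: le_trans (ltW (archi_boundP _)) _; first by rewrite divr_ge0// ltW.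
by rewrite ler_nat ltnW.
Qed.

Lemma limit_avg_phi f g : rspace f -> limit_avg f g -> limit_avg (f \o phi) g.
Proof.
move=> fX [gX lg]; split; first exact: gX.
move=> v vP Nv e e0; have pP := rpP vP.
have e2 : (0 < e / 2)%R by rewrite divr_gt0.
have [n1 h1] := coboundary_small fX vP Nv e2; have [n2 h2] := lg v vP Nv _ e2.
exists (n1 + n2)%N => n nn.
have ma := measurable_avgR mphi n fX.1.
have E : avgR phi n (f \o phi) = (fun x => avgR phi n f (phi x)).
  apply/funext => x; rewrite /avgR; congr (_ * _)%R; apply: eq_bigr => i _.
  by rewrite /= -iterS iterSr.
rewrite E; have map : measurable_fun setT (fun x => avgR phi n f (phi x)) by exact: (measurableT_comp ma mphi).
apply: le_trans (absnorm_tri pP map ma gX.1) _.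
rewrite [e]splitr EFinD; apply: leeD; first exact: (h1 n (leq_trans (leq_addr _ _) nn)).
exact: (h2 n (leq_trans (leq_addl _ _) nn)).
Qed.

(** The averages of [f o phi] and of [f] differ by a vanishing boundary term, while composition with
    [phi] is bounded for each pairing. *)
Lemma limit_avg_fixed f g : rspace f -> limit_avg f g -> {ae mu, forall x, g (phi x) = g x}.
Proof.
move=> fX [[mg _] lg].
have mgp : measurable_fun setT (g \o phi) by exact: measurableT_comp.
suff : {ae mu, forall x, (g (phi x) - g x)%R = 0%R}.
  by apply: filterS => x /eqP; rewrite subr_eq0 => /eqP.
apply: rdot_separates; first exact: (measurable_funB mgp mg).
move=> v vP Nv; have pP := rpP vP; have pA := rpA vP.
apply: (@le_eps _ (A + 2)%R) => [|e e0]; first by rewrite addr_ge0.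
have [n1 h1] := coboundary_small fX vP Nv e0; have [n2 h2] := lg v vP Nv _ e0.
pose n := (n1 + n2)%N.
have {}h1 := h1 n (leq_addr _ _); have {}h2 := h2 n (leq_addl _ _).
have ma := measurable_avgR mphi n fX.1.
have map : measurable_fun setT (fun x => avgR phi n f (phi x)) by exact: (measurableT_comp ma mphi).
apply: le_trans (absnorm_tri pP mgp map mg) _.
have -> : ((A + 2) * e)%:E = A%:E * e%:E + (e%:E + e%:E).
  by rewrite -!EFinM -!EFinD; congr (_%:E); ring.
apply: leeD; last first.
  by apply: le_trans (absnorm_tri pP map ma mg) _; exact: (leeD h1 h2).
rewrite absnormC; have := absnorm_iter pA 1 (measurable_funB ma mg).
move=> /le_trans; apply; apply: lee_wpmul2l => //.
Qed.

Lemma limit_avg_of_fixed f : rspace f -> {ae mu, forall x, f (phi x) = f x} -> limit_avg f f.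
Proof.
move=> fX ff; split => // v vP Nv e e0; have [mf _] := fX; have pP := rpP vP; have pA := rpA vP.
have mi i : measurable_fun setT (f \o iter i phi).
  exact: measurableT_comp mf (measurable_iter mphi i).
have fi i : absnorm (rp v) (fun x => f (iter i phi x) - f x)%R <= 0.
  elim: i => [|i IH].
    rewrite (absnorm_ae0 pP)//; first exact: measurable_funB.
    by apply: aeT => x; rewrite subrr.
  apply: le_trans (absnorm_tri pP (mi i.+1) (mi 1%N) mf) _.
  rewrite -[leRHS]adde0; apply: leeD.
    have := absnorm_iter pA 1 (measurable_funB (mi i) mf) => h.
    apply: (@le_trans _ _ (A%:E * 0)); last by rewrite mule0.
    apply: le_trans (_ : _ <= A%:E * absnorm (rp v) (fun x => f (iter i phi x) - f x)%R) _.
      apply: le_trans h; rewrite le_eqVlt; apply/orP; left; apply/eqP; congr (rp v).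
      by apply/funext => x /=; rewrite -iterS iterSr.
    by apply: lee_wpmul2l.
  rewrite (absnorm_ae0 pP)//; first exact: (measurable_funB (mi 1%N) mf).
  by apply: filterS ff => x /= ->; rewrite subrr.
exists 1%N => n n0; have nz : (n%:R != 0 :> R)%R by rewrite pnatr_eq0 -lt0n.
have -> : (fun x => avgR phi n f x - f x)%R =
    (fun x => n%:R^-1 * \sum_(i < n) (f (iter i phi x) - f x))%R.
  apply/funext => x; rewrite sumrB mulrBr /avgR; congr (_ - _)%R.
  by rewrite sumr_const card_ord -(mulr_natl (f x)) mulrA mulVf// mul1r.
apply: (@le_trans _ _ 0); last by rewrite lee_fin ltW.
exact: (absnorm_mean pP n (fun i => measurable_funB (mi i) mf) (lexx 0) fi).
Qed.

End LimitOperator.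

(** * Functionals given by integration *)

Section Density.
Context {R : realType} {d : measure_display} {T : measurableType d}.
Variable mu : {measure set T -> \bar R}.
Hypothesis sf : sigma_finite setT mu.
Implicit Types (f g h : T -> R) (E : set T).

Lemma integrable_lty f : measurable_fun setT f -> \int[mu]_x `|f x|%:E < +oo ->
  mu.-integrable setT (EFin \o f).
Proof.
by move=> mf fi; apply/integrableP; split => //; exact/measurable_EFinP.
Qed.

Lemma integrable_lin (a b : R) f g : mu.-integrable setT (EFin \o f) ->
  mu.-integrable setT (EFin \o g) ->
  mu.-integrable setT (EFin \o (fun x => a * f x + b * g x)%R).
Proof.
move=> fi gi; have := integrableD measurableT (integrableZl measurableT a fi)
  (integrableZl measurableT b gi).
by apply: eq_integrable => // x _ /=; rewrite EFinD !EFinM.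
Qed.

Lemma Rintegral_lin (a b : R) f g : mu.-integrable setT (EFin \o f) ->
  mu.-integrable setT (EFin \o g) ->
  (\int[mu]_x (a * f x + b * g x) = a * \int[mu]_x f x + b * \int[mu]_x g x)%R.
Proof.
move=> fi gi; rewrite RintegralD ?RintegralZl//.
- by have := integrableZl measurableT a fi; apply: eq_integrable => // x _ /=; rewrite EFinM.
- by have := integrableZl measurableT b gi; apply: eq_integrable => // x _ /=; rewrite EFinM.
Qed.

(** The sign function is used with values [1] and [-1] only, so that multiplying
  by it preserves moduli. *)
Lemma sign_function h : measurable_fun setT h -> exists s : T -> R,
  [/\ measurable_fun setT s, forall x, (`|s x| = 1)%R & forall x, (s x * h x = `|h x|)%R].
Proof.
move=> mh; pose P := [set y | (0 <= h y)%R]; pose s x : R := (2 * \1_P x - 1)%R.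
have mP : measurable P.
  by rewrite -[P]setTI; exact: (measurable_fun_le (f := cst 0%R)).
have sP x : s x = (if (0 <= h x)%R then 1 else -1)%R.
  rewrite /s indicE; case: ifP => hx; first by rewrite mem_set//=; ring.
  have -> : (x \in P) = false by apply/negbTE/negP => /set_mem; rewrite /P /= hx.
  by rewrite /=; ring.
exists s; split.
- by apply: measurable_funB => //; apply: measurable_funM => //; exact: measurable_indic.
- by move=> x; rewrite sP; case: ifP; rewrite ?normr1 ?normrN1.
- move=> x; rewrite sP; case: ifP => hx; first by rewrite mul1r ger0_norm.
  by rewrite mulN1r ler0_norm// ltW// ltNge hx.
Qed.

(** The Radon-Nikodym theorem for a finite signed measure that is given as a mere set
  function. *)
Lemma charge_density (nu : set T -> \bar R) : nu set0 = 0 ->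
  (forall E, measurable E -> nu E \is a fin_num) -> semi_sigma_additive nu ->
  (forall E, measurable E -> mu E = 0 -> nu E = 0) ->
  exists g, mu.-integrable setT (EFin \o g) /\
    forall E, measurable E -> nu E = \int[mu]_(x in E) (g x)%:E.
Proof.
move=> nu0 nuf nus num.
pose B := isCharge.Build _ _ _ nu nu0 nuf nus.
pose c : {charge set T -> \bar R} := HB.pack nu B.
have [m mE] := sigma_finite_pack sf; rewrite mE in num *.
have cm : c `<< m by apply/null_content_dominatesP => E mE0 E0; exact: num.
exists (fine \o Radon_Nikodym c m).
have E : EFin \o (fine \o Radon_Nikodym c m) = Radon_Nikodym c m.
  by apply/funext => x /=; rewrite fineK// Radon_Nikodym_fin_num.
split; first by rewrite E; exact: Radon_Nikodym_integrable.
move=> F mF; have := Radon_Nikodym_integral cm mF; rewrite /= => ->.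
by apply: eq_integral => x _; rewrite -[in LHS]E.
Qed.

End Density.

(** This is how the associate of an operator on [X] is found: a functional that
  is dominated by an order continuous seminorm defines a finite signed measure
  [E |-> q (1_E w)], where [w] is a weight of finite norm, and the density of
  this measure, divided by [w], represents [q]. *)
Section DominatedFunctional.
Context {R : realType} {d : measure_display} {T : measurableType d}.
Variable mu : {measure set T -> \bar R}.
Variables (N p : (T -> \bar R) -> \bar R) (q : (T -> R) -> R) (C : R).
Hypothesis sf : sigma_finite setT mu.
Hypothesis NP : fatou_norm mu N.
Hypothesis pP : fatou_norm mu p.
Hypothesis p_lty : forall f, rspace N f -> absnorm p f < +oo.
Hypothesis p_dom : forall (f : T -> R) (F : nat -> T -> R), rspace N f ->
  (forall k, measurable_fun setT (F k)) ->
  (forall k x, `|F k x| <= `|f x|)%R ->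
  {ae mu, forall x, F k x @[k --> \oo] --> 0%R} ->
  absnorm p (F k) @[k --> \oo] --> 0.
Hypothesis q_lin : forall (a b : R) f g, rspace N f -> rspace N g ->
  q (fun x => a * f x + b * g x)%R = (a * q f + b * q g)%R.
Hypothesis C0 : (0 <= C)%R.
Hypothesis q_le : forall f, rspace N f -> `|q f|%:E <= C%:E * absnorm p f.
Variable w : T -> R.
Hypotheses (mw : measurable_fun setT w) (w0 : forall x, (0 < w x)%R) (wX : rspace N w).
Implicit Types (f g h : T -> R) (E : set T).

Let absp_le f g : measurable_fun setT f -> measurable_fun setT g ->
  (forall x, `|f x| <= `|g x|)%R -> absnorm p f <= absnorm p g.
Proof. by move=> mf mg fg; exact: (absnorm_le pP mf mg fg). Qed.

Let rspace_le f g : measurable_fun setT f -> rspace N g -> (forall x, `|f x| <= `|g x|)%R ->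
  rspace N f.
Proof.
move=> mf [mg Ng] fg; split => //; apply: le_lt_trans Ng.
exact: (absnorm_le NP mf mg fg).
Qed.

Let cvg0_le (c : R) (r : nat -> R) (u : nat -> \bar R) : u k @[k --> \oo] --> 0 ->
  (forall k, `|r k|%:E <= c%:E * u k) -> r k @[k --> \oo] --> 0%R.
Proof.
move=> u0 ru; have uC : c%:E * u k @[k --> \oo] --> c%:E * 0 by exact: cvgeZl.
rewrite mule0 in uC; apply/cvgr0Pnorm_lt => e e0.
have := cvge_near_lt uC (_ : 0 < e%:E); rewrite lte_fin => /(_ e0).
by apply: filterS => k; rewrite -lte_fin; exact: le_lt_trans.
Qed.

Let iw E x : R := (\1_E x * w x)%R.

Let iwX E : measurable E -> rspace N (iw E).
Proof.
move=> mE; apply: (rspace_le _ wX); first by apply: measurable_funM => //; exact: measurable_indic.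
move=> x; rewrite /iw normrM ler_piMl// indicE.
by case: (_ \in _); rewrite ?normr1 ?normr0.
Qed.

Let q0 : q (fun=> 0%R) = 0%R.
Proof.
have := q_lin 0 0 wX wX; rewrite !mul0r addr0.
by under eq_fun do rewrite !mul0r addr0.
Qed.

Let qU E F : measurable E -> measurable F -> E `&` F = set0 ->
  q (iw (E `|` F)) = (q (iw E) + q (iw F))%R.
Proof.
move=> mE mF EF; rewrite -[q (iw E)]mul1r -[q (iw F)]mul1r -q_lin; [|exact: iwX..].
congr q; apply/funext => x; rewrite /iw !mul1r -mulrDl !indicE in_setU; congr (_ * _)%R.
case: (boolP (x \in E)) => xE; case: (boolP (x \in F)) => xF //=; rewrite ?addr0 ?add0r//.
by move: EF => /seteqP[/(_ x)] /(_ (conj (set_mem xE) (set_mem xF))).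
Qed.

Let weight_density : exists g, mu.-integrable setT (EFin \o g) /\
  forall E, measurable E -> q (iw E) = (\int[mu]_(x in E) g x)%R.
Proof.
have iw0 : iw set0 = fun=> 0%R by apply/funext => x; rewrite /iw indic0 mul0r.
have num E : measurable E -> mu E = 0 -> (q (iw E))%:E = 0.
  move=> mE E0; apply/eqP; rewrite eqe -normr_eq0 eq_le normr_ge0 andbT -lee_fin.
  apply: le_trans (q_le (iwX mE)) _; rewrite (absnorm_ae0 pP (iwX mE).1) ?mule0//.
  exists E; split => // x /= h; apply: contrapT => xE; apply: h.
  by rewrite /iw indicE memNset ?mul0r.
have nus : semi_sigma_additive (fun E => (q (iw E))%:E).
  move=> F mF tF mU.
  pose D n := \bigcup_k F k `\` \big[setU/set0]_(i < n) F i.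
  have mB n : measurable (\big[setU/set0]_(i < n) F i) by exact: bigsetU_measurable.
  have mD n : measurable (D n) by exact: measurableD.
  have sumE n : (\sum_(i < n) q (iw (F i)))%R = q (iw (\big[setU/set0]_(i < n) F i)).
    elim: n => [|n IH]; first by rewrite !big_ord0 iw0 q0.
    rewrite !big_ord_recr /= IH -qU//.
    apply/seteqP; split => // x []; rewrite -bigcup_mkord => -[i /= iltn Fix Fnx].
    by have := tF i n I I (ex_intro _ x (conj Fix Fnx)) => e; rewrite e ltnn in iltn.
  have UE n : q (iw (\bigcup_k F k)) = (q (iw (\big[setU/set0]_(i < n) F i)) + q (iw (D n)))%R.
    rewrite -qU//; last by apply/seteqP; split => // x [h [_ /(_ h)]].
    congr (q (iw _)); rewrite /D setDUK//.
    by rewrite -bigcup_mkord; apply: bigcup_sub => i _; exact: bigcup_sup.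
  have Dp : absnorm p (iw (D n)) @[n --> \oo] --> 0.
    apply: (p_dom wX) => [k|k x|]; first exact: (iwX (mD k)).1.
      rewrite /iw normrM ler_piMl// indicE.
      by case: (_ \in _); rewrite ?normr1 ?normr0.
    apply: aeT => x; apply: (@cvg_trans _ ((fun=> 0%R : R) @ \oo)); last exact: cvg_cst.
    apply: near_eq_cvg; have [[k _ Fkx]|nU] := pselect ((\bigcup_k F k) x); last first.
      by apply: nearW => n; rewrite /iw indicE memNset ?mul0r// => -[].
    exists k.+1 => // n /= kn; rewrite /iw indicE memNset ?mul0r// => -[_]; apply.
    by rewrite -bigcup_mkord; exists k.
  have Dq : q (iw (D n)) @[n --> \oo] --> 0%R.
    by apply: (cvg0_le Dp) => n; exact: (q_le (iwX (mD n))).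
  have -> : (fun n => \sum_(0 <= i < n) (q (iw (F i)))%:E) =
      (fun n => (q (iw (\bigcup_k F k)) - q (iw (D n)))%:E).
    by apply/funext => n; rewrite (UE n) addrK -sumE big_mkord sumEFin.
  apply: cvg_EFin; first exact: nearW.
  rewrite -[X in _ --> X]subr0; apply: cvgB => //; exact: cvg_cst.
have [g [ig gE]] := charge_density sf (congr1 EFin (etrans (congr1 q iw0) q0))
  (fun E _ => erefl : (q (iw E))%:E \is a fin_num) nus num.
by exists g; split => // E mE; have := gE E mE; rewrite /Rintegral => <-.
Qed.


Let weight_int g (u : T -> R) : mu.-integrable setT (EFin \o g) -> measurable_fun setT u ->
  (forall x, 0 <= u x <= 1)%R -> mu.-integrable setT (EFin \o (fun x => u x * g x)%R).
Proof.
move=> ig mu' u01; have /integrableP[mg gi] := ig.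
have mg' : measurable_fun setT g by exact/measurable_EFinP.
apply: integrable_lty; first exact: measurable_funM.
apply: le_lt_trans gi; apply: ge0_le_integral => //.
- by apply/measurable_EFinP; apply: measurableT_comp => //; exact: measurable_funM.
- by apply/measurable_EFinP; exact: measurableT_comp.
move=> x _; rewrite /= lee_fin normrM ler_piMl//; have /andP[a b] := u01 x.
by rewrite ger0_norm.
Qed.

(** Both sides are additive and bounded on the functions with values in
  [[0, 1]], and they agree on indicators. If [u'] is [2 u - 1] where
  [u >= 1/2] and [2 u] elsewhere, then [u'] takes values in [[0, 1]] and the
  discrepancy for [u] is half that for [u'], so that it vanishes. *)
Let weight_rep g : mu.-integrable setT (EFin \o g) ->
  (forall E, measurable E -> q (iw E) = (\int[mu]_(x in E) g x)%R) ->
  forall u : T -> R, measurable_fun setT u -> (forall x, 0 <= u x <= 1)%R ->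
  q (fun x => u x * w x)%R = (\int[mu]_x (u x * g x))%R.
Proof.
move=> ig gE.
pose D (u : T -> R) := (q (fun x => u x * w x) - \int[mu]_x (u x * g x))%R.
pose K := (C * fine (absnorm p w) + \int[mu]_x `|g x|)%R.
have uwX (u : T -> R) : measurable_fun setT u -> (forall x, 0 <= u x <= 1)%R -> rspace N (fun x => u x * w x)%R.
  move=> mu' u01; apply: (rspace_le _ wX); first exact: measurable_funM.
  by move=> x; have /andP[a b] := u01 x; rewrite normrM ler_piMl// ger0_norm.
have mg : measurable_fun setT g by apply/measurable_EFinP; case/integrableP : ig.
have DK n : forall u : T -> R, measurable_fun setT u -> (forall x, 0 <= u x <= 1)%R ->
    (`|D u| <= K * 2^-1 ^+ n)%R.
  elim: n => [|n IH] u mu' u01.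
    rewrite expr0 mulr1; apply: le_trans (ler_normB _ _) _; apply: lerD.
      rewrite -lee_fin EFinM fineK; last first.
        by rewrite ge0_fin_numE ?(absnorm_ge0 pP)//; exact: p_lty.
      apply: le_trans (q_le (uwX _ mu' u01)) _; apply: lee_wpmul2l; first by rewrite lee_fin.
      apply: absp_le => //; first exact: measurable_funM.
      by move=> x; have /andP[a b] := u01 x; rewrite normrM ler_piMl// ger0_norm.
    apply: le_trans (le_normr_Rintegral measurableT (weight_int ig mu' u01)) _.
    apply: le_Rintegral => //.
    - have := weight_int ig mu' u01 => /integrable_norm.
      by [].
    - by have /integrable_norm := ig.
    - by move=> x _; have /andP[a b] := u01 x; rewrite normrM ler_piMl// ger0_norm.
  pose E := [set x | (2^-1 <= u x)%R].
  have mE : measurable E.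
    by rewrite -[E]setTI; apply: (measurable_fun_le (f := cst 2^-1%R)).
  pose u' x := (2 * u x - \1_E x)%R.
  have mu2 : measurable_fun setT u'.
    apply: measurable_funB; first exact: measurable_funM.
    exact: measurable_indic.
  have u'01 x : (0 <= u' x <= 1)%R.
    have := u01 x; rewrite /u' indicE; case: (boolP (x \in E)) => /=.
      by move/set_mem; rewrite /E /= => *; lra.
    move=> /negP h; have : (u x < 2^-1)%R by rewrite ltNge; apply/negP => h'; apply: h; exact/mem_set.
    by move=> *; lra.
  suff -> : D u = (2^-1 * D u')%R.
    by rewrite normrM ger0_norm// exprS mulrCA ler_pM2l//; exact: IH.
  have iE01 x : (0 <= (\1_E x : R) <= 1)%R by rewrite indicE; case: (_ \in _); rewrite ?lexx ler01.
  have indE : (q (iw E) = \int[mu]_x (\1_E x * g x))%R.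
    rewrite gE// Rintegral_mkcond; apply: eq_Rintegral => x _; rewrite patchE indicE.
    by case: ifP; rewrite ?mul1r ?mul0r.
  have i1 := weight_int ig mu2 u'01; have i2 := weight_int ig (measurable_indic mE) iE01.
  rewrite /D; have -> : (\int[mu]_x (u x * g x) = 2^-1 * \int[mu]_x (u' x * g x) + 2^-1 * q (iw E))%R.
    rewrite indE -Rintegral_lin//.
    by apply: eq_Rintegral => x _; rewrite /u'; field.
  have -> : (fun x => u x * w x)%R = (fun x => 2^-1 * (u' x * w x) + 2^-1 * iw E x)%R.
    by apply/funext => x; rewrite /u' /iw; field.
  rewrite q_lin; [|exact: uwX|exact: iwX].
  by ring.
move=> u mu' u01; apply/eqP; rewrite -subr_eq0 -normr_eq0 eq_le normr_ge0 andbT.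
have h : (K * 2^-1 ^+ n)%R @[n --> \oo] --> (K * 0)%R.
  by apply: cvgMr; apply: cvg_expr; rewrite ger0_norm//; lra.
rewrite mulr0 in h; apply: (ler_cvg_to (cvg_cst _) h); apply: nearW => n; exact: DK.
Qed.

(** The functional is represented first on functions bounded by a multiple of the weight.
  Testing with [s |f|], where [s] is the sign of the density, bounds the integral of [|f h|], and
  clipping extends the representation to the whole space. *)
Lemma dominated_functional_density : exists h, measurable_fun setT h /\
  forall f, rspace N f -> \int[mu]_x `|f x * h x|%:E <= C%:E * absnorm p f /\
    q f = (\int[mu]_x (f x * h x))%R.
Proof.
have wn0 x : w x != 0%R by rewrite gt_eqF.
have [g [ig gE]] := weight_density; have gw := weight_rep ig gE.
have /integrableP[mg _] := ig; have {}mg : measurable_fun setT g by exact/measurable_EFinP.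
have mwi : measurable_fun setT (fun x => (w x)^-1)%R.
  rewrite (_ : (fun x => _) = (fun x => w x `^ (-1))%R); last first.
    by apply/funext => x; rewrite powR_inv1// ltW.
  exact: (measurableT_comp (measurable_powR _) mw).
pose h x := (g x / w x)%R.
have mh : measurable_fun setT h by exact: measurable_funM.
exists h; split => //.
(* A function bounded by a multiple of [w] is an affine image of a function
   with values in the unit interval. *)
have bounded f k : measurable_fun setT f -> (0 < k)%R -> (forall x, `|f x| <= k * w x)%R ->
    [/\ rspace N f, mu.-integrable setT (EFin \o (fun x => f x * h x)%R) &
    q f = (\int[mu]_x (f x * h x))%R].
  move=> mf k0 fk; have kn0 : k != 0%R by rewrite gt_eqF.
  pose u x := ((f x / (k * w x) + 1) / 2)%R.
  have mu' : measurable_fun setT u.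
    rewrite (_ : u = fun x => (f x * (w x)^-1 * (2 * k)^-1 + 2^-1)%R); last first.
      by apply/funext => x; rewrite /u; field; rewrite kn0 wn0.
    by apply: measurable_funD => //; apply: measurable_funM => //; exact: measurable_funM.
  have u01 x : (0 <= u x <= 1)%R.
    have : (`|f x / (k * w x)| <= 1)%R.
      by rewrite normrM normfV (ger0_norm (ltW (mulr_gt0 k0 (w0 x)))) ler_pdivrMr ?mulr_gt0// mul1r.
    by rewrite ler_norml /u; move: (f x / _)%R => t; lra.
  have o01 (x : T) : (0 <= (1 : R) <= 1)%R by rewrite ler01 lexx.
  have fX : rspace N f.
    have [_ Nw] := wX; have mkw : measurable_fun setT (fun x => k * w x)%R by exact: measurable_funM.
    have kwX : rspace N (fun x => k * w x)%R.
      by split => //; rewrite (absnormZ NP)// lte_mul_pinfty ?lee_fin// (absnorm_ge0 NP).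
    apply: (rspace_le mf kwX) => x.
    by rewrite (le_trans (fk x))// ler_norm.
  have uwX : rspace N (fun x => u x * w x)%R.
    apply: (rspace_le _ wX); first exact: measurable_funM.
    by move=> x; have /andP[a b] := u01 x; rewrite normrM ler_piMl// ger0_norm.
  have iu := weight_int ig mu' u01.
  have fE : f = (fun x => (2 * k) * (u x * w x) + (- k) * w x)%R.
    by apply/funext => x; rewrite /u; field; rewrite kn0 wn0.
  have fhE : (fun x => f x * h x)%R = (fun x => (2 * k) * (u x * g x) + (- k) * g x)%R.
    by apply/funext => x; rewrite /u /h; field; rewrite kn0 wn0.
  split => //; first by rewrite fhE; exact: integrable_lin.
  rewrite {1}fE q_lin// gw// fhE Rintegral_lin//; congr (_ + _ * _)%R.
  have := gw (cst 1%R) (measurable_cst _) o01.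
  rewrite (_ : (fun x => cst 1 x * w x)%R = w); last by apply/funext => x; rewrite mul1r.
  by move=> ->; apply: eq_Rintegral => x _; rewrite mul1r.
have clipX k f : rspace N f -> [/\ rspace N (clip w k f),
    mu.-integrable setT (EFin \o (fun x => clip w k f x * h x)%R) &
    q (clip w k f) = (\int[mu]_x (clip w k f x * h x))%R].
  move=> [mf _]; apply: (@bounded _ k.+1%:R).
  - exact: measurable_clip.
  - by rewrite ltr0n.
  - by move=> x; rewrite (le_trans (clip_le _ _ _ w0))// ler_wpM2r ?ler_nat// ltW.
have bound f : rspace N f -> \int[mu]_x `|f x * h x|%:E <= C%:E * absnorm p f.
  move=> fX; have [mf _] := fX.
  have [s [ms s1 sh]] := sign_function mh.
  have mFm k : measurable_fun setT (clip w k f) by exact: measurable_clip.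
  have mg' k : nnmeas (fun x => `|clip w k f x * h x|%:E).
    by apply: nnmeas_abs; exact: measurable_funM.
  have step k : \int[mu]_x `|clip w k f x * h x|%:E <= C%:E * absnorm p f.
    pose F x := (s x * `|clip w k f x|)%R.
    have [FX iF FE] : [/\ rspace N F, mu.-integrable setT (EFin \o (fun x => F x * h x)%R) &
        q F = (\int[mu]_x (F x * h x))%R].
      apply: (@bounded _ k.+1%:R).
      - by apply: measurable_funM => //; exact: measurableT_comp.
      - by rewrite ltr0n.
      - move=> x; rewrite /F normrM s1 mul1r normr_id.
        by rewrite (le_trans (clip_le _ _ _ w0))// ler_wpM2r ?ler_nat// ltW.
    have FhE x : (F x * h x = `|clip w k f x * h x|)%R.
      by rewrite /F mulrAC sh [RHS]normrM mulrC.
    have -> : \int[mu]_x `|clip w k f x * h x|%:E = (q F)%:E.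
      rewrite FE /Rintegral fineK; last exact: integrable_fin_num.
      by apply: eq_integral => x _; rewrite FhE.
    apply: le_trans (_ : _ <= `|q F|%:E) _; first by rewrite lee_fin ler_norm.
    apply: le_trans (q_le FX) _; apply: lee_wpmul2l; first by rewrite lee_fin.
    apply: absp_le => //; first exact: FX.1.
    move=> x; rewrite /F normrM s1 mul1r normr_id /clip normrM ler_piMr// indicE.
    by case: (_ \in _); rewrite ?normr1 ?normr0.
  apply: (fn_fatou (fatou_norm_int mu) mg' _ _ step).
    by apply: nnmeas_abs; exact: measurable_funM.
  apply: aeT => x; apply: cvg_EFin; first exact: nearW.
  apply: (@cvg_trans _ ((fun=> `|f x * h x|%R : R) @ \oo)); last exact: cvg_cst.
  apply: near_eq_cvg; have := nbhs_infty_ger (`|f x| / w x)%R.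
  apply: filterS => k /= hk; rewrite /clip indicE mem_set ?mulr1//=.
  by rewrite -ler_pdivrMr.
move=> f fX; split; first exact: bound.
have [mf _] := fX; have C2 : (0 <= C + C)%R by rewrite addr_ge0.
apply/eqP; rewrite -subr_eq0; apply/eqP.
pose F k x := (f x - clip w k f x)%R.
have FX k : rspace N (F k).
  apply: (rspace_le _ fX); first by apply: measurable_funB => //; exact: measurable_clip.
  move=> x; rewrite /F sub_clip normrM ler_piMr// indicE.
  by case: (_ \in _); rewrite ?normr1 ?normr0.
have Fp : absnorm p (F k) @[k --> \oo] --> 0.
  apply: (p_dom fX) => [k|k x|]; first exact: (FX k).1.
    rewrite /F sub_clip normrM ler_piMr// indicE.
    by case: (_ \in _); rewrite ?normr1 ?normr0.
  apply: aeT => x; under eq_fun do rewrite /F sub_clip.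
  by rewrite -(mulr0 (f x)); apply: cvgMr; exact: cvg_clip_set.
have ih k : rspace N k -> mu.-integrable setT (EFin \o (fun x => k x * h x)%R).
  move=> kX; apply: integrable_lty; first exact: measurable_funM kX.1 mh.
  apply: le_lt_trans (bound k kX) _; rewrite lte_mul_pinfty ?lee_fin//; exact: p_lty.
set r := (q f - _)%R; have rE k : r = (q (F k) - \int[mu]_x (F k x * h x))%R.
  have [cX ci cE] := clipX k f fX.
  have -> : (\int[mu]_x (F k x * h x) = \int[mu]_x (f x * h x) - \int[mu]_x (clip w k f x * h x))%R.
    rewrite -RintegralB//; last exact: ih.
    by apply: eq_Rintegral => x _; rewrite /F mulrBl.
  have -> : F k = (fun x => 1 * f x + (-1) * clip w k f x)%R.
    by apply/funext => x; rewrite /F; ring.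
  by rewrite q_lin// cE /r; ring.
have rle k : `|r|%:E <= (C + C)%:E * absnorm p (F k).
  rewrite (rE k) EFinD ge0_muleDl ?lee_fin//.
  apply: (@le_trans _ _ (`|q (F k)|%:E + `|\int[mu]_x (F k x * h x)|%R%:E)).
    by rewrite -EFinD lee_fin ler_normB.
  apply: leeD; first exact: q_le.
  apply: le_trans (bound _ (FX k)); rewrite EFin_normr_Rintegral//; last exact: ih.
  apply: le_abse_integral => //; apply/measurable_EFinP; exact: measurable_funM (FX k).1 mh.
exact: (cvg_unique _ (cvg_cst r) (cvg0_le Fp rle)).
Qed.

End DominatedFunctional.

(** * The associate of the limit operator *)

Lemma rspace_lin2 {R : realType} {d : measure_display} {T : measurableType d}
    (mu : {measure set T -> \bar R}) (N : (T -> \bar R) -> \bar R) :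
  banach_norm mu N -> forall (a b : R) (f g : T -> R), rspace N f -> rspace N g ->
  rspace N (fun x => a * f x + b * g x)%R.
Proof.
move=> BN a b f g fX gX; have bgX := rspace_lin BN (b - 1) gX gX.
rewrite (_ : (fun x => _) = (fun x => a * f x + ((b - 1) * g x + g x))%R); last first.
  by apply/funext => x; ring.
exact: (rspace_lin BN a fX bgX).
Qed.

Section RealOperators.
Context {R : realType} {d : measure_display} {T : measurableType d}.
Variable mu : {measure set T -> \bar R}.
Variables (phi : T -> T) (A : R) (N : (T -> \bar R) -> \bar R).
Implicit Types (f g h : T -> R) (u v : T -> \bar R).

(** The limit is determined up to null sets only; a representative is chosen. *)
Definition avg_limit f : T -> R := xget (fun=> 0%R) [set g |
  [/\ limit_avg mu phi N f g, absnorm N g <= A%:E * absnorm N f &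
      acn_nn mu N (fun x => `|f x|%:E) -> cvg_avg phi N f g]].

Definition associate_avg h : T -> R := xget (fun=> 0%R) [set k |
  [/\ rspace (assoc mu N) k, absnorm (assoc mu N) k <= A%:E * absnorm (assoc mu N) h &
      forall f, rspace N f -> (\int[mu]_x (avg_limit f x * h x) = \int[mu]_x (f x * k x))%R]].

Hypothesis mphi : measurable_fun setT phi.
Hypothesis A1 : (1 <= A)%R.
Hypothesis phiA : forall n (E : set T), measurable E ->
  mu (iter n phi @^-1` E) <= A%:E * mu E.
Hypothesis sf : sigma_finite setT mu.
Hypothesis res : resonant_nn mu.
Hypothesis BN : banach_norm mu N.
Hypothesis inv : dist_invariant mu N.
Hypothesis ACR : forall u, nnmeas u -> N u < +oo -> vanishing mu u.
Hypothesis ACR' : forall v, nnmeas v -> assoc mu N v < +oo -> vanishing mu v.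

Let NP := bn_fatou BN.
Let N' := assoc mu N.
Let BN' : banach_norm mu N' := banach_norm_assoc BN.
Let A0 : (0 <= A)%R. Proof. exact: le_trans A1. Qed.

Lemma avg_limitP f : rspace N f -> [/\ limit_avg mu phi N f (avg_limit f),
  absnorm N (avg_limit f) <= A%:E * absnorm N f &
  acn_nn mu N (fun x => `|f x|%:E) -> cvg_avg phi N f (avg_limit f)].
Proof.
move=> fX; have [g gP] := limit_avg_exists mphi A1 phiA sf res BN inv ACR ACR' fX.
by rewrite /avg_limit; case: xgetP => [y _ yP|no]; [exact: yP | case: (no g)].
Qed.

Lemma limit_avg_lin2 (a b : R) f g lf lg : rspace N f -> rspace N g ->
  limit_avg mu phi N f lf -> limit_avg mu phi N g lg ->
  limit_avg mu phi N (fun x => a * f x + b * g x)%R (fun x => a * lf x + b * lg x)%R.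
Proof.
move=> fX gX lf' lg'; have E h : (fun x => b * h x)%R = (fun x => (b - 1) * h x + h x)%R.
  by apply/funext => x; ring.
have bg := limit_avg_lin mphi res BN (b - 1) gX gX lg' lg'.
have bgX := rspace_lin BN (b - 1) gX gX.
by rewrite -!E in bg bgX; exact: (limit_avg_lin mphi res BN a fX bgX lf' bg).
Qed.

Lemma avg_limit_lin (a b : R) f g : rspace N f -> rspace N g ->
  {ae mu, forall x, avg_limit (fun x => a * f x + b * g x)%R x =
    (a * avg_limit f x + b * avg_limit g x)%R}.
Proof.
move=> fX gX; have [lf _ _] := avg_limitP fX; have [lg _ _] := avg_limitP gX.
have fgX := rspace_lin2 BN a b fX gX; have [lfg _ _] := avg_limitP fgX.
apply: (limit_avg_unique mphi A1 phiA sf res BN fgX.1 fgX.1 _ lfg (limit_avg_lin2 a b fX gX lf lg)).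
exact: aeT.
Qed.

Lemma avg_limit_ae f g : rspace N f -> rspace N g -> {ae mu, forall x, f x = g x} ->
  {ae mu, forall x, avg_limit f x = avg_limit g x}.
Proof.
move=> fX gX fg; have [lf _ _] := avg_limitP fX; have [lg _ _] := avg_limitP gX.
exact: (limit_avg_unique mphi A1 phiA sf res BN fX.1 gX.1 fg lf lg).
Qed.

Lemma rspace_avg_limit f : rspace N f -> rspace N (avg_limit f).
Proof. by move=> fX; have [[]] := avg_limitP fX. Qed.

Lemma integrable_pairing f h : rspace N f -> rspace N' h ->
  mu.-integrable setT (EFin \o (fun x => f x * h x)%R).
Proof.
move=> [mf Nf] [mh Nh]; apply: integrable_lty; first exact: measurable_funM.
apply: le_lt_trans (rdot_lty res BN inv (nnmeas_abs mf) (nnmeas_abs mh) Nf Nh).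
apply: le_trans (integral_le_rdot res (nnmeas_abs mf) (nnmeas_abs mh)).
by under eq_integral do rewrite normrM EFinM.
Qed.

Lemma le_pairing f h : rspace N f -> rspace N' h ->
  (`|\int[mu]_x (f x * h x)|%R)%:E <= rdot mu (fun x => `|f x|%:E) (fun x => `|h x|%:E).
Proof.
move=> fX hX; have [mf Nf] := fX; have [mh Nh] := hX.
rewrite EFin_normr_Rintegral//; last exact: integrable_pairing.
apply: le_trans (integral_le_rdot res (nnmeas_abs mf) (nnmeas_abs mh)).
apply: le_trans (le_abse_integral mu measurableT _) _.
  by apply/measurable_EFinP; exact: measurable_funM.
by under eq_integral do rewrite /= normrM EFinM.
Qed.

(** Tested with a positive weight times the sign of [h - k]. *)
Lemma pairing_separates h k : rspace N' h -> rspace N' k ->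
  (forall f, rspace N f -> (\int[mu]_x (f x * h x) = \int[mu]_x (f x * k x))%R) ->
  {ae mu, forall x, h x = k x}.
Proof.
move=> hX kX hk; have [w [mw wb Nw _ _]] := common_weight sf BN.
have w0 x : (0 < w x)%R by have /andP[] := wb x.
have mD : measurable_fun setT (fun x => h x - k x)%R by exact: measurable_funB hX.1 kX.1.
have [s [ms s1 sD]] := sign_function mD.
have swX : rspace N (fun x => s x * w x)%R.
  split; first exact: measurable_funM.
  rewrite /absnorm; under eq_fun do rewrite normrM s1 mul1r ger0_norm ?ltW//.
  exact: Nw.
have ih := integrable_pairing swX hX; have ik := integrable_pairing swX kX.
have mDw : measurable_fun setT (fun x => w x * `|h x - k x|)%R.
  by apply: measurable_funM => //; exact: measurableT_comp.
have Dw0 x : (0 <= w x * `|h x - k x|)%R by rewrite mulr_ge0// ltW.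
have E x : (w x * `|h x - k x| = 1 * (s x * w x * h x) + (-1) * (s x * w x * k x))%R.
  by rewrite -sD; ring.
have iD : mu.-integrable setT (EFin \o (fun x => w x * `|h x - k x|)%R).
  by under eq_fun do rewrite E; exact: integrable_lin.
have z : \int[mu]_x (w x * `|h x - k x|)%:E <= 0.
  rewrite -(fineK (integrable_fin_num measurableT iD)) lee_fin.
  have -> : fine (\int[mu]_x (EFin \o (fun x => w x * `|h x - k x|)%R) x) =
    (\int[mu]_x (1 * (s x * w x * h x) + (-1) * (s x * w x * k x)))%R.
    by apply: eq_Rintegral => x _; rewrite E.
  by rewrite Rintegral_lin// hk// mulN1r mul1r subrr.
apply: filterS (integral_eq0_ae (nnmeas_EFin mDw Dw0) z) => x -[] /eqP.
by rewrite mulf_eq0 gt_eqF//= normr_eq0 subr_eq0 => /eqP.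
Qed.

(** The functional that integrates the limit against [h] is dominated by the pairing with [|h|], by
  the boundedness of the limit operator for pairings; its density is the associate of [h].
  The norm of this density is estimated by duality. *)
Lemma associate_avgP h : rspace N' h -> [/\ rspace N' (associate_avg h),
  absnorm N' (associate_avg h) <= A%:E * absnorm N' h &
  forall f, rspace N f ->
    (\int[mu]_x (avg_limit f x * h x) = \int[mu]_x (f x * associate_avg h x))%R].
Proof.
move=> hX; have [mh Nh] := hX.
suff [k kP] : exists k, [/\ rspace N' k, absnorm N' k <= A%:E * absnorm N' h &
  forall f, rspace N f -> (\int[mu]_x (avg_limit f x * h x) = \int[mu]_x (f x * k x))%R].
  by rewrite /associate_avg; case: xgetP => [y _ yP|no]; [exact: yP | case: (no k)].
have [w [mw wb Nw _ _]] := common_weight sf BN.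
have w0 x : (0 < w x)%R by have /andP[] := wb x.
have wX : rspace N w.
  split => //; rewrite /absnorm; under eq_fun do rewrite ger0_norm ?ltW//.
  exact: Nw.
have hP := nnmeas_abs mh.
pose p u := rdot mu u (fun x => `|h x|%:E).
have pP : fatou_norm mu p by exact: fatou_norm_rdot.
have plty f : rspace N f -> absnorm p f < +oo.
  by move=> [mf Nf]; apply: (rdot_lty res BN inv) => //; exact: nnmeas_abs.
have pdom f (F : nat -> T -> R) : rspace N f -> (forall k, measurable_fun setT (F k)) ->
    (forall k x, `|F k x| <= `|f x|)%R -> {ae mu, forall x, F k x @[k --> \oo] --> 0%R} ->
    absnorm p (F k) @[k --> \oo] --> 0.
  move=> fX mF Ff F0; have [mf Nf] := fX.
  apply: (dominated_rdot (u := fun x => `|f x|%:E)) => //.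
  - by move=> k; exact: nnmeas_abs.
  - exact: nnmeas_abs.
  - by apply: filterS F0 => x Fx; apply: cvg_EFin; [exact: nearW | exact/norm_cvg0P].
  - by apply: ACR => //; exact: nnmeas_abs.
  - exact: plty.
pose q f := (\int[mu]_x (avg_limit f x * h x))%R.
have qlin (a b : R) f g : rspace N f -> rspace N g ->
    q (fun x => a * f x + b * g x)%R = (a * q f + b * q g)%R.
  move=> fX gX; have fgX := rspace_lin2 BN a b fX gX.
  have pf := integrable_pairing (rspace_avg_limit fX) hX.
  have pg := integrable_pairing (rspace_avg_limit gX) hX.
  have pfg := integrable_pairing (rspace_avg_limit fgX) hX.
  rewrite /q -Rintegral_lin//; congr fine; apply: ae_eq_integral => //.
  - by case/integrableP : pfg.
  - by have /integrableP[] := integrable_lin a b pf pg.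
  - apply: filterS (avg_limit_lin a b fX gX) => x /= -> _; congr (_%:E); ring.
have qle f : rspace N f -> `|q f|%:E <= A%:E * absnorm p f.
  move=> fX; have [lf _ _] := avg_limitP fX.
  apply: le_trans (le_pairing (rspace_avg_limit fX) hX) _.
  exact: (limit_avg_bound mphi A1 phiA res fX lf hP Nh).
have [k [mk kP]] := dominated_functional_density sf NP pP plty pdom qlin A0 qle mw w0 wX.
have Nk : absnorm N' k <= A%:E * absnorm N' h.
  apply: ge_ereal_sup => _ [u [uP Nu] <-].
  have ufin := norm_lty_ae sf res BN inv uP (le_lt_trans Nu (ltry 1)).
  pose f x := fine (u x).
  have mf : measurable_fun setT f by apply: measurableT_comp uP.1; exact: fine_measurable.
  have uE : {ae mu, forall x, u x = `|f x|%:E}.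
    by apply: filterS ufin => x ux; rewrite /f ger0_norm ?fine_ge0 ?uP.2// fineK.
  have Nf : absnorm N f <= 1.
    apply: le_trans Nu; apply: (fn_le NP) => //; first exact: nnmeas_abs.
    by apply: filterS uE => x ->.
  have fX : rspace N f by split => //; exact: le_lt_trans Nf (ltry 1).
  have -> : \int[mu]_x (`|k x|%:E * u x) = \int[mu]_x `|f x * k x|%:E.
    apply: ae_eq_integral => //.
    - by apply: emeasurable_funM uP.1; exact: (nnmeas_abs mk).1.
    - by apply: (nnmeas_abs _).1; exact: measurable_funM.
    - by apply: filterS uE => x -> _; rewrite -EFinM normrM mulrC.
  have [h1 _] := kP f fX; apply: le_trans h1 _; apply: lee_wpmul2l; first by rewrite lee_fin.
  by have := rdot_le res BN inv (nnmeas_abs mf) hP ltr01 Nf; rewrite mul1e.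
have kX : rspace N' k.
  split; first exact: mk.
  by apply: le_lt_trans Nk _; rewrite lte_mul_pinfty ?lee_fin// (absnorm_ge0 (bn_fatou BN')).
exists k; split; [exact: kX | exact: Nk|].
by move=> f fX; have [_] := kP f fX.
Qed.

Lemma associate_avg_lin (a b : R) h k : rspace N' h -> rspace N' k ->
  {ae mu, forall x, associate_avg (fun x => a * h x + b * k x)%R x =
    (a * associate_avg h x + b * associate_avg k x)%R}.
Proof.
move=> hX kX; have hkX := rspace_lin2 BN' a b hX kX.
have [h'X _ hE] := associate_avgP hX; have [k'X _ kE] := associate_avgP kX.
have [hk'X _ hkE] := associate_avgP hkX.
apply: (pairing_separates hk'X (rspace_lin2 BN' a b h'X k'X)).
move=> f fX; have lfX := rspace_avg_limit fX; rewrite -hkE//.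
have E (g h1 h2 : T -> R) : (fun x => g x * (a * h1 x + b * h2 x))%R =
    (fun x => a * (g x * h1 x) + b * (g x * h2 x))%R by apply/funext => x; ring.
rewrite !E !Rintegral_lin ?hE ?kE//; exact: integrable_pairing.
Qed.

Lemma associate_avg_ae h k : rspace N' h -> rspace N' k -> {ae mu, forall x, h x = k x} ->
  {ae mu, forall x, associate_avg h x = associate_avg k x}.
Proof.
move=> hX kX hk.
have [h'X _ hE] := associate_avgP hX; have [k'X _ kE] := associate_avgP kX.
apply: (pairing_separates h'X k'X) => f fX; have lfX := rspace_avg_limit fX.
rewrite -hE// -kE//; congr fine; apply: ae_eq_integral => //.
- by have /integrableP[] := integrable_pairing lfX hX.
- by have /integrableP[] := integrable_pairing lfX kX.
- by apply: filterS hk => x -> _.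
Qed.

End RealOperators.

(** * Extended complex functions through their moduli *)

Section ExtendedComplexValues.
Context {R : realType}.
Implicit Types z w : xcomplex R.

Lemma normc_ge0 (a : R[i]) : (0 <= normc a)%R.
Proof. by case: a => x y; exact: sqrtr_ge0. Qed.

Lemma xabs_ge0 z : 0 <= xabs z.
Proof. by case: z => [a|]; rewrite ?leey// lee_fin; exact: normc_ge0. Qed.

Lemma normc_ge_Re' (a : R[i]) : (`|complex.Re a| <= normc a)%R.
Proof.
case: a => x y /=; rewrite -sqrtr_sqr ler_wsqrtr// lerDl; exact: sqr_ge0.
Qed.

Lemma normc_ge_Im' (a : R[i]) : (`|complex.Im a| <= normc a)%R.
Proof.
case: a => x y /=; rewrite -sqrtr_sqr ler_wsqrtr// lerDr; exact: sqr_ge0.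
Qed.

Lemma normc_le_ReIm (a : R[i]) : (normc a <= `|complex.Re a| + `|complex.Im a|)%R.
Proof.
case: a => x y /=; rewrite -[leRHS]ger0_norm ?addr_ge0// -sqrtr_sqr ler_wsqrtr//.
by rewrite sqrrD !real_normK ?num_real// lerD2r lerDl mulrn_wge0// mulr_ge0.
Qed.

Lemma xabsM z w : xabs (xmul z w) = xabs z * xabs w.
Proof.
have H (a : R[i]) : xabs (if a == 0%R then xzero else XInf) = (normc a)%:E * +oo :> \bar R.
  case: eqP => [->|a0]; first by rewrite /xzero /xabs normc0 mul0e.
  rewrite /xabs gt0_muley// lte_fin lt_neqAle eq_sym; apply/andP; split.
    by apply/eqP => /eq0_normc.
  exact: normc_ge0.
case: z w => [a|] [b|] /=.
- by rewrite normcM EFinM.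
- exact: H.
- by rewrite muleC; exact: H.
- by rewrite mulyy.
Qed.

Lemma xabs_scale (a : R[i]) z : xabs (xscale a z) = (normc a)%:E * xabs z.
Proof. exact: xabsM. Qed.

Lemma xabsD z w : xabs (xadd z w) <= xabs z + xabs w.
Proof.
case: z w => [a|] [b|] /=; rewrite ?addye ?addey//.
by rewrite -EFinD lee_fin le_normcD.
Qed.

Lemma xabs_zero : xabs (xzero : xcomplex R) = 0.
Proof. by rewrite /xabs /xzero normc0. Qed.

Definition emb (r : \bar R) : xcomplex R := if r is x%:E then XFin (x%:C)%C else XInf.

Lemma xabs_emb r : 0 <= r -> xabs (emb r) = r.
Proof.
case: r => [x| |] //=; rewrite lee_fin => x0.
by rewrite expr0n /= addr0 sqrtr_sqr ger0_norm.
Qed.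

Lemma emb_xabs z : emb (xabs z) = xmod z.
Proof. by case: z. Qed.

Lemma xnonneg_emb r : 0 <= r -> xnonneg (emb r).
Proof. by case: r => [x| |] //=; rewrite lee_fin lecR. Qed.

End ExtendedComplexValues.

Section ExtendedComplexFunctions.
Context {R : realType} {d : measure_display} {T : measurableType d}.
Variable mu : {measure set T -> \bar R}.
Implicit Types (f g : T -> xcomplex R) (u v : T -> \bar R).

Definition re f : T -> R := fun x => xRe (f x).
Definition im f : T -> R := fun x => xIm (f x).
Definition absf f : T -> \bar R := fun x => xabs (f x).
Definition embf u : T -> xcomplex R := fun x => emb (u x).
Definition mkc (a b : T -> R) : T -> xcomplex R := fun x => XFin (Complex (a x) (b x)).

Lemma Mfun_mkc (a b : T -> R) : measurable_fun setT a -> measurable_fun setT b -> Mfun (mkc a b).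
Proof.
move=> ma mb; split => //.
by rewrite (_ : [set x | _] = set0)//; apply/seteqP; split.
Qed.

Lemma nnmeas_absf f : Mfun f -> nnmeas (absf f).
Proof.
move=> [mI mr mi]; split; last by move=> x; exact: xabs_ge0.
rewrite (_ : absf f = fun x => (Num.sqrt (re f x ^+ 2 + im f x ^+ 2))%:E +
    +oo * (\1_[set x | f x = XInf] x)%:E); last first.
  apply/funext => x; rewrite /absf /re /im indicE; case E : (f x) => [[a b]|].
    by rewrite memNset/= ?E// mule0 adde0.
  by rewrite mem_set//= mule1 addey.
apply: emeasurable_funD.
  apply/measurable_EFinP; apply: measurableT_comp.
    by apply: continuous_measurable_fun => x; exact: sqrt_continuous.
  by apply: measurable_funD; exact: measurable_funX.
apply: emeasurable_funM; first exact: measurable_cst.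
by apply/measurable_EFinP; exact: measurable_indic.
Qed.

Lemma Mplus_embf u : nnmeas u -> Mplus (embf u).
Proof.
move=> [mu' u0]; split; last by move=> x; exact: xnonneg_emb.
have E : [set x | embf u x = XInf] = u @^-1` [set +oo].
  apply/seteqP; split => x /=; rewrite /embf; last by move=> ->.
  by have := u0 x; case: (u x).
split.
- by rewrite E -[X in measurable X]setTI; exact: mu'.
- rewrite (_ : (fun x => _) = fine \o u); last first.
    by apply/funext => x; rewrite /embf /=; case: (u x).
  by apply: measurableT_comp mu'; exact: fine_measurable.
- rewrite (_ : (fun x => _) = cst 0%R); first exact: measurable_cst.
  by apply/funext => x; rewrite /embf /=; case: (u x).
Qed.

Lemma absf_embf u : nnmeas u -> absf (embf u) = u.
Proof. by move=> uP; apply/funext => x; rewrite /absf xabs_emb ?uP.2. Qed.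

Lemma Mfun_re f : Mfun f -> measurable_fun setT (re f). Proof. by case. Qed.
Lemma Mfun_im f : Mfun f -> measurable_fun setT (im f). Proof. by case. Qed.

(** The operations on extended complex values are defined by cases; this reduces their
  measurability to that of the finite formula and of the set of infinite values. *)
Lemma Mfun_if (E : set T) (a b : T -> R) f : measurable E ->
  measurable_fun setT a -> measurable_fun setT b ->
  (forall x, f x = if x \in E then XInf else XFin (Complex (a x) (b x))) -> Mfun f.
Proof.
move=> mE ma mb fE.
have mif (c : T -> R) : measurable_fun setT c ->
    measurable_fun setT (fun x => c x * \1_(~` E) x)%R.
  by move=> mc; apply: measurable_funM => //; apply: measurable_indic; exact: measurableC.
split.
- rewrite (_ : [set x | _] = E)//; apply/seteqP; split => x /=; rewrite fE.
    by case: ifP => // /set_mem.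
  by move=> Ex; rewrite mem_set.
- rewrite (_ : (fun x => _) = fun x => (a x * \1_(~` E) x)%R); first exact: mif.
  by apply/funext => x; rewrite fE indicE in_setC; case: ifP => _ /=; rewrite ?mulr0 ?mulr1.
- rewrite (_ : (fun x => _) = fun x => (b x * \1_(~` E) x)%R); first exact: mif.
  by apply/funext => x; rewrite fE indicE in_setC; case: ifP => _ /=; rewrite ?mulr0 ?mulr1.
Qed.

Lemma Mfun_fadd f g : Mfun f -> Mfun g -> Mfun (fadd f g).
Proof.
move=> [mf fr fi] [mg gr gi].
apply: (@Mfun_if ([set x | f x = XInf] `|` [set x | g x = XInf])
  (fun x => re f x + re g x)%R (fun x => im f x + im g x)%R).
- exact: measurableU.
- exact: measurable_funD.
- exact: measurable_funD.
move=> x; rewrite /fadd /re /im; case: ifPn => [/set_mem[] /= ->|h]; first by [].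
  by case: (f x).
case Ef : (f x) => [a|]; last by case/negP: h; apply/mem_set; left.
case Eg : (g x) => [b|]; last by case/negP: h; apply/mem_set; right.
by case: a b {Ef Eg} => [? ?] [? ?].
Qed.

Lemma Mfun_fmul f g : Mfun f -> Mfun g -> Mfun (fmul f g).
Proof.
move=> Mf Mg; have [mf fr fi] := Mf; have [mg gr gi] := Mg.
pose E := [set x | absf f x * absf g x = +oo].
have mE : measurable E.
  rewrite -[E]setTI; apply: (measurable_eqe measurableT _ (measurable_cst +oo)).
  exact: (nnmeasM (nnmeas_absf Mf) (nnmeas_absf Mg)).1.
apply: (@Mfun_if E (fun x => re f x * re g x - im f x * im g x)%R
   (fun x => re f x * im g x + im f x * re g x)%R) => //.
- by apply: measurable_funB; exact: measurable_funM.
- by apply: measurable_funD; exact: measurable_funM.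
move=> x; have fg := xabsM (f x) (g x).
case: ifPn => [/set_mem|/negP h].
  by rewrite /E /= /absf -fg /fmul; case: (xmul _ _).
have {h} : xabs (xmul (f x) (g x)) <> +oo by move=> e; apply: h; apply/mem_set; rewrite /E /= -fg.
rewrite /fmul /re /im; case: (f x) => [[a b]|]; case: (g x) => [[a' b']|] //=.
- by case: eqP => // -[-> ->] _; rewrite !mul0r subrr addr0.
- by case: eqP => // -[-> ->] _; rewrite !mulr0 subrr addr0.
Qed.

Lemma Mfun_charfun E : measurable E -> Mfun (charfun E : T -> xcomplex R).
Proof.
move=> mE; apply: Mfun_mkc; first exact: measurable_indic.
exact: measurable_cst.
Qed.

Lemma Mfun_fscale (a : R[i]) f : Mfun f -> Mfun (fscale a f).
Proof.
move=> Mf; apply: (@Mfun_fmul (fun=> XFin a)) => //; case: a => a b.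
by apply: (@Mfun_mkc (cst a) (cst b)); exact: measurable_cst.
Qed.

Lemma Mfun_comp (phi : T -> T) f : measurable_fun setT phi -> Mfun f ->
  Mfun (composition_operator phi f).
Proof.
move=> mphi [mf fr fi]; split.
- by rewrite -[X in measurable X]setTI; exact: (mphi measurableT _ mf).
- exact: measurableT_comp fr mphi.
- exact: measurableT_comp fi mphi.
Qed.

End ExtendedComplexFunctions.

(** * The norm of non-negative functions *)

Section NormOfModulus.
Context {R : realType} {d : measure_display} {T : measurableType d}.
Variable mu : {measure set T -> \bar R}.
Variable rho : (T -> xcomplex R) -> \bar R.
Implicit Types (f g : T -> xcomplex R) (u v w : T -> \bar R).

(** The norm of a function is determined by its modulus, and everything is
  deduced from its values on non-negative functions. *)
Definition fnorm u : \bar R := rho (embf u).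

Lemma embf_absf f : embf (absf f) = fmod f.
Proof. by apply/funext => x; rewrite /embf emb_xabs. Qed.

Lemma absf_fmul f g : absf (fmul f g) = (fun x => absf f x * absf g x).
Proof. by apply/funext => x; exact: xabsM. Qed.

Lemma absf_charfun E : absf (charfun E : T -> xcomplex R) = indic_fun E.
Proof.
apply/funext => x; rewrite /absf /charfun /indic_fun indicE.
by case: (x \in E); rewrite /xabs ?normc1 ?normc0.
Qed.

Section FunctionNorm.
Hypothesis Brho : banach_function_norm mu rho.

Lemma rho_fnorm f : Mfun f -> rho f = fnorm (absf f).
Proof. by move=> Mf; rewrite /fnorm embf_absf (bfn_mod Brho). Qed.

(** Fatou's lemma comes from monotone convergence, applied to the infima of the tails of the
  sequence. *)
Lemma fatou_norm_fnorm : fatou_norm mu fnorm.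
Proof.
have emb_le u v : nnmeas u -> nnmeas v -> {ae mu, forall x, u x <= v x} -> fnorm u <= fnorm v.
  move=> uP vP uv; apply: (bfn_P2 Brho); try exact: Mplus_embf.
  by apply: filterS uv => x; rewrite !xabs_emb ?uP.2 ?vP.2.
split => //.
- by move=> u uP; apply: (bfn_ge0 Brho); have [] := Mplus_embf uP.
- move=> a u a0 uP; have auP : nnmeas (fun x => a%:E * u x) by exact: nnmeasZ.
  have := bfn_P1_homogeneous Brho (a%:C)%C (Mplus_embf uP).
  have Mau : Mfun (fscale (a%:C)%C (embf u)) by apply: Mfun_fscale; have [] := Mplus_embf uP.
  have -> : normc (a%:C)%C = a by rewrite /= expr0n /= addr0 sqrtr_sqr ger0_norm.
  move=> <-; rewrite (rho_fnorm Mau); congr fnorm; apply/funext => x.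
  rewrite /absf /fscale xabs_scale xabs_emb ?uP.2//=.
  by rewrite expr0n /= addr0 sqrtr_sqr ger0_norm.
- move=> u v uP vP; have := bfn_P1_subadditive Brho (Mplus_embf uP) (Mplus_embf vP).
  apply: le_trans; rewrite le_eqVlt; apply/orP; left; apply/eqP.
  congr rho; apply/funext => x; rewrite /embf /fadd.
  have := uP.2 x; have := vP.2 x; case: (u x) => [a| |] //; case: (v x) => [b| |] //= _ _.
  by rewrite -rmorphD.
- move=> F u c FP uP Fu Fc.
  pose v n x := einfs (F ^~ x) n.
  have vP n : nnmeas (v n).
    split; first exact: (measurable_fun_einfs (fun k => (FP k).1)).
    by move=> x; apply: le_ereal_inf_tmp => _ [k _ <-]; exact: (FP k).2.
  have vF n x : v n x <= F n x by apply: ereal_inf_lbound; exists n => //=.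
  have vc n : fnorm (v n) <= c by apply: le_trans (Fc n); apply: emb_le => //; exact: aeT.
  have [_ h] : (forall n, rho (embf (v n)) <= rho (embf (v n.+1))) /\
      rho (embf (v n)) @[n --> \oo] --> rho (embf u).
    apply: (bfn_P3 Brho); [by move=> n; exact: Mplus_embf | exact: Mplus_embf|].
    apply: filterS Fu => x Fx; split.
      by move=> n; rewrite !xabs_emb ?(vP _).2//; exact: nondecreasing_einfs.
    rewrite xabs_emb ?uP.2//; apply: cvg_trans (cvg_einfs Fx).
    by apply: near_eq_cvg; apply: nearW => n; rewrite /= xabs_emb// (vP _).2.
  exact: cvge_le h vc.
Qed.

Lemma banach_norm_fnorm : banach_norm mu fnorm.
Proof.
split; first exact: fatou_norm_fnorm.
- move=> E mE Ef; have := bfn_P4 Brho mE Ef.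
  by rewrite (rho_fnorm (Mfun_charfun mE)) absf_charfun.
- move=> E mE Ef; have [C h] := bfn_P5 Brho mE Ef.
  have nE := nnmeas_indic mE.
  exists (`|C| + 1)%R; first by rewrite ltr_wpDl.
  move=> u uP; have := h _ (Mplus_embf uP); rewrite integral_mkcond.
  have -> : (fun x => xabs (embf u x)) \_ E = (fun x => u x * (\1_E x)%:E).
    apply/funext => x; rewrite patchE indicE xabs_emb ?uP.2//.
    by case: ifP; rewrite ?mule1 ?mule0.
  move=> /le_trans; apply; apply: lee_wpmul2r; first exact: (fn_ge0 fatou_norm_fnorm).
  by rewrite lee_fin (le_trans (ler_norm C))// lerDl.
Qed.

Lemma assoc_norm_fnorm f : assoc_norm mu rho f = assoc mu fnorm (absf f).
Proof.
apply/eqP; rewrite eq_le; apply/andP; split; apply: ge_ereal_sup => _ [g [gP Ng] <-].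
  apply: ereal_sup_ubound; exists (absf g); last first.
    by apply: eq_integral => x _; rewrite -(xabsM (f x) (g x)).
  by split; [exact: nnmeas_absf | rewrite -rho_fnorm].
have [Mg _] := Mplus_embf gP.
apply: ereal_sup_ubound; exists (embf g); first by split.
by apply: eq_integral => x _; rewrite /fmul xabsM -/(absf f x) -[in RHS](absf_embf gP).
Qed.

Lemma resonant_fnorm : resonant mu -> resonant_nn mu.
Proof.
move=> res u v uP vP; have [Mu _] := Mplus_embf uP; have [Mv _] := Mplus_embf vP.
have := res _ _ Mu Mv; rewrite /int_rearr_mul => h.
have -> : rdot mu u v = rdot mu (absf (embf u)) (absf (embf v)) by rewrite !absf_embf.
rewrite /rdot -h; congr ereal_sup; apply/seteqP; split => _ [w [wP wv] <-].
  have [Mw _] := Mplus_embf wP; exists (embf w).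
    split => // t t0; have := (eq_dist_rea mu wP vP).2 wv t t0.
    by rewrite -{1}(absf_embf wP) -{1}(absf_embf vP).
  apply: eq_integral => x _; rewrite /fmul xabsM.
  by rewrite -[in RHS](absf_embf uP) -[in RHS](absf_embf wP).
exists (absf w).
  split; first exact: nnmeas_absf.
  apply/(eq_dist_rea mu (nnmeas_absf wP) vP) => t t0.
  by rewrite -(absf_embf vP); exact: wv.
by apply: eq_integral => x _; rewrite /fmul xabsM -{1}(absf_embf uP).
Qed.

End FunctionNorm.

Lemma ri_dist_invariant : ri_norm mu rho -> dist_invariant mu fnorm.
Proof.
move=> [_ ri] u v uP vP uv; apply: ri.
- by have [] := Mplus_embf uP.
- by have [] := Mplus_embf vP.
move=> t t0; have := (eq_dist_rea mu uP vP).2 uv t t0.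
by rewrite -{1}(absf_embf uP) -{1}(absf_embf vP).
Qed.

Lemma ACR_vanishing : has_ACR mu rho -> forall u, nnmeas u -> fnorm u < +oo -> vanishing mu u.
Proof.
move=> acr u uP Nu s s0; have [Mu _] := Mplus_embf uP.
have h := acr (embf u) (conj Mu Nu).
have nb : nbhs (0 : \bar R) [set y | y < s%:E].
  by apply: open_nbhs_nbhs; split; [exact: open_ereal_lt_ereal | rewrite /= lte_fin].
have hn : \forall t \near +oo%R, rearr mu (embf u) t < s%:E := h _ nb.
have [t ts] := filter_ex hn.
have := rea_gt mu t uP (ltW s0); rewrite -{1}(absf_embf uP) => e.
apply: (@le_lt_trans _ _ t%:E); last exact: ltry.
by rewrite leNgt -e -leNgt ltW.
Qed.

Lemma has_acn_acn_nn f : banach_function_norm mu rho -> Mfun f -> has_acn mu rho f ->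
  acn_nn mu fnorm (absf f).
Proof.
move=> Brho Mf fa E mE E0; have := fa E mE E0.
apply: cvg_trans; apply: near_eq_cvg; apply: nearW => k /=.
rewrite (rho_fnorm Brho); last by apply: Mfun_fmul => //; exact: Mfun_charfun.
by rewrite absf_fmul absf_charfun.
Qed.

End NormOfModulus.

(** * Operators acting on real and imaginary parts *)

Section ComplexComponents.
Context {R : realType}.
Implicit Types z w : xcomplex R.

Lemma xadd_fin (a b c d : R) : xadd (XFin (Complex a b)) (XFin (Complex c d)) =
  XFin (Complex (a + c)%R (b + d)%R).
Proof. by []. Qed.

Lemma xscale_fin (k : R[i]) (a b : R) : xscale k (XFin (Complex a b)) =
  XFin (Complex (complex.Re k * a - complex.Im k * b)%R (complex.Re k * b + complex.Im k * a)%R).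
Proof. by case: k. Qed.

Lemma xsub_fin (a b c d : R) : xsub (XFin (Complex a b)) (XFin (Complex c d)) =
  XFin (Complex (a - c)%R (b - d)%R).
Proof.
rewrite /xsub xscale_fin xadd_fin /=; congr (XFin (Complex _ _)).
  by rewrite oppr0 mul0r subr0 mulN1r.
by rewrite oppr0 mul0r addr0 mulN1r.
Qed.

Lemma xabs_le_ReIm (a b : R) : xabs (XFin (Complex a b)) <= `|a|%:E + `|b|%:E.
Proof. by rewrite -EFinD lee_fin; exact: (normc_le_ReIm (Complex a b)). Qed.

Lemma xRe_le z : `|xRe z|%:E <= xabs z.
Proof. by case: z => [a|]; rewrite ?leey// lee_fin; exact: normc_ge_Re'. Qed.

Lemma xIm_le z : `|xIm z|%:E <= xabs z.
Proof. by case: z => [a|]; rewrite ?leey// lee_fin; exact: normc_ge_Im'. Qed.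

Lemma xfin_eta z : xabs z \is a fin_num -> z = XFin (Complex (xRe z) (xIm z)).
Proof. by case: z => [[a b]|]. Qed.

End ComplexComponents.

(** The norm of the space is only used through [N]: this covers both [X] and
  its associate space. *)
Section ModulusSpace.
Context {R : realType} {d : measure_display} {T : measurableType d}.
Variable mu : {measure set T -> \bar R}.
Variables (rho : (T -> xcomplex R) -> \bar R) (N : (T -> \bar R) -> \bar R).
Hypothesis NP : fatou_norm mu N.
Hypothesis rhoN : forall f, Mfun f -> rho f = N (absf f).
Hypothesis Nfin : forall u, nnmeas u -> N u < +oo -> {ae mu, forall x, u x \is a fin_num}.
Implicit Types (f g h : T -> xcomplex R) (a b : T -> R).

Local Notation X := (bfspace rho).

Lemma X_fin f : X f -> {ae mu, forall x, f x = mkc (re f) (im f) x}.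
Proof.
move=> [Mf Nf]; rewrite rhoN// in Nf.
by apply: filterS (Nfin (nnmeas_absf Mf) Nf) => x /xfin_eta.
Qed.

Lemma rspace_re f : X f -> rspace N (re f).
Proof.
move=> [Mf Nf]; split; first exact: Mfun_re.
rewrite rhoN// in Nf; apply: le_lt_trans Nf; apply: (fn_leT NP).
- by apply: nnmeas_abs; exact: Mfun_re.
- exact: nnmeas_absf.
- by move=> x; exact: xRe_le.
Qed.

Lemma rspace_im f : X f -> rspace N (im f).
Proof.
move=> [Mf Nf]; split; first exact: Mfun_im.
rewrite rhoN// in Nf; apply: le_lt_trans Nf; apply: (fn_leT NP).
- by apply: nnmeas_abs; exact: Mfun_im.
- exact: nnmeas_absf.
- by move=> x; exact: xIm_le.
Qed.

Lemma fatou_norm_mkc (q : (T -> \bar R) -> \bar R) a b : fatou_norm mu q ->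
  measurable_fun setT a -> measurable_fun setT b ->
  q (absf (mkc a b)) <= absnorm q a + absnorm q b.
Proof.
move=> qP ma mb; have maP := nnmeas_abs ma; have mbP := nnmeas_abs mb.
apply: le_trans (fn_D qP maP mbP); apply: (fn_leT qP).
- by apply: nnmeas_absf; exact: Mfun_mkc.
- exact: nnmeasD.
- by move=> x; exact: xabs_le_ReIm.
Qed.

Lemma fatou_norm_ae (q : (T -> \bar R) -> \bar R) f g : fatou_norm mu q -> Mfun f -> Mfun g ->
  eq_ae mu f g -> q (absf f) = q (absf g).
Proof.
move=> qP Mf Mg fg; apply/eqP; rewrite eq_le; apply/andP.
by split; apply: (fn_le qP); try exact: nnmeas_absf;
  apply: filterS fg => x; rewrite /absf => ->.
Qed.

Lemma X_mkc a b : rspace N a -> rspace N b -> X (mkc a b).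
Proof.
move=> [ma Na] [mb Nb]; have Mab := Mfun_mkc ma mb; split => //.
by rewrite rhoN//; apply: le_lt_trans (fatou_norm_mkc NP ma mb) _; rewrite lte_add_pinfty.
Qed.

Lemma X_fadd f g : X f -> X g -> X (fadd f g).
Proof.
move=> [Mf Nf] [Mg Ng]; have Mfg := Mfun_fadd Mf Mg; split => //.
rewrite !rhoN// in Nf Ng *; apply: (@le_lt_trans _ _ (N (absf f) + N (absf g))).
  apply: le_trans (fn_D NP (nnmeas_absf Mf) (nnmeas_absf Mg)); apply: (fn_leT NP).
  - exact: nnmeas_absf.
  - by apply: nnmeasD; exact: nnmeas_absf.
  - by move=> x; exact: xabsD.
by rewrite lte_add_pinfty.
Qed.

Lemma absf_fscale (k : R[i]) f : absf (fscale k f) = (fun x => (normc k)%:E * absf f x).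
Proof. by apply/funext => x; exact: xabs_scale. Qed.

Lemma X_fscale (k : R[i]) f : X f -> X (fscale k f).
Proof.
move=> [Mf Nf]; have Mkf := Mfun_fscale k Mf; split => //.
rewrite !rhoN// in Nf *; rewrite absf_fscale (fn_Z NP) ?normc_ge0//; last exact: nnmeas_absf.
by rewrite lte_mul_pinfty ?lee_fin ?normc_ge0// (fn_ge0 NP)//; exact: nnmeas_absf.
Qed.

Lemma X_fsub f g : X f -> X g -> X (fsub f g).
Proof. by move=> Xf Xg; apply: X_fadd => //; exact: X_fscale. Qed.

Lemma X_fzero : X (fzero : T -> xcomplex R).
Proof.
have Mz : Mfun (fzero : T -> xcomplex R) by apply: (@Mfun_mkc _ _ _ (cst 0%R) (cst 0%R)).
split => //; rewrite rhoN// (_ : absf fzero = cst 0); first by rewrite (fn0 NP).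
by apply/funext => x; exact: xabs_zero.
Qed.

Lemma ae_re f g : eq_ae mu f g -> {ae mu, forall x, re f x = re g x}.
Proof. by apply: filterS => x; rewrite /re => ->. Qed.

Lemma ae_im f g : eq_ae mu f g -> {ae mu, forall x, im f x = im g x}.
Proof. by apply: filterS => x; rewrite /im => ->. Qed.

Lemma lin_fin (k : R[i]) f g : X f -> X g -> eq_ae mu (fadd (fscale k f) g)
  (mkc (fun x => complex.Re k * re f x - complex.Im k * im f x + re g x)%R
       (fun x => complex.Re k * im f x + complex.Im k * re f x + im g x)%R).
Proof.
move=> Xf Xg; apply: filterS2 (X_fin Xf) (X_fin Xg) => x fx gx.
by rewrite /fadd /fscale fx gx [X in xscale _ X]/mkc xscale_fin xadd_fin.
Qed.

Lemma sub_fin f g : X f -> X g ->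
  eq_ae mu (fsub f g) (mkc (fun x => re f x - re g x)%R (fun x => im f x - im g x)%R).
Proof.
move=> Xf Xg; apply: filterS2 (X_fin Xf) (X_fin Xg) => x fx gx.
by rewrite /fsub fx gx /mkc xsub_fin.
Qed.

Section Componentwise.
Variables (L : (T -> R) -> (T -> R)) (K : R).
Hypothesis LX : forall a, rspace N a -> rspace N (L a).
Hypothesis Llin : forall (s t : R) a b, rspace N a -> rspace N b ->
  {ae mu, forall x, L (fun x => s * a x + t * b x)%R x = (s * L a x + t * L b x)%R}.
Hypothesis Lae : forall a b, rspace N a -> rspace N b -> {ae mu, forall x, a x = b x} ->
  {ae mu, forall x, L a x = L b x}.
Hypothesis K0 : (0 <= K)%R.
Hypothesis Lle : forall a, rspace N a -> absnorm N (L a) <= K%:E * absnorm N a.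
Hypothesis rlin : forall (s t : R) a b, rspace N a -> rspace N b ->
  rspace N (fun x => s * a x + t * b x)%R.

Definition cplx f : T -> xcomplex R := mkc (L (re f)) (L (im f)).

Lemma X_cplx f : X f -> X (cplx f).
Proof. by move=> Xf; apply: X_mkc; apply: LX; [exact: rspace_re | exact: rspace_im]. Qed.

Lemma eq_ae_mkc a b a' b' : {ae mu, forall x, a x = a' x} -> {ae mu, forall x, b x = b' x} ->
  eq_ae mu (mkc a b) (mkc a' b').
Proof. by apply: filterS2 => x; rewrite /mkc => -> ->. Qed.

(** A real-linear operator on real functions extends to a complex-linear one, acting on real and
  imaginary parts. *)
Lemma linear_cplx : linear_operator mu X cplx.
Proof.
split; first exact: X_cplx.
  move=> f g Xf Xg fg; apply: eq_ae_mkc; apply: Lae; try exact: rspace_re; try exact: rspace_im.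
    exact: ae_re.
  exact: ae_im.
move=> k f g Xf Xg; have rf := rspace_re Xf; have ri := rspace_im Xf.
have gf := rspace_re Xg; have gi := rspace_im Xg.
have E := lin_fin k Xf Xg; have Xk := X_fadd (X_fscale k Xf) Xg.
have L3 (s t : R) a b c : rspace N a -> rspace N b -> rspace N c ->
    {ae mu, forall x, L (fun x => s * a x + t * b x + c x)%R x = (s * L a x + t * L b x + L c x)%R}.
  move=> aX bX cX; have abX := rlin s t aX bX.
  have := Llin 1 1 abX cX; rewrite (_ : (fun x => 1 * _ + _)%R =
    (fun x => s * a x + t * b x + c x)%R); last by apply/funext => x; rewrite !mul1r.
  by apply: filterS2 (Llin s t aX bX) => x h ->; rewrite h !mul1r.
have Er := L3 (complex.Re k) (- complex.Im k)%R _ _ _ rf ri gf.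
have Ei := L3 (complex.Re k) (complex.Im k) _ _ _ ri rf gi.
have r3 (s t : R) a b c : rspace N a -> rspace N b -> rspace N c ->
    rspace N (fun x => s * a x + t * b x + c x)%R.
  move=> aX bX cX; rewrite (_ : (fun x => _) =
    (fun x => 1 * (s * a x + t * b x) + 1 * c x)%R); last by apply/funext => x; rewrite !mul1r.
  by apply: (rlin 1 1 _ cX); exact: rlin.
have Ar : {ae mu, forall x, L (re (fadd (fscale k f) g)) x =
    L (fun x => complex.Re k * re f x + - complex.Im k * im f x + re g x)%R x}.
  apply: Lae; [exact: rspace_re | exact: r3 |].
  by apply: filterS (ae_re E) => x ->; rewrite /re /mkc/= mulNr.
have Ai : {ae mu, forall x, L (im (fadd (fscale k f) g)) x =
    L (fun x => complex.Re k * im f x + complex.Im k * re f x + im g x)%R x}.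
  apply: Lae; [exact: rspace_im | exact: r3 |].
  by apply: filterS (ae_im E) => x ->.
have Fr : {ae mu, forall x, L (re (fadd (fscale k f) g)) x =
    (complex.Re k * L (re f) x - complex.Im k * L (im f) x + L (re g) x)%R}.
  by apply: filterS2 Er Ar => x h ->; rewrite h mulNr.
have Fi : {ae mu, forall x, L (im (fadd (fscale k f) g)) x =
    (complex.Re k * L (im f) x + complex.Im k * L (re f) x + L (im g) x)%R}.
  by apply: filterS2 Ei Ai => x h ->; rewrite h.
apply: filterS2 Fr Fi => x h1 h2.
by rewrite /fadd /fscale /cplx /mkc xscale_fin xadd_fin h1 h2.
Qed.

(** The factor [2] comes from estimating the modulus by the sum of the moduli of the two
  parts. *)
Lemma cplx_le f : X f -> rho (cplx f) <= (2 * K)%:E * rho f.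
Proof.
move=> Xf; have [Mf Nf] := Xf; have rf := rspace_re Xf; have ri := rspace_im Xf.
have [mr _] := LX rf; have [mi _] := LX ri.
rewrite !rhoN//; last exact: (X_cplx Xf).1.
apply: le_trans (fatou_norm_mkc NP mr mi) _.
have fP := nnmeas_absf Mf; have N0 := fn_ge0 NP fP.
have le_comp a : rspace N a -> (forall x, `|a x|%:E <= absf f x) ->
    absnorm N (L a) <= K%:E * N (absf f).
  move=> aX af; apply: le_trans (Lle aX) _; apply: lee_wpmul2l; first by rewrite lee_fin.
  by apply: (fn_leT NP) => //; apply: nnmeas_abs; exact: aX.1.
rewrite mulr_natl mulr2n EFinD ge0_muleDl ?lee_fin//.
by apply: leeD; apply: le_comp => // x; [exact: xRe_le | exact: xIm_le].
Qed.

End Componentwise.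

End ModulusSpace.

(** * Topologies given by seminorms *)

Section SeminormTopology.
Context {R : realType} {d : measure_display} {T : measurableType d}.
Implicit Types (f g h : T -> xcomplex R) (X : set (T -> xcomplex R)).
Implicit Types S : set ((T -> xcomplex R) -> \bar R).

Lemma lc_cvgI X S (u : nat -> T -> xcomplex R) f : (forall n, X (u n)) ->
  (forall p, S p -> p (fsub (u n) f) @[n --> \oo] --> 0) -> lc_cvg X S u f.
Proof.
move=> uX up U [k [p [e [pS e0 h]]]].
have : \forall n \near \oo, forall j : 'I_k, p j (fsub (u n) f) < e%:E.
  by apply: filter_forall => j; apply: (cvge_near_lt (up _ (pS j))); rewrite lte_fin.
by apply: filterS => n; exact: h.
Qed.

(** [lc_coarser X S1 S2] is the usual comparison of families of seminorms, one
  seminorm of [S2] being enough to bound one of [S1]. *)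
Definition lc_coarser X S1 S2 := forall p, S1 p -> exists q (C : R), [/\ S2 q, (0 <= C)%R,
  forall h, X h -> 0 <= q h & forall h, X h -> p h <= C%:E * q h].

Lemma lc_nbhs_coarser X S1 S2 f U : lc_coarser X S1 S2 ->
  (forall g, X g -> X (fsub g f)) -> lc_nbhs X S1 f U -> lc_nbhs X S2 f U.
Proof.
move=> S12 Xf [k [p [e [pS e0 h]]]].
have /choice [qC qCP] : forall j : 'I_k, exists qC : ((T -> xcomplex R) -> \bar R) * R,
    [/\ S2 qC.1, (0 <= qC.2)%R, forall h, X h -> 0 <= qC.1 h &
      forall h, X h -> p j h <= qC.2%:E * qC.1 h].
  by move=> j; have [q [C qP]] := S12 _ (pS j); exists (q, C).
pose M := (1 + \sum_j (qC j).2)%R.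
have s0 : (0 <= \sum_j (qC j).2)%R by apply: sumr_ge0 => j _; have [] := qCP j.
have M0 : (0 < M)%R by rewrite ltr_pwDl.
exists k, (fun j => (qC j).1), (e / M)%R; split.
- by move=> j; have [] := qCP j.
- by rewrite divr_gt0.
move=> g gX gq; apply: h => // j; have [_ C0 q0 pq] := qCP j.
have gf := Xf g gX; apply: le_lt_trans (pq _ gf) _.
apply: (@le_lt_trans _ _ (M%:E * (qC j).1 (fsub g f))).
  apply: lee_wpmul2r; first exact: q0.
  rewrite lee_fin /M (bigD1 j)//= addrCA lerDl addr_ge0//; apply: sumr_ge0 => i _.
  by have [] := qCP i.
by rewrite muleC -lte_pdivlMr.
Qed.

Lemma lc_weaker_coarser X S1 S2 : (forall f g, X f -> X g -> X (fsub g f)) ->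
  lc_coarser X S1 S2 -> lc_weaker X S1 S2.
Proof.
move=> Xs S12 U [UX Uo]; split => // f Uf.
by apply: (lc_nbhs_coarser S12); [move=> g Xg; apply: Xs => //; exact: UX | exact: Uo].
Qed.

Lemma lc_closure_coarser X S1 S2 B : (forall f g, X f -> X g -> X (fsub g f)) ->
  lc_coarser X S1 S2 -> lc_closure X S2 B `<=` lc_closure X S1 B.
Proof.
move=> Xs S12 f [Xf fB]; split => // U nU; apply: fB.
by apply: (lc_nbhs_coarser S12) nU => g Xg; exact: Xs.
Qed.

End SeminormTopology.

Section BoundedOperators.
Context {R : realType} {d : measure_display} {T : measurableType d}.
Variable mu : {measure set T -> \bar R}.
Variables (rho : (T -> xcomplex R) -> \bar R) (N : (T -> \bar R) -> \bar R).
Hypothesis NP : fatou_norm mu N.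
Hypothesis rhoN : forall f, Mfun f -> rho f = N (absf f).
Implicit Types (f g h : T -> xcomplex R).

Local Notation X := (bfspace rho).

Lemma xaddC : commutative (@xadd R).
Proof. by case=> [a|] [b|] //=; rewrite addrC. Qed.

Lemma linear_operator_sub P f g : linear_operator mu X P -> X f -> X g ->
  eq_ae mu (P (fsub g f)) (fsub (P g) (P f)).
Proof.
move=> [_ _ Pl] Xf Xg; have := Pl (-1)%R f g Xf Xg.
rewrite /eq_ae (_ : fadd (fscale _ f) g = fsub g f); last first.
  by apply/funext => x; rewrite /fadd xaddC.
by apply: filterS => x ->; rewrite /fadd xaddC.
Qed.

Lemma rho_ae f g : Mfun f -> Mfun g -> eq_ae mu f g -> rho f = rho g.
Proof. by move=> Mf Mg fg; rewrite !rhoN//; exact: (fatou_norm_ae NP). Qed.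

Lemma bounded_continuous P (C : R) : linear_operator mu X P -> (0 <= C)%R ->
  (forall f, X f -> rho (P f) <= C%:E * rho f) -> continuous_operator mu rho P.
Proof.
move=> Pl C0 Pb; split => // f Xf U [k [p [e [pS e0 h]]]]; have [PX _ _] := Pl.
have C1 : (0 < C + 1)%R by rewrite ltr_wpDl.
exists k, p, (e / (C + 1))%R; split => //; first by rewrite divr_gt0.
move=> g Xg gp; apply: h; first exact: PX.
move=> j; have := gp j; rewrite (pS j : p j = rho) => gr.
have Xgf := X_fsub NP rhoN Xg Xf.
rewrite -(rho_ae _ _ (linear_operator_sub Pl Xf Xg)); last 2 first.
- by have [] := PX _ Xgf.
- by have [] := X_fsub NP rhoN (PX _ Xg) (PX _ Xf).
have r0 : 0 <= rho (fsub g f).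
  by rewrite rhoN ?(fn_ge0 NP)//; [exact: nnmeas_absf Xgf.1 | exact: Xgf.1].
apply: le_lt_trans (Pb _ Xgf) _; apply: (@le_lt_trans _ _ ((C + 1)%:E * rho (fsub g f))).
  by apply: lee_wpmul2r => //; rewrite lee_fin lerDl.
by rewrite muleC -lte_pdivlMr.
Qed.

End BoundedOperators.

(** * The composition operator and its averages *)

Section Cesaro.
Context {R : realType} {d : measure_display} {T : measurableType d}.
Variable mu : {measure set T -> \bar R}.
Variables (phi : T -> T) (A : R).
Hypothesis mphi : measurable_fun setT phi.
Hypothesis A1 : (1 <= A)%R.
Hypothesis phiA : forall n (E : set T), measurable E ->
  mu (iter n phi @^-1` E) <= A%:E * mu E.
Implicit Types (f g : T -> xcomplex R) (a b : T -> R).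

Local Notation Tphi := (composition_operator phi).

(** Preimages of null sets under the iterates of [phi] are null sets. *)
Lemma ae_iter (P : T -> Prop) : {ae mu, forall x, P x} ->
  {ae mu, forall x, forall n, P (iter n phi x)}.
Proof.
move=> [E [mE E0 PE]]; apply: ae_foralln => n.
have mi : measurable (iter n phi @^-1` E).
  by have := measurable_iter mphi n measurableT mE; rewrite setTI.
exists (iter n phi @^-1` E); split => //; last by move=> x h; exact: PE.
by apply/eqP; rewrite eq_le measure_ge0 andbT; apply: le_trans (phiA n mE) _; rewrite E0 mule0.
Qed.

Lemma ae_comp (P : T -> Prop) : {ae mu, forall x, P x} -> {ae mu, forall x, P (phi x)}.
Proof. by move=> /ae_iter; apply: filterS => x /(_ 1%N). Qed.

Lemma iter_composition n f x : iter n Tphi f x = f (iter n phi x).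
Proof.
elim: n x => [//|n IH] x; rewrite [in LHS]iterS /composition_operator.
by rewrite [LHS]IH iterSr.
Qed.

Lemma sum_mkc (I : Type) (r : seq I) (a b : I -> R) :
  \big[xadd/xzero]_(i <- r) XFin (Complex (a i) (b i)) =
  XFin (Complex (\sum_(i <- r) a i)%R (\sum_(i <- r) b i)%R).
Proof.
elim: r => [|i r IH]; first by rewrite !big_nil.
by rewrite !big_cons IH xadd_fin.
Qed.

Lemma invn_complex n : (n%:R^-1 = Complex n%:R^-1 0 :> R[i])%R.
Proof. by rewrite -[RHS]/((n%:R^-1)%:C)%C fmorphV rmorph_nat. Qed.

(** For almost every point, [f] is finite along the whole orbit of the point. *)
Lemma cesaro_mean_fin f n : {ae mu, forall x, f x = mkc (re f) (im f) x} ->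
  eq_ae mu (cesaro_mean Tphi f n) (mkc (avgR phi n (re f)) (avgR phi n (im f))).
Proof.
move=> ff; apply: filterS (ae_iter ff) => x fx.
rewrite /cesaro_mean (eq_bigr (fun i : 'I_n =>
  XFin (Complex (re f (iter i phi x)) (im f (iter i phi x))))); last first.
  by move=> i _; rewrite iter_composition fx.
rewrite sum_mkc invn_complex xscale_fin /= /mkc /avgR.
by rewrite !mul0r subr0 addr0.
Qed.

Lemma Mfun_sum (I : Type) (r : seq I) (F : I -> T -> xcomplex R) : (forall i, Mfun (F i)) ->
  Mfun (fun x => \big[xadd/xzero]_(i <- r) F i x).
Proof.
move=> MF; elim: r => [|i r IH].
  rewrite (_ : (fun x => _) = fun=> xzero); last by apply/funext => x; rewrite big_nil.
  by apply: (@Mfun_mkc _ _ _ (cst 0%R) (cst 0%R)); exact: measurable_cst.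
rewrite (_ : (fun x => _) = fadd (F i) (fun x => \big[xadd/xzero]_(j <- r) F j x)).
  exact: Mfun_fadd.
by apply/funext => x; rewrite big_cons.
Qed.

Lemma Mfun_cesaro f n : Mfun f -> Mfun (cesaro_mean Tphi f n).
Proof.
move=> Mf; apply: Mfun_fscale; apply: Mfun_sum => i.
elim: (i : nat) => [|k IH] //=; exact: (Mfun_comp mphi).
Qed.

Section Space.
Variables (rho : (T -> xcomplex R) -> \bar R) (N : (T -> \bar R) -> \bar R).
Hypothesis NP : fatou_norm mu N.
Hypothesis rhoN : forall f, Mfun f -> rho f = N (absf f).
Hypothesis Nfin : forall u, nnmeas u -> N u < +oo -> {ae mu, forall x, u x \is a fin_num}.
Hypothesis NA : phi_bounded phi A N.

Local Notation X := (bfspace rho).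

Lemma X_ae f g : Mfun f -> X g -> eq_ae mu f g -> X f.
Proof.
by move=> Mf [Mg Ng] fg; split => //; rewrite (rho_ae NP rhoN Mf Mg fg).
Qed.

Lemma rspace_avgR n a : rspace N a -> rspace N (avgR phi n a).
Proof.
move=> [ma Na]; split; first exact: measurable_avgR.
apply: le_lt_trans (absnorm_avg mphi A1 NP NA n ma) _.
by rewrite lte_mul_pinfty ?lee_fin ?(le_trans ler01)// (absnorm_ge0 NP).
Qed.

Lemma X_cesaro n f : X f -> X (cesaro_mean Tphi f n).
Proof.
move=> Xf; apply: X_ae (cesaro_mean_fin n (X_fin rhoN Nfin Xf)).
  by apply: Mfun_cesaro; exact: Xf.1.
by apply: (X_mkc NP rhoN); apply: rspace_avgR;
  [exact: (rspace_re NP rhoN) | exact: (rspace_im NP rhoN)].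
Qed.

Lemma X_composition f : X f -> X (Tphi f).
Proof.
move=> [Mf Nf]; have Mc := Mfun_comp mphi Mf; split => //.
rewrite !rhoN// in Nf *; apply: le_lt_trans (NA 1%N (nnmeas_absf Mf)) _.
rewrite lte_mul_pinfty ?lee_fin ?(le_trans ler01)// (fn_ge0 NP)//; exact: nnmeas_absf.
Qed.

Lemma linear_composition : linear_operator mu X Tphi.
Proof.
split; first exact: X_composition.
- by move=> f g _ _; exact: ae_comp.
- by move=> k f g _ _; apply: aeT => x.
Qed.

Lemma continuous_composition : continuous_operator mu rho Tphi.
Proof.
apply: (bounded_continuous NP rhoN (C := A) linear_composition).
  exact: le_trans A1.
move=> f [Mf _]; rewrite !rhoN//; last exact: Mfun_comp.
exact: (NA 1%N (nnmeas_absf Mf)).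
Qed.

(** Telescoping shows that [a - a o phi^i] is of the form [b - b o phi], and the difference between
  [a] and its averages is an average of such functions. *)
Lemma coboundary_avg n a : (0 < n)%N -> rspace N a -> exists2 b, rspace N b &
  forall x, (a x - avgR phi n a x = b x - b (phi x))%R.
Proof.
move=> n0 aX.
pose cob c := exists2 b, rspace N b & forall x, (c x = b x - b (phi x))%R.
have rlin (s : R) b c : rspace N b -> rspace N c -> rspace N (fun x => s * b x + c x)%R.
  move=> [mb Nb] [mc Nc]; have msb : measurable_fun setT (fun x => s * b x)%R by exact: measurable_funM.
  split; first exact: measurable_funD.
  apply: le_lt_trans (absnormD NP msb mc) _; rewrite (absnormZ NP)//.
  by rewrite lte_add_pinfty// lte_mul_pinfty ?lee_fin// (absnorm_ge0 NP).
have coblin (s : R) b c : cob b -> cob c -> cob (fun x => s * b x + c x)%R.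
  move=> [b' b'X bE] [c' c'X cE]; exists (fun x => s * b' x + c' x)%R; first exact: rlin.
  by move=> x; rewrite bE cE; ring.
have cob0 : cob (fun=> 0%R).
  exists (fun=> 0%R); last by move=> x; rewrite subrr.
  split; first exact: measurable_cst.
  by rewrite (absnorm_ae0 NP)//; exact: aeT.
have ai i : rspace N (fun x => a (iter i phi x)).
  have [ma Na] := aX; split; first exact: (measurableT_comp ma (measurable_iter mphi i)).
  apply: le_lt_trans (NA i (nnmeas_abs ma)) _.
  by rewrite lte_mul_pinfty ?lee_fin ?(le_trans ler01)// (absnorm_ge0 NP).
have cobi i : cob (fun x => a x - a (iter i phi x))%R.
  elim: i => [|i IH].
    by rewrite (_ : (fun x => _) = fun=> 0%R)//; apply/funext => x; rewrite subrr.
  rewrite (_ : (fun x => _) = (fun x => 1 * (a x - a (iter i phi x)) +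
      (a (iter i phi x) - a (iter i.+1 phi x)))%R).
    apply: coblin => //; exists (fun x => a (iter i phi x)) => // x.
    by rewrite iterSr.
  by apply/funext => x; ring.
have cobs m : cob (fun x => \sum_(i < m) (a x - a (iter i phi x)))%R.
  elim: m => [|m IH].
    by rewrite (_ : (fun x => _) = fun=> 0%R)//; apply/funext => x; rewrite big_ord0.
  rewrite (_ : (fun x => _) = (fun x => 1 * (a x - a (iter m phi x)) +
      \sum_(i < m) (a x - a (iter i phi x)))%R); first exact: coblin.
  by apply/funext => x; rewrite big_ord_recr /= mul1r addrC.
have [b bX bE] := coblin n%:R^-1%R _ _ (cobs n) cob0.
exists b => // x; rewrite -bE addr0 sumrB mulrBr; congr (_ - _)%R.
by rewrite sumr_const card_ord -(mulr_natl (a x)) mulrA mulVf ?mul1r// pnatr_eq0 -lt0n.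
Qed.

Lemma sub_cesaro_im n f : (0 < n)%N -> X f ->
  op_im mu X (id_sub Tphi) (fsub f (cesaro_mean Tphi f n)).
Proof.
move=> n0 Xf; have Xc := X_cesaro n Xf.
have [b bX bE] := coboundary_avg n0 (rspace_re NP rhoN Xf).
have [c cX cE] := coboundary_avg n0 (rspace_im NP rhoN Xf).
split; first exact: (X_fsub NP rhoN).
exists (mkc b c); first exact: (X_mkc NP rhoN).
apply: filterS2 (X_fin rhoN Nfin Xf) (cesaro_mean_fin n (X_fin rhoN Nfin Xf)) => x fx cx.
by rewrite /fsub cx fx /id_sub /fsub /composition_operator /mkc !xsub_fin bE cE.
Qed.

End Space.

End Cesaro.

(** * Pairings and the topology [xi] *)

Section Pairing.
Context {R : realType} {d : measure_display} {T : measurableType d}.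
Variable mu : {measure set T -> \bar R}.
Variable rho : (T -> xcomplex R) -> \bar R.
Hypothesis sf : sigma_finite setT mu.
Hypothesis res : resonant mu.
Hypothesis ri : ri_norm mu rho.
Implicit Types (f g h : T -> xcomplex R) (a b : T -> R).

Let N := fnorm rho.
Let N' := assoc mu N.
Let rho' := assoc_norm mu rho.
Let X := bfspace rho.
Let X' := bfspace rho'.

Let resN : resonant_nn mu := resonant_fnorm res.
Let BN : banach_norm mu N := banach_norm_fnorm ri.1.
Let inv : dist_invariant mu N := ri_dist_invariant ri.
Let NP := bn_fatou BN.
Let BN' : banach_norm mu N' := banach_norm_assoc BN.
Let NP' := bn_fatou BN'.

Let rhoN f : Mfun f -> rho f = N (absf f). Proof. exact: (rho_fnorm ri.1). Qed.
Let rhoN' f : Mfun f -> rho' f = N' (absf f). Proof. by move=> _; exact: (assoc_norm_fnorm ri.1). Qed.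
Let Nfin u : nnmeas u -> N u < +oo -> {ae mu, forall x, u x \is a fin_num}.
Proof. exact: (norm_lty_ae sf resN BN inv). Qed.
Let Nfin' u : nnmeas u -> N' u < +oo -> {ae mu, forall x, u x \is a fin_num}.
Proof. exact: (assoc_lty_ae sf resN BN inv). Qed.

Lemma rdot_le_mul u v : nnmeas u -> nnmeas v -> N u < +oo -> N' v < +oo ->
  rdot mu u v <= N u * N' v.
Proof.
move=> uP vP Nu Nv; have Nu0 := fn_ge0 NP uP; have Nv0 := fn_ge0 NP' vP.
have [uf vf] : N u \is a fin_num /\ N' v \is a fin_num by rewrite !ge0_fin_numE.
rewrite -(fineK uf) -(fineK vf) -EFinM; apply/lee_addgt0Pr => e e0.
have a0 : (0 <= fine (N u))%R by exact: fine_ge0.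
have b0 : (0 <= fine (N' v))%R by exact: fine_ge0.
have b1 : (0 < fine (N' v) + 1)%R by rewrite ltr_wpDl.
pose k := (fine (N u) + e / (fine (N' v) + 1))%R.
have k0 : (0 < k)%R by rewrite ltr_wpDl// divr_gt0.
apply: le_trans (rdot_le resN BN inv uP vP k0 _) _.
  by rewrite -(fineK uf) lee_fin lerDl divr_ge0// ltW.
rewrite -/N' -(fineK vf) -EFinM -EFinD lee_fin mulrDl lerD2l.
by rewrite mulrAC ler_pdivrMr// ler_wpM2l ?lerDl// ltW.
Qed.

Lemma xi_family_rdot p : xi_family mu rho p -> exists2 v, nnmeas v /\ N' v < +oo &
  forall f, p f = rdot mu (absf f) v.
Proof.
move=> [g [Mg Ng] <-]; rewrite -/rho' rhoN'// in Ng; exists (absf g).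
  by split => //; exact: nnmeas_absf.
by move=> f; rewrite rdotC.
Qed.

Lemma xi_family_embf v : nnmeas v -> N' v < +oo ->
  xi_family mu rho (int_rearr_mul mu (embf v)).
Proof.
move=> vP Nv; have [Mv _] := Mplus_embf vP; exists (embf v) => //; split => //.
by rewrite -/rho' rhoN'// absf_embf.
Qed.

Lemma rdot_absf_lty f v : X f -> nnmeas v -> N' v < +oo -> rdot mu (absf f) v < +oo.
Proof.
move=> [Mf Nf] vP Nv; rewrite rhoN// in Nf.
exact: (rdot_lty resN BN inv (nnmeas_absf Mf) vP Nf Nv).
Qed.

Lemma xi_seminorm p : xi_family mu rho p -> seminorm_on X p.
Proof.
move=> /xi_family_rdot[v [vP Nv] pE]; have pP := fatou_norm_rdot resN vP; split.
- move=> f fX; rewrite pE rdot_absf_lty// andbT.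
  by apply: (fn_ge0 pP); exact: nnmeas_absf fX.1.
- move=> k f [Mf _]; rewrite !pE absf_fscale.
  by apply: (fn_Z pP); [exact: normc_ge0 | exact: nnmeas_absf].
- move=> f g [Mf _] [Mg _]; rewrite !pE.
  have fP := nnmeas_absf Mf; have gP := nnmeas_absf Mg.
  apply: le_trans (fn_D pP fP gP); apply: (fn_leT pP).
  + by apply: nnmeas_absf; exact: Mfun_fadd.
  + exact: nnmeasD.
  + by move=> x; exact: xabsD.
Qed.

Lemma X_sub f g : X f -> X g -> X (fsub g f).
Proof. by move=> fX gX; exact: (X_fsub NP rhoN). Qed.

Lemma xi_coarser_norm : lc_coarser X (xi_family mu rho) (norm_family rho).
Proof.
move=> p /xi_family_rdot[v [vP Nv] pE]; exists rho, (fine (N' v)).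
have v0 := fn_ge0 NP' vP; split => //; first exact: fine_ge0.
  by move=> h [Mh _]; rewrite rhoN// (fn_ge0 NP)//; exact: nnmeas_absf.
move=> h [Mh Nh]; rewrite pE rhoN// in Nh *; rewrite fineK ?ge0_fin_numE// muleC.
exact: (rdot_le_mul (nnmeas_absf Mh) vP Nh Nv).
Qed.

Lemma le_Rintegral_abs (a : T -> R) u : measurable_fun setT a -> nnmeas u ->
  (forall x, `|a x|%:E <= u x) -> (`|\int[mu]_x a x|%R)%:E <= \int[mu]_x u x.
Proof.
move=> ma uP au.
have fle (x : \bar R) : (`|fine x|%R)%:E <= `|x| by case: x => [r| |] //=; rewrite normr0 leey.
have ma' : measurable_fun setT (EFin \o a) by exact/measurable_EFinP.
apply: le_trans (fle _) _; apply: le_trans (le_abse_integral mu measurableT ma') _.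
apply: ge0_le_integral => //.
- exact: measurableT_comp.
- exact: uP.1.
- by move=> x _; exact: au.
Qed.

Lemma weak_coarser_xi : lc_coarser X (weak_family mu rho) (xi_family mu rho).
Proof.
move=> _ [g [Mg Ng] <-]; rewrite -/rho' rhoN'// in Ng.
exists (int_rearr_mul mu g), 2%R; split => //.
- by exists g => //; split => //; rewrite -/rho' rhoN'.
- by move=> h _; exact: (rdot_ge0 mu (absf g) (absf h)).
move=> h [Mh _]; have Mgh := Mfun_fmul Mg Mh; have ghP := nnmeas_absf Mgh.
apply: le_trans (_ : _ <= `|\int[mu]_x re (fmul g h) x|%R%:E + `|\int[mu]_x im (fmul g h) x|%R%:E) _.
  exact: (normc_le_ReIm (cintegral mu (fmul g h))).
have I : \int[mu]_x absf (fmul g h) x <= int_rearr_mul mu g h.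
  rewrite absf_fmul; exact: (integral_le_rdot resN (nnmeas_absf Mg) (nnmeas_absf Mh)).
rewrite mule_natl mule2n; apply: leeD; apply: le_trans I.
  by apply: le_Rintegral_abs => //; [exact: Mfun_re | move=> x; exact: xRe_le].
by apply: le_Rintegral_abs => //; [exact: Mfun_im | move=> x; exact: xIm_le].
Qed.

Let rX f : X f -> rspace N (re f) /\ rspace N (im f).
Proof. by move=> fX; split; [exact: (rspace_re NP rhoN) | exact: (rspace_im NP rhoN)]. Qed.

Let rX' f : X' f -> rspace N' (re f) /\ rspace N' (im f).
Proof. by move=> fX; split; [exact: (rspace_re NP' rhoN') | exact: (rspace_im NP' rhoN')]. Qed.

Lemma cintegral_fmul f g : X f -> X' g -> cintegral mu (fmul f g) =
  Complex (\int[mu]_x (re f x * re g x) - \int[mu]_x (im f x * im g x))%R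
          (\int[mu]_x (re f x * im g x) + \int[mu]_x (im f x * re g x))%R.
Proof.
move=> fX gX; have [fr fi] := rX fX; have [gr gi] := rX' gX.
have ip := integrable_pairing resN BN inv.
have Mfg := Mfun_fmul fX.1 gX.1.
have E : {ae mu, forall x, fmul f g x = mkc (fun x => 1 * (re f x * re g x) + (-1) * (im f x * im g x))%R
   (fun x => 1 * (re f x * im g x) + 1 * (im f x * re g x))%R x}.
  apply: filterS2 (X_fin rhoN Nfin fX) (X_fin rhoN' Nfin' gX) => x fx gx.
  rewrite /fmul fx gx /mkc /xmul; congr (XFin _); rewrite /=.
  by rewrite !mul1r mulN1r.
rewrite /cintegral; congr Complex.
  transitivity (\int[mu]_x (1 * (re f x * re g x) + (-1) * (im f x * im g x)))%R; last first.
    by rewrite (Rintegral_lin 1 (-1) (ip _ _ fr gr) (ip _ _ fi gi)) mul1r mulN1r.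
  congr fine; apply: ae_eq_integral => //.
  - by apply/measurable_EFinP; exact: (Mfun_re Mfg).
  - by have /integrableP[] := integrable_lin 1 (-1) (ip _ _ fr gr) (ip _ _ fi gi).
  - by apply: filterS E => x -> _.
transitivity (\int[mu]_x (1 * (re f x * im g x) + 1 * (im f x * re g x)))%R; last first.
  by rewrite (Rintegral_lin 1 1 (ip _ _ fr gi) (ip _ _ fi gr)) !mul1r.
congr fine; apply: ae_eq_integral => //.
- by apply/measurable_EFinP; exact: (Mfun_im Mfg).
- by have /integrableP[] := integrable_lin 1 1 (ip _ _ fr gi) (ip _ _ fi gr).
- by apply: filterS E => x -> _.
Qed.

End Pairing.

(** * The mean ergodic projection *)

Lemma cvge0_le {R : realType} (u : nat -> \bar R) : (forall n, 0 <= u n) ->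
  (forall e : R, (0 < e)%R -> exists n0, forall n, (n0 <= n)%N -> u n <= e%:E) ->
  u n @[n --> \oo] --> 0.
Proof.
move=> u0 h; apply/fine_cvgP; split.
  by have [n0 h0] := h 1%R ltr01; exists n0 => // n /= /h0 un; rewrite ge0_fin_numE// (le_lt_trans un) ?ltry.
apply/cvgr0Pnorm_le => e e0; have [n0 h0] := h e e0; exists n0 => // n /= /h0 un.
rewrite ger0_norm ?fine_ge0// -lee_fin fineK// ge0_fin_numE//.
exact: le_lt_trans un (ltry _).
Qed.

Section ErgodicProjection.
Context {R : realType} {d : measure_display} {T : measurableType d}.
Variable mu : {measure set T -> \bar R}.
Variables (rho : (T -> xcomplex R) -> \bar R) (phi : T -> T) (A : R).
Hypothesis sf : sigma_finite setT mu.
Hypothesis res : resonant mu.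
Hypothesis ri : ri_norm mu rho.
Hypothesis mphi : measurable_fun setT phi.
Hypothesis A1 : (1 <= A)%R.
Hypothesis phiA : forall n (E : set T), measurable E ->
  mu (iter n phi @^-1` E) <= A%:E * mu E.
Implicit Types (f g h : T -> xcomplex R) (a b : T -> R).

Let N := fnorm rho.
Let N' := assoc mu N.
Let rho' := assoc_norm mu rho.
Let X := bfspace rho.
Let X' := bfspace rho'.
Let Tphi := composition_operator (R := R) phi.

Let resN : resonant_nn mu := resonant_fnorm res.
Let BN : banach_norm mu N := banach_norm_fnorm ri.1.
Let inv : dist_invariant mu N := ri_dist_invariant ri.
Let NP := bn_fatou BN.
Let BN' : banach_norm mu N' := banach_norm_assoc BN.
Let NP' := bn_fatou BN'.

Let rhoN f : Mfun f -> rho f = N (absf f). Proof. exact: (rho_fnorm ri.1). Qed.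
Let rhoN' f : Mfun f -> rho' f = N' (absf f). Proof. by move=> _; exact: (assoc_norm_fnorm ri.1). Qed.
Let Nfin u : nnmeas u -> N u < +oo -> {ae mu, forall x, u x \is a fin_num}.
Proof. exact: (norm_lty_ae sf resN BN inv). Qed.
Let Nfin' u : nnmeas u -> N' u < +oo -> {ae mu, forall x, u x \is a fin_num}.
Proof. exact: (assoc_lty_ae sf resN BN inv). Qed.
Let A0 : (0 <= A)%R. Proof. exact: le_trans A1. Qed.

Let NA : phi_bounded phi A N.
Proof.
move=> n u uP; have iP := nnmeas_comp (measurable_iter mphi n) uP.
apply: (norm_dilate sf resN BN inv) => // s _; exact: (dist_iter phiA).
Qed.

Lemma continuous_Tphi : continuous_operator mu rho Tphi.
Proof. exact: (continuous_composition mphi A1 phiA NP rhoN NA). Qed.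

Hypothesis ACR : forall u, nnmeas u -> N u < +oo -> vanishing mu u.
Hypothesis ACR' : has_ACR mu rho'.

Let ACRN' v : nnmeas v -> N' v < +oo -> vanishing mu v.
Proof.
move=> vP Nv; apply: (ACR_vanishing ACR') => //.
by rewrite /fnorm rhoN' ?absf_embf//; have [] := Mplus_embf vP.
Qed.

Definition ergodic_op : (T -> xcomplex R) -> T -> xcomplex R := cplx (avg_limit mu phi A N).
Definition ergodic_assoc : (T -> xcomplex R) -> T -> xcomplex R :=
  cplx (associate_avg mu phi A N).

Let PR := avg_limit mu phi A N.
Let P := ergodic_op.
Let P' := ergodic_assoc.

Let PRP a : rspace N a -> [/\ limit_avg mu phi N a (PR a),
  absnorm N (PR a) <= A%:E * absnorm N a &
  acn_nn mu N (fun x => `|a x|%:E) -> cvg_avg phi N a (PR a)].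
Proof. exact: (avg_limitP mphi A1 phiA sf resN BN inv ACR ACRN'). Qed.

Let PRX a : rspace N a -> rspace N (PR a).
Proof. by case/PRP => -[]. Qed.

Let PRlin (s t : R) a b : rspace N a -> rspace N b ->
  {ae mu, forall x, PR (fun x => s * a x + t * b x)%R x = (s * PR a x + t * PR b x)%R}.
Proof. exact: (avg_limit_lin mphi A1 phiA sf resN BN inv ACR ACRN'). Qed.

Let PRae a b : rspace N a -> rspace N b -> {ae mu, forall x, a x = b x} ->
  {ae mu, forall x, PR a x = PR b x}.
Proof. exact: (avg_limit_ae mphi A1 phiA sf resN BN inv ACR ACRN'). Qed.

Let PRuniq a b : rspace N a -> limit_avg mu phi N a b -> {ae mu, forall x, PR a x = b x}.
Proof.
move=> aX ab; have [la _ _] := PRP aX.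
apply: (limit_avg_unique mphi A1 phiA sf resN BN aX.1 aX.1 _ la ab); exact: aeT.
Qed.

Let rX f : X f -> rspace N (re f) /\ rspace N (im f).
Proof. by move=> fX; split; [exact: (rspace_re NP rhoN) | exact: (rspace_im NP rhoN)]. Qed.

Let rX' f : X' f -> rspace N' (re f) /\ rspace N' (im f).
Proof. by move=> fX; split; [exact: (rspace_re NP' rhoN') | exact: (rspace_im NP' rhoN')]. Qed.

Lemma linear_ergodic_op : linear_operator mu X P.
Proof.
have h : forall a, rspace N a -> absnorm N (PR a) <= A%:E * absnorm N a by move=> a /PRP[].
exact: (linear_cplx NP rhoN Nfin PRX PRlin PRae (rspace_lin2 BN)).
Qed.

Let XP f : X f -> X (P f). Proof. by have [h _ _] := linear_ergodic_op; exact: h. Qed.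

Lemma continuous_ergodic_op : continuous_operator mu rho P.
Proof.
apply: (bounded_continuous NP rhoN (C := 2 * A)%R linear_ergodic_op); first by rewrite mulr_ge0.
move=> f fX; apply: (cplx_le NP rhoN PRX A0 _ fX).
by move=> a /PRP[].
Qed.

Let QP b : rspace N' b -> [/\ rspace N' (associate_avg mu phi A N b),
  absnorm N' (associate_avg mu phi A N b) <= A%:E * absnorm N' b &
  forall a, rspace N a ->
    (\int[mu]_x (PR a x * b x) = \int[mu]_x (a x * associate_avg mu phi A N b x))%R].
Proof. exact: (associate_avgP mphi A1 phiA sf resN BN inv ACR ACRN'). Qed.

Let QX b : rspace N' b -> rspace N' (associate_avg mu phi A N b).
Proof. by case/QP. Qed.

Lemma linear_ergodic_assoc : linear_operator mu X' P'.
Proof.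
apply: (linear_cplx NP' rhoN' Nfin' QX _ _ (rspace_lin2 BN')).
  exact: (associate_avg_lin mphi A1 phiA sf resN BN inv ACR ACRN').
exact: (associate_avg_ae mphi A1 phiA sf resN BN inv ACR ACRN').
Qed.

Lemma continuous_ergodic_assoc : continuous_operator mu rho' P'.
Proof.
apply: (bounded_continuous NP' rhoN' (C := 2 * A)%R linear_ergodic_assoc); first by rewrite mulr_ge0.
move=> f fX; apply: (cplx_le NP' rhoN' QX A0 _ fX).
by move=> a /QP[].
Qed.

Lemma ergodic_op_associate : mutually_associate mu rho P P'.
Proof.
move=> f g fX gX; have [fr fi] := rX fX; have [gr gi] := rX' gX.
have [P'X _ _] := linear_ergodic_assoc.
rewrite (cintegral_fmul sf res ri (XP fX) gX) (cintegral_fmul sf res ri fX (P'X _ gX)).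
have [_ _ hr] := QP gr; have [_ _ hi] := QP gi.
by congr Complex; congr (_ + _)%R; rewrite ?hr ?hi//; congr (- _)%R; rewrite ?hi.
Qed.

Lemma positive_ergodic_op : positive_operator mu X P.
Proof.
move=> f fX f0; have [fr fi] := rX fX.
have fin := X_fin rhoN Nfin fX.
have r0 : {ae mu, forall x, (0 <= re f x)%R}.
  apply: filterS2 f0 fin => x h e; move: h; rewrite e /= lecE /= => /andP[].
  by [].
have i0 : {ae mu, forall x, im f x = (0 * im f x + 0 * im f x)%R}.
  apply: filterS2 f0 fin => x h e; move: h; rewrite e /= lecE /= => /andP[/eqP].
  by rewrite !mul0r addr0.
have [lr _ _] := PRP fr.
have p0 := limit_avg_ge0 mphi A1 phiA sf resN BN inv ACR ACRN' fr lr r0.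
have q0 : {ae mu, forall x, PR (im f) x = 0%R}.
  apply: filterS2 (PRae fi (rspace_lin2 BN 0 0 fi fi) i0) (PRlin 0 0 fi fi) => x -> ->.
  by rewrite !mul0r addr0.
apply: filterS2 p0 q0 => x a0 b0.
by rewrite /P /ergodic_op /cplx /mkc /= lecE /= -/PR a0 b0 eqxx.
Qed.

(** * Convergence of the averages *)

Lemma cvg_cesaro (q : (T -> \bar R) -> \bar R) f : fatou_norm mu q -> X f ->
  cvg_avg phi q (re f) (PR (re f)) -> cvg_avg phi q (im f) (PR (im f)) ->
  q (absf (fsub (cesaro_mean Tphi f n) (P f))) @[n --> \oo] --> 0.
Proof.
move=> qP fX cr ci; have [fr fi] := rX fX.
have Xc n : X (cesaro_mean Tphi f n) by exact: (X_cesaro mphi A1 phiA NP rhoN Nfin NA).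
have Msub n := (X_fsub NP rhoN (Xc n) (XP fX)).1.
have mr n : measurable_fun setT (fun x => avgR phi n (re f) x - PR (re f) x)%R.
  by apply: measurable_funB; [exact: (measurable_avgR mphi n fr.1) | exact: (PRX fr).1].
have mi n : measurable_fun setT (fun x => avgR phi n (im f) x - PR (im f) x)%R.
  by apply: measurable_funB; [exact: (measurable_avgR mphi n fi.1) | exact: (PRX fi).1].
have le n : q (absf (fsub (cesaro_mean Tphi f n) (P f))) <=
    absnorm q (fun x => avgR phi n (re f) x - PR (re f) x)%R +
    absnorm q (fun x => avgR phi n (im f) x - PR (im f) x)%R.
  apply: le_trans (fatou_norm_mkc qP (mr n) (mi n)).
  rewrite le_eqVlt; apply/orP; left; apply/eqP.
  apply: (fatou_norm_ae qP (Msub n)); first by apply: Mfun_mkc; [exact: mr | exact: mi].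
  apply: filterS (cesaro_mean_fin mphi phiA n (X_fin rhoN Nfin fX)) => x cx.
  by rewrite /fsub cx /P /ergodic_op /cplx /mkc xsub_fin.
have c0 (a b : T -> R) : cvg_avg phi q a b -> (forall n, measurable_fun setT (fun x => avgR phi n a x - b x)%R) ->
    absnorm q (fun x => avgR phi n a x - b x)%R @[n --> \oo] --> 0.
  by move=> ab m; apply: cvge0_le; [move=> n; exact: (absnorm_ge0 qP (m n)) | exact: ab].
apply: (cvg_squeeze0 _ le).
  by move=> n; apply: (fn_ge0 qP); exact: nnmeas_absf (Msub n).
by rewrite -(adde0 0); apply: cvgeD => //; exact: c0.
Qed.

(** Families of seminorms for which the averages converge: [xi] always, and the norm when it is
  absolutely continuous. The decomposition is proved for both at once. *)
Definition ergodic_family (S : set ((T -> xcomplex R) -> \bar R)) :=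
  forall p, S p -> exists q, [/\ fatou_norm mu q,
  forall f, Mfun f -> p f = q (absf f) &
  forall a, rspace N a -> cvg_avg phi q a (PR a)].

Lemma ergodic_xi : ergodic_family (xi_family mu rho).
Proof.
move=> p /(xi_family_rdot ri)[v [vP Nv] pE]; exists (fun u => rdot mu u v); split.
- exact: fatou_norm_rdot.
- by move=> f _; exact: pE.
- by move=> a aX; have [[_ h] _ _] := PRP aX; exact: h.
Qed.

Lemma ergodic_norm : (forall u, nnmeas u -> N u < +oo -> acn_nn mu N u) ->
  ergodic_family (norm_family rho).
Proof.
move=> acn p ->; exists N; split; [exact: NP | exact: rhoN |].
move=> a aX; have [_ _] := PRP aX; apply; have [ma Na] := aX.
by apply: acn => //; exact: nnmeas_abs.
Qed.

Lemma cesaro_cvg S f : ergodic_family S -> X f -> lc_cvg X S (cesaro_mean Tphi f) (P f).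
Proof.
move=> SP fX; have [fr fi] := rX fX; apply: lc_cvgI.
  by move=> n; exact: (X_cesaro mphi A1 phiA NP rhoN Nfin NA).
move=> p /SP[q [qP pE qc]]; have := cvg_cesaro qP fX (qc _ fr) (qc _ fi).
apply: cvg_trans; apply: near_eq_cvg; apply: nearW => n; rewrite pE//.
have Xc := X_cesaro mphi A1 phiA NP rhoN Nfin NA n fX.
by have [] := X_fsub NP rhoN Xc (XP fX).
Qed.

Lemma acn_nn_le u v : nnmeas u -> nnmeas v -> (forall x, u x <= v x) ->
  acn_nn mu N v -> acn_nn mu N u.
Proof.
move=> uP vP uv va E mE E0.
have mi w k : nnmeas w -> nnmeas (fun x => w x * indic_fun (E k) x).
  by move=> wP; apply: nnmeasM => //; exact: nnmeas_indic.
apply: (cvg_squeeze0 _ _ (va E mE E0)) => k; first by apply: (fn_ge0 NP); exact: mi.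
apply: (fn_leT NP); [exact: mi | exact: mi|] => x.
by apply: lee_wpmul2r => //; rewrite indic_funE; case: ifP.
Qed.

Lemma cesaro_cvg_acn f : X f -> has_acn mu rho f ->
  lc_cvg X (norm_family rho) (cesaro_mean Tphi f) (P f).
Proof.
move=> fX fa; have [fr fi] := rX fX; have [Mf _] := fX.
have va := has_acn_acn_nn ri.1 Mf fa.
have vP := nnmeas_absf Mf.
apply: lc_cvgI; first by move=> n; exact: (X_cesaro mphi A1 phiA NP rhoN Nfin NA).
move=> p ->; have [_ _ cr] := PRP fr; have [_ _ ci] := PRP fi.
have ar : acn_nn mu N (fun x => `|re f x|%:E).
  by apply: acn_nn_le va => //; [exact: (nnmeas_abs fr.1) | move=> x; exact: xRe_le].
have ai : acn_nn mu N (fun x => `|im f x|%:E).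
  by apply: acn_nn_le va => //; [exact: (nnmeas_abs fi.1) | move=> x; exact: xIm_le].
have := cvg_cesaro NP fX (cr ar) (ci ai).
apply: cvg_trans; apply: near_eq_cvg; apply: nearW => n; rewrite rhoN//.
have Xc := X_cesaro mphi A1 phiA NP rhoN Nfin NA n fX.
by have [] := X_fsub NP rhoN Xc (XP fX).
Qed.

(** * The ergodic decomposition *)

Let K := op_ker mu X (id_sub Tphi).

Lemma op_kerP f : X f -> (K f <-> {ae mu, forall x, re f (phi x) = re f x} /\
  {ae mu, forall x, im f (phi x) = im f x}).
Proof.
move=> fX; have fin := X_fin rhoN Nfin fX; have finp := ae_comp mphi phiA fin.
split.
  move=> [_ f0]; have h : {ae mu, forall x, re f (phi x) = re f x /\ im f (phi x) = im f x}.
    apply: filterS3 f0 fin finp => x e0 e1 e2; move: e0.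
    rewrite /id_sub /fsub /Tphi /composition_operator e1 e2 /mkc xsub_fin => -[/eqP + /eqP +].
    by rewrite !subr_eq0 => /eqP -> /eqP ->.
  by split; apply: filterS h => x [].
move=> [hr hi]; split => //.
have h : {ae mu, forall x, re f (phi x) = re f x /\ im f (phi x) = im f x}.
  by apply: filterS2 hr hi => x; split.
apply: filterS3 h fin finp => x [e1 e2]; rewrite /id_sub /fsub /Tphi /composition_operator => -> ->.
by rewrite /mkc xsub_fin e1 e2 !subrr.
Qed.

Lemma op_ker_ergodic_op f : X f -> K (P f).
Proof.
move=> fX; have [fr fi] := rX fX; apply/op_kerP; first exact: XP.
have [lr _ _] := PRP fr; have [li _ _] := PRP fi.
by split; [exact: (limit_avg_fixed mphi A1 phiA sf resN BN inv fr lr) |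
  exact: (limit_avg_fixed mphi A1 phiA sf resN BN inv fi li)].
Qed.

Lemma ergodic_op_fixed f : K f -> eq_ae mu (P f) f.
Proof.
move=> Kf; have [fX _] := Kf; have [fr fi] := rX fX.
have [hr hi] := (op_kerP fX).1 Kf.
have er := PRuniq fr (limit_avg_of_fixed mphi A1 phiA resN fr hr).
have ei := PRuniq fi (limit_avg_of_fixed mphi A1 phiA resN fi hi).
by apply: filterS3 er ei (X_fin rhoN Nfin fX) => x e1 e2 ->; rewrite /P /ergodic_op /cplx /mkc -/PR e1 e2.
Qed.

Let PR_coboundary a b : rspace N a -> rspace N b ->
  {ae mu, forall x, a x = (b x - b (phi x))%R} -> {ae mu, forall x, PR a x = 0%R}.
Proof.
move=> aX bX ab; have [lb _ _] := PRP bX.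
have bpX := rspace_phi mphi A1 phiA sf resN BN inv bX.
have e1 := PRuniq bpX (limit_avg_phi mphi A1 phiA resN BN inv bX lb).
have bbX := rspace_lin2 BN 1 (-1) bX bpX.
have e2 : {ae mu, forall x, PR a x = PR (fun x => 1 * b x + (-1) * (b \o phi) x)%R x}.
  by apply: PRae => //; apply: filterS ab => x ->; rewrite mul1r mulN1r.
apply: filterS3 e1 e2 (PRlin 1 (-1) bX bpX) => x h1 -> ->.
by rewrite h1 mul1r mulN1r subrr.
Qed.

Let Im := op_im mu X (id_sub Tphi).

Lemma ergodic_op_coboundary h : Im h -> {ae mu, forall x, PR (re h) x = 0%R} /\
  {ae mu, forall x, PR (im h) x = 0%R}.
Proof.
move=> [hX [k kX hk]]; have [hr hi] := rX hX; have [kr ki] := rX kX.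
have fin := X_fin rhoN Nfin kX; have finp := ae_comp mphi phiA fin.
have E : {ae mu, forall x, re h x = (re k x - re k (phi x))%R /\ im h x = (im k x - im k (phi x))%R}.
  apply: filterS3 hk fin finp => x e0 e1 e2; move: e0.
  rewrite /id_sub /fsub /Tphi /composition_operator e1 e2 /mkc xsub_fin => e0.
  by split; [rewrite [LHS]/re e0 | rewrite [LHS]/im e0].
by split; [apply: (PR_coboundary hr kr) | apply: (PR_coboundary hi ki)];
  apply: filterS E => x [].
Qed.

(** The limit operator kills the closure of the image of [I - T_phi]: it is
  bounded for each seminorm of [xi] and kills the image itself. *)
Lemma closure_xi_ker g : lc_closure X (xi_family mu rho) Im g -> eq_ae mu (P g) (@fzero R d T).
Proof.
move=> [gX gc]; have [gr gi] := rX gX.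
have key (c : (T -> xcomplex R) -> T -> R) :
    (forall f, X f -> rspace N (c f)) -> (forall z : T -> xcomplex R, forall x, `|c z x|%:E <= xabs (z x)) ->
    (forall f h, X f -> X h -> {ae mu, forall x, c (fsub h f) x = (c h x - c f x)%R}) ->
    (forall h, Im h -> {ae mu, forall x, PR (c h) x = 0%R}) ->
    {ae mu, forall x, PR (c g) x = 0%R}.
  move=> cX cle csub cIm.
  apply: (rdot_separates sf resN BN); first exact: (PRX (cX _ gX)).1.
  move=> v vP Nv; apply: (@le_eps _ _ A) => // e e0.
  have qP := fatou_norm_rdot resN vP.
  pose U := [set h | X h /\ rdot mu (absf (fsub h g)) v < e%:E].
  have [h [hIm [hX hg]]] : Im `&` U !=set0.
    apply: gc; exists 1%N, (fun=> int_rearr_mul mu (embf v)), e; split => //.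
      by move=> _; exact: (xi_family_embf ri vP Nv).
    move=> h hX /(_ ord0) hh; split; first exact: hX.
      by rewrite rdotC -(absf_embf vP).
  have cgX := cX _ gX; have chX := cX _ hX.
  have gXs := rspace_lin2 BN 1 (-1) cgX chX.
  have [ls _ _] := PRP gXs.
  have mPg := (PRX cgX).1; have mPs := (PRX gXs).1.
  have e1 : {ae mu, forall x, PR (c g) x = PR (fun x => 1 * c g x + (-1) * c h x)%R x}.
    apply: filterS2 (PRlin 1 (-1) cgX chX) (cIm _ hIm) => x -> ->.
    by rewrite mul1r mulr0 addr0.
  apply: (@le_trans _ _ (absnorm (fun u => rdot mu u v) (PR (fun x => 1 * c g x + (-1) * c h x)%R))).
    apply: (fn_le qP); [exact: nnmeas_abs | exact: nnmeas_abs |].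
    by apply: filterS e1 => x ->.
  apply: le_trans (limit_avg_bound mphi A1 phiA resN gXs ls vP Nv) _.
  rewrite EFinM; apply: lee_wpmul2l; first by rewrite lee_fin.
  apply: le_trans (ltW hg); apply: (fn_le qP).
  - exact: (nnmeas_abs gXs.1).
  - by apply: nnmeas_absf; have [] := X_fsub NP rhoN hX gX.
  - apply: filterS (csub _ _ gX hX) => x cx.
    apply: le_trans (cle _ x); rewrite cx mul1r mulN1r lee_fin.
    by rewrite -normrN opprB addrC.
have pr : {ae mu, forall x, PR (re g) x = 0%R}.
  apply: (key re) => //.
  - by move=> f fX; have [] := rX fX.
  - by move=> z x; exact: xRe_le.
  - by move=> f h fX hX; apply: filterS (sub_fin rhoN Nfin hX fX) => x e; rewrite [LHS]/re e.
  - by move=> h /ergodic_op_coboundary[].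
have pi : {ae mu, forall x, PR (im g) x = 0%R}.
  apply: (key im) => //.
  - by move=> f fX; have [] := rX fX.
  - by move=> z x; exact: xIm_le.
  - by move=> f h fX hX; apply: filterS (sub_fin rhoN Nfin hX fX) => x e; rewrite [LHS]/im e.
  - by move=> h /ergodic_op_coboundary[].
by apply: filterS2 pr pi => x e1 e2; rewrite /P /ergodic_op /cplx /mkc -/PR e1 e2.
Qed.

Let XC n f : X f -> X (cesaro_mean Tphi f n).
Proof. exact: (X_cesaro mphi A1 phiA NP rhoN Nfin NA). Qed.

Let Xsub f g : X f -> X g -> X (fsub f g).
Proof. exact: (X_fsub NP rhoN). Qed.

(** The difference between [f] and its averages lies in the image of [I - T_phi], and converges to
  [f - P f]. *)
Lemma id_sub_ergodic_op_closure S f : ergodic_family S -> X f -> lc_closure X S Im (id_sub P f).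
Proof.
move=> SP fX; have PfX := XP fX; split; first exact: Xsub.
move=> U [k [p [e [pS e0 h]]]].
have cS j : \forall n \near \oo, p j (fsub (fsub f (cesaro_mean Tphi f n)) (id_sub P f)) < e%:E.
  have [q [qP pE qc]] := SP _ (pS j); have [fr fi] := rX fX.
  have := cvge_near_lt (cvg_cesaro qP fX (qc _ fr) (qc _ fi)) (_ : 0 < e%:E).
  rewrite lte_fin => /(_ e0); apply: filterS => n.
  have X1 := Xsub (XC n fX) PfX; have X2 := Xsub (Xsub fX (XC n fX)) (Xsub fX PfX).
  rewrite (pE _ X2.1); apply: le_lt_trans; rewrite le_eqVlt; apply/orP; left; apply/eqP.
  have M1 := Mfun_fscale (-1)%R X1.1.
  transitivity (q (absf (fscale (-1)%R (fsub (cesaro_mean Tphi f n) (P f))))).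
    apply: (fatou_norm_ae qP X2.1 M1).
    apply: filterS2 (X_fin rhoN Nfin fX) (cesaro_mean_fin mphi phiA n (X_fin rhoN Nfin fX)) => x fx cx.
    rewrite /fsub /fscale cx /id_sub /fsub fx /P /ergodic_op /cplx /mkc !xsub_fin xscale_fin.
    by congr (XFin (Complex _ _)); rewrite /=; ring.
  congr q; apply/funext => x; rewrite absf_fscale.
  by rewrite normcN normc1 mul1e.
have : \forall n \near \oo, forall j : 'I_k,
    p j (fsub (fsub f (cesaro_mean Tphi f n)) (id_sub P f)) < e%:E by exact: filter_forall.
move=> [n0 _ hn]; have {}hn := hn n0.+1 (leqnSn n0).
exists (fsub f (cesaro_mean Tphi f n0.+1)); split.
  exact: (sub_cesaro_im mphi A1 phiA NP rhoN Nfin NA).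
by apply: h => //; apply: Xsub => //; exact: XC.
Qed.

Lemma lc_closure_ae S B f g : (forall p, S p -> exists q, fatou_norm mu q /\
    forall h, Mfun h -> p h = q (absf h)) ->
  X f -> X g -> eq_ae mu f g -> lc_closure X S B f -> lc_closure X S B g.
Proof.
move=> SP fX gX fg [_ fB]; split => // U [k [p [e [pS e0 h]]]]; apply: fB.
exists k, p, e; split => // u uX up; apply: h => // j.
have [q [qP pE]] := SP _ (pS j); have := up j.
have X1 := Xsub uX fX; have X2 := Xsub uX gX.
rewrite (pE _ X1.1) (pE _ X2.1) (fatou_norm_ae qP X1.1 X2.1)//.
by apply: filterS fg => x; rewrite /fsub => ->.
Qed.

(** Elements of the kernel of [P] are limits of elements of the image, by
  [id_sub_ergodic_op_closure]; conversely, the closure for any family that is finer than [xi] lies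
  in the closure for [xi], which [P] kills. *)
Lemma closureE S : ergodic_family S -> lc_coarser X (xi_family mu rho) S ->
  lc_closure X S Im = op_ker mu X P.
Proof.
move=> SP xiS; apply/seteqP; split => g.
  move=> gc; split; first by case: gc.
  apply: closure_xi_ker; apply: lc_closure_coarser xiS _ gc => f h fX hX; exact: Xsub.
move=> [gX Pg]; have := id_sub_ergodic_op_closure SP gX.
apply: lc_closure_ae => //; last 2 first.
- exact: Xsub gX (XP gX).
- apply: filterS2 Pg (X_fin rhoN Nfin gX) => x Pgx gx.
  by rewrite /id_sub /fsub Pgx /fzero /xzero gx /mkc xsub_fin !subr0.
by move=> p /SP[q [qP pE _]]; exists q.
Qed.

Lemma linear_id_sub L : linear_operator mu X L -> linear_operator mu X (id_sub L).
Proof.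
move=> [LX Le Ll]; split.
- by move=> f fX; apply: Xsub => //; exact: LX.
- move=> f g fX gX fg; apply: filterS2 fg (Le _ _ fX gX fg) => x e1 e2.
  by rewrite /id_sub /fsub e1 e2.
move=> k f g fX gX.
have h : {ae mu, forall x, (f x = mkc (re f) (im f) x /\ g x = mkc (re g) (im g) x) /\
    (L f x = mkc (re (L f)) (im (L f)) x /\ L g x = mkc (re (L g)) (im (L g)) x)}.
  have fin2 f1 f2 : X f1 -> X f2 -> {ae mu, forall x, f1 x = mkc (re f1) (im f1) x /\
      f2 x = mkc (re f2) (im f2) x}.
    by move=> X1 X2; apply: filterS2 (X_fin rhoN Nfin X1) (X_fin rhoN Nfin X2) => x; split.
  by apply: filterS2 (fin2 _ _ fX gX) (fin2 _ _ (LX _ fX) (LX _ gX)) => x; split.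
apply: filterS2 h (Ll k f g fX gX) => x [[e1 e2] [e3 e4]] e5.
rewrite /id_sub /fsub e5 /fadd /fscale e1 e2 e3 e4 /mkc.
rewrite !(xsub_fin, xadd_fin, xscale_fin).
by congr (XFin (Complex _ _)); ring.
Qed.

Lemma subspace_op_ker L : linear_operator mu X L -> Defs.subspace X (op_ker mu X L).
Proof.
move=> [LX Le Ll]; have zX : X (@fzero R d T) by exact: (X_fzero NP rhoN).
split.
- by move=> f [].
- split => //; have := Ll (-1)%R _ _ zX zX.
  rewrite (_ : fadd (fscale (-1)%R fzero) fzero = @fzero R d T); last first.
    apply/funext => x; rewrite /fadd /fscale /fzero /xzero xscale_fin xadd_fin.
    by rewrite !mulr0 subr0 !addr0.
  move=> h; apply: filterS2 h (X_fin rhoN Nfin (LX _ zX)) => x e0 e.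
  rewrite e0 /fadd /fscale e /mkc xscale_fin xadd_fin /fzero /xzero.
  by congr (XFin (Complex _ _)); rewrite /=; ring.
move=> k f g [fX f0] [gX g0]; split.
  by apply: (X_fadd NP rhoN) => //; exact: (X_fscale NP rhoN).
apply: filterS3 (Ll k f g fX gX) f0 g0 => x -> e1 e2.
rewrite /fadd /fscale e1 e2 /fzero /xzero xscale_fin xadd_fin.
by rewrite !mulr0 subr0 !addr0.
Qed.

Section Decomposition.
Variable S : set ((T -> xcomplex R) -> \bar R).
Hypothesis SP : ergodic_family S.
Hypothesis xiS : lc_coarser X (xi_family mu rho) S.

Lemma ergodic_op_idempotent f : X f -> eq_ae mu (P (P f)) (P f).
Proof. by move=> fX; apply: ergodic_op_fixed; exact: op_ker_ergodic_op. Qed.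

Lemma projection_ergodic_op : projection_onto mu X P K.
Proof.
split; first exact: linear_ergodic_op.
- exact: ergodic_op_idempotent.
- exact: op_ker_ergodic_op.
move=> g Kg; exists g; first by case: Kg.
by apply: filterS (ergodic_op_fixed Kg).
Qed.

Lemma projection_id_sub_ergodic_op : projection_onto mu X (id_sub P) (lc_closure X S Im).
Proof.
split; first exact: (linear_id_sub linear_ergodic_op).
- move=> f fX; have := id_sub_ergodic_op_closure SP fX; rewrite (closureE SP xiS) => -[gX g0].
  apply: filterS2 g0 (X_fin rhoN Nfin gX) => x e1 e2.
  by rewrite {1}/id_sub /fsub e1 e2 /fzero /xzero /mkc xsub_fin !subr0.
- by move=> f fX; exact: id_sub_ergodic_op_closure.
move=> g; rewrite (closureE SP xiS) => -[gX g0]; exists g => //.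
apply: filterS2 g0 (X_fin rhoN Nfin gX) => x e1 e2.
by rewrite /id_sub /fsub e1 e2 /fzero /xzero /mkc xsub_fin !subr0.
Qed.

Lemma ergodic_direct_sum : direct_sum mu X K (lc_closure X S Im).
Proof.
split.
- by apply: subspace_op_ker; apply: linear_id_sub; have [] := continuous_Tphi.
- by rewrite (closureE SP xiS); apply: subspace_op_ker; exact: linear_ergodic_op.
- move=> f fX; exists (P f), (id_sub P f); split.
  + exact: op_ker_ergodic_op.
  + exact: id_sub_ergodic_op_closure.
  apply: filterS2 (X_fin rhoN Nfin fX) (X_fin rhoN Nfin (XP fX)) => x e1 e2.
  rewrite /fadd /id_sub /fsub e2 e1 /mkc xsub_fin xadd_fin.
  by congr (XFin (Complex _ _)); ring.
move=> f Kf; rewrite (closureE SP xiS) => -[fX f0].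
by apply: filterS2 f0 (ergodic_op_fixed Kf) => x <-.
Qed.

End Decomposition.

End ErgodicProjection.

(** * Mean ergodicity of the composition operator *)

Lemma space_acn_nn {R : realType} {d : measure_display} {T : measurableType d}
    (mu : {measure set T -> \bar R}) (rho : (T -> xcomplex R) -> \bar R) :
  banach_function_norm mu rho -> space_has_acn mu rho ->
  forall u, nnmeas u -> fnorm rho u < +oo -> acn_nn mu (fnorm rho) u.
Proof.
move=> B acn u uP Nu; have [Mu _] := Mplus_embf uP.
by have := has_acn_acn_nn B Mu (acn _ (conj Mu Nu)); rewrite absf_embf.
Qed.

Theorem theorem1p1 (R : realType) (d : measure_display) (T : measurableType d)
    (mu : {measure set T -> \bar R}) (rho : (T -> xcomplex R) -> \bar R)
    (phi : T -> T) :
  sigma_finite [set: T] mu -> resonant mu -> ri_norm mu rho ->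
  has_ACR mu (assoc_norm mu rho) ->
  measurable_fun [set: T] phi ->
  (exists A : R, (0 < A)%R /\
    forall n : nat, (1 <= n)%N -> forall E : set T, measurable E ->
      mu (iter n phi @^-1` E) <= A%:E * mu E) ->
  let X := bfspace rho in
  let rho' := assoc_norm mu rho in
  let Tphi := composition_operator phi in
  let norm := norm_family rho in
  let xi := xi_family mu rho in
  let weak := weak_family mu rho in
  continuous_operator mu rho Tphi /\
  (space_has_acn mu rho ->
    exists P : (T -> xcomplex R) -> T -> xcomplex R,
      [/\ continuous_operator mu rho P,
          forall f, X f -> lc_cvg X norm (cesaro_mean Tphi f) (P f),
          positive_operator mu X P &
          exists P', continuous_operator mu rho' P' /\ mutually_associate mu rho P P'] /\
      [/\ projection_onto mu X P (op_ker mu X (id_sub Tphi)),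
          projection_onto mu X (id_sub P)
            (lc_closure X norm (op_im mu X (id_sub Tphi))) &
          direct_sum mu X (op_ker mu X (id_sub Tphi))
            (lc_closure X norm (op_im mu X (id_sub Tphi)))]) /\
  (~ space_has_acn mu rho -> has_ACR mu rho ->
    exists P : (T -> xcomplex R) -> T -> xcomplex R,
      [/\ continuous_operator mu rho P,
          forall f, X f -> has_acn mu rho f ->
            lc_cvg X norm (cesaro_mean Tphi f) (P f) &
          forall f, X f -> lc_cvg X xi (cesaro_mean Tphi f) (P f)] /\
      [/\ (forall p, xi p -> seminorm_on X p),
          lc_weaker X xi norm &
          lc_weaker X weak xi] /\
      [/\ positive_operator mu X P &
          exists P', continuous_operator mu rho' P' /\ mutually_associate mu rho P P'] /\
      [/\ projection_onto mu X P (op_ker mu X (id_sub Tphi)),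
          projection_onto mu X (id_sub P)
            (lc_closure X xi (op_im mu X (id_sub Tphi))) &
          direct_sum mu X (op_ker mu X (id_sub Tphi))
            (lc_closure X xi (op_im mu X (id_sub Tphi)))]).
Proof.
move=> sf res ri acr' mphi [A [A0 phiA]] X rho' Tphi norm xi weak.
(* The bound is enlarged so as to cover the zeroth iterate as well. *)
pose B : R := Num.max A 1%R.
have B1 : (1 <= B)%R by rewrite le_max lexx orbT.
have phiB n (E : set T) : measurable E -> mu (iter n phi @^-1` E) <= B%:E * mu E.
  move=> mE; case: n => [|n].
    by rewrite -[leLHS]mul1e; apply: lee_wpmul2r => //; rewrite lee_fin.
  apply: le_trans (phiA n.+1 isT E mE) _; apply: lee_wpmul2r => //.
  by rewrite lee_fin le_max lexx.
have [brho inv] := ri.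
split; first exact: (continuous_Tphi sf res ri mphi B1 phiB).
have Xs f g : X f -> X g -> X (fsub g f) by move=> fX gX; exact: (X_sub ri fX gX).
have xi_norm : lc_coarser X xi norm by exact: (xi_coarser_norm res ri).
have xi_xi : lc_coarser X xi xi.
  move=> p xip; exists p, 1%R; split => //; last by move=> h _; rewrite mul1e.
  by move=> h hX; have [/(_ h hX)/andP[]] := xi_seminorm res ri xip.
split=> [acn|_ acr].
  have acnN := space_acn_nn brho acn.
  have ACR u : nnmeas u -> fnorm rho u < +oo -> vanishing mu u.
    move=> uP Nu; apply: (acn_vanishing sf (banach_norm_fnorm brho) (ri_dist_invariant ri) uP).
    exact: acnN.
  have en := ergodic_norm sf res ri mphi B1 phiB ACR acr' acnN.
  exists (ergodic_op mu rho phi B); split; split.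
  - exact: (continuous_ergodic_op sf res ri mphi B1 phiB ACR acr').
  - by move=> f fX; exact: (cesaro_cvg sf res ri mphi B1 phiB ACR acr' en fX).
  - exact: (positive_ergodic_op sf res ri mphi B1 phiB ACR acr').
  - exists (ergodic_assoc mu rho phi B); split.
      exact: (continuous_ergodic_assoc sf res ri mphi B1 phiB ACR acr').
    exact: (ergodic_op_associate sf res ri mphi B1 phiB ACR acr').
  - exact: (projection_ergodic_op sf res ri mphi B1 phiB ACR acr').
  - exact: (projection_id_sub_ergodic_op sf res ri mphi B1 phiB ACR acr' en xi_norm).
  - exact: (ergodic_direct_sum sf res ri mphi B1 phiB ACR acr' en xi_norm).
have ACR := ACR_vanishing acr.
have ex := ergodic_xi sf res ri mphi B1 phiB ACR acr'.
exists (ergodic_op mu rho phi B); split; [|split; [|split]]; split.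
- exact: (continuous_ergodic_op sf res ri mphi B1 phiB ACR acr').
- by move=> f fX fa; exact: (cesaro_cvg_acn sf res ri mphi B1 phiB ACR acr' fX fa).
- by move=> f fX; exact: (cesaro_cvg sf res ri mphi B1 phiB ACR acr' ex fX).
- by move=> p; exact: (xi_seminorm res ri).
- exact: (lc_weaker_coarser Xs xi_norm).
- exact: (lc_weaker_coarser Xs (weak_coarser_xi res ri)).
- exact: (positive_ergodic_op sf res ri mphi B1 phiB ACR acr').
- exists (ergodic_assoc mu rho phi B); split.
    exact: (continuous_ergodic_assoc sf res ri mphi B1 phiB ACR acr').
  exact: (ergodic_op_associate sf res ri mphi B1 phiB ACR acr').
- exact: (projection_ergodic_op sf res ri mphi B1 phiB ACR acr').
- exact: (projection_id_sub_ergodic_op sf res ri mphi B1 phiB ACR acr' ex xi_xi).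
- exact: (ergodic_direct_sum sf res ri mphi B1 phiB ACR acr' ex xi_xi).
Qed.
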